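(* Every parity-HIST machine can be simulated by a sliding-window transformer without using positional encodings. Consequently, sliding-window transformers without positional encodings are Turing complete.
   Context: ''Turing complete'' means equivalent to Turing machines in terms of computational power. ''Simulated'' is meant in the usual sense: the autoregressive generation of the transformer reproduces the execution of the machine transition by transition. **Parity-HIST machines.** A parity-HIST machine is a tuple $(\Sigma,Q,\delta,q_{\mathrm{start}},q_{\mathrm{halt}})$, where $\Sigma$ is a finite alphabet containing a blank symbol $\perp$, a start symbol $\triangleright$, and $0,1$; $Q$ is a finite set of states containing $q_{\mathrm{start}}$ and $q_{\mathrm{halt}}$; and $\delta:Q\times\{0,1\}^{\Sigma}\to Q\times(\Sigma\cup\Sigma^2)$. On input $x\in\{0,1\}^*$ its initial window is $W_0=x$ and its initial state is $q_0=q_{\mathrm{start}}$. Until it enters $q_{\mathrm{halt}}$, it computes $(q_{t+1},a_t)=\delta(q_t,\mathsf{hist}(W_t)\bmod 2)$ and its next window is $W_{t+1}=\mathsf{tail}(W_t\,\|\,a_t)$. Here $\mathsf{hist}(W)\in\mathbb{N}^\Sigma$ is the vector of numbers of occurrences of each symbol in $W$, $\|$ is concatenation, and $\mathsf{tail}$ deletes the first symbol of a nonempty word. **Sliding-window transformer without positional encodings (single head, single layer).** Let $\mathcal V$ be a finite vocabulary, each token $v$ carrying an update bit $\gamma(v)\in\{0,1\}$. The parameters are an embedding $\mathrm{emb}:\mathcal V\to\mathbb{R}^D$, matrices $\mathbf Q,\mathbf K,\mathbf V\in\mathbb{R}^{D\times D}$, and a multi-layer ReLU network $f_{\mathrm{mlp}}$.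 Given the context window $C=(v_{i-m+1},\dots,v_i)$, $m=|C|$, the next token $v_{i+1}$ is computed as follows. - $h^0_j=\mathrm{emb}(v_j)$ (no positional information is added). - $\alpha_{i,j}=\exp\langle \mathbf Qh^0_i,\mathbf Kh^0_j\rangle\big/\sum_{k=i-m+1}^{i}\exp\langle \mathbf Qh^0_i,\mathbf Kh^0_k\rangle$ for $j=i-m+1,\dots,i$. - $h^{0.5}_i=h^0_i+\sum_{j=i-m+1}^{i}\alpha_{i,j}\mathbf Vh^0_j$. - $h^1_i=f_{\mathrm{mlp}}(h^{0.5}_i)+h^{0.5}_i$. - $v_{i+1}=\operatorname{argmax}_{v\in\mathcal V}\mathrm{emb}(v)^\top h^1_i$. The initial context window is the whole prompt. After generating $w=v_{i+1}$, the window is updated to $C\,\|\,w$ if $\gamma(w)=1$, and to $\mathsf{tail}(C)\,\|\,w$ if $\gamma(w)=0$. **Precision setting.** The token alphabet and the number of learnable parameters are constant, but the arithmetic precision is allowed to be non-constant: logarithmic-precision arithmetic is used, namely $O(\log S)$-bit inference precision for an execution in which the window of the parity-HIST machine has length at most $S$.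
   Formalization: In the Turing-completeness equivalence the transformer parameters are required to have finitely many bits (dyadic); with arbitrary real parameters read at growing precision, uncountably many problems would be computed, so equivalence with Turing machines would fail. *)

(* Defs.v *)
(* MathComp / MathComp-Analysis; the real numbers are an arbitrary [realType]. *)
From HB Require Import structures.
From mathcomp Require Import all_boot all_order all_algebra.
From mathcomp Require Import reals sequences exp.
Set Implicit Arguments.
Unset Strict Implicit.
Unset Printing Implicit Defensive.
Import Order.TTheory GRing.Theory Num.Theory.
Local Open Scope ring_scope.

(** * Parity-HIST machines *)

Definition hist (S : finType) (w : seq S) : {ffun S -> nat} :=
  [ffun s => count_mem s w].

Definition hist_mod2 (S : finType) (w : seq S) : {ffun S -> bool} :=
  [ffun s => odd (hist w s)].

Record parity_hist := ParityHist {
  ph_sym : finType;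
  ph_blank : ph_sym;
  ph_begin : ph_sym;
  ph_zero : ph_sym;
  ph_one : ph_sym;
  ph_sym_uniq : uniq [:: ph_blank; ph_begin; ph_zero; ph_one];
  ph_state : finType;
  ph_start : ph_state;
  ph_halt : ph_state;
  ph_delta : ph_state -> {ffun ph_sym -> bool} ->
             ph_state * (ph_sym + ph_sym * ph_sym)
}.

Definition word_of (S : Type) (a : S + S * S) : seq S :=
  match a with inl u => [:: u] | inr (u, v) => [:: u; v] end.

Section ParityHist.
Variable M : parity_hist.

Definition ph_input (x : seq bool) : seq (ph_sym M) :=
  [seq if b then ph_one M else ph_zero M | b <- x].

Definition ph_config : Type := ph_state M * seq (ph_sym M).

Definition ph_step (c : ph_config) : ph_config :=
  if c.1 == ph_halt M then c else
  let: (q, a) := ph_delta c.1 (hist_mod2 c.2) in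
  (q, behead (c.2 ++ word_of a)).

(* [(q_t, W_t)], kept constant once the halting state has been entered. *)
Definition ph_run (x : seq bool) (t : nat) : ph_config :=
  iter t ph_step (ph_start M, ph_input x).

End ParityHist.

(** * Sliding-window transformers without positional encodings *)

Inductive relu_net (R : Type) : nat -> nat -> Type :=
| Affine m n of 'M[R]_(n, m) & 'cV[R]_n : relu_net R m n
| Hidden m k n of 'M[R]_(k, m) & 'cV[R]_k & relu_net R k n : relu_net R m n.

Record swt (R : Type) := Swt {
  vocab : finType;
  grow : vocab -> bool;   (* the update bit gamma *)
  dim : nat;
  emb : vocab -> 'cV[R]_dim;
  WQ : 'M[R]_dim;
  WK : 'M[R]_dim;
  WV : 'M[R]_dim;
  mlp : relu_net R dim dim
}.

(* Inference is parameterised by a rounding function [rd], applied to every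
   parameter and to the result of every elementary operation; sums are
   accumulated one term at a time.  With [rd := id] these are the exact
   real-valued formulas. *)
Section Inference.
Variables (R : realType) (rd : R -> R).

Definition radd (x y : R) : R := rd (x + y).
Definition rmul (x y : R) : R := rd (x * y).

Definition rdot n (u v : 'cV[R]_n) : R :=
  \big[radd/0]_(i < n) rmul (u i 0) (v i 0).

Definition rmulmx m n (A : 'M[R]_(m, n)) (u : 'cV[R]_n) : 'cV[R]_m :=
  \col_i \big[radd/0]_(j < n) rmul (A i j) (u j 0).

Definition raddv n (u v : 'cV[R]_n) : 'cV[R]_n :=
  \col_i radd (u i 0) (v i 0).

Definition load m n (A : 'M[R]_(m, n)) : 'M[R]_(m, n) := map_mx rd A.

Definition relu n (u : 'cV[R]_n) : 'cV[R]_n := map_mx (Num.max 0) u.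

Fixpoint net_eval m n (N : relu_net R m n) : 'cV[R]_m -> 'cV[R]_n :=
  match N with
  | Affine _ _ A b => fun u => raddv (rmulmx (load A) u) (load b)
  | Hidden _ _ _ A b N' =>
      fun u => net_eval N' (relu (raddv (rmulmx (load A) u) (load b)))
  end.

Variable T : swt R.

Definition h0 (v : vocab T) : 'cV[R]_(dim T) := load (emb v).

Definition att_exp (vi v : vocab T) : R :=
  rd (expR (rdot (rmulmx (load (WQ T)) (h0 vi)) (rmulmx (load (WK T)) (h0 v)))).

(* The weight alpha_(i,j) depends on the position j only through the token
   at that position. *)
Definition att_weight (C : seq (vocab T)) (vi v : vocab T) : R :=
  rd (att_exp vi v / \big[radd/0]_(w <- C) att_exp vi w).

Definition h_half (C : seq (vocab T)) (vi : vocab T) : 'cV[R]_(dim T) :=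
  raddv (h0 vi)
    (\col_d \big[radd/0]_(v <- C)
        rmul (att_weight C vi v) (rmulmx (load (WV T)) (h0 v) d 0)).

Definition h1 (C : seq (vocab T)) (vi : vocab T) : 'cV[R]_(dim T) :=
  raddv (net_eval (mlp T) (h_half C vi)) (h_half C vi).

Definition logit (C : seq (vocab T)) (vi v : vocab T) : R :=
  rdot (h0 v) (h1 C vi).

(* The argmax has to be attained at a unique token: on a tie, or on an empty
   window, no token is generated, so that nothing depends on how ties would be
   broken. *)
Definition next_token (C : seq (vocab T)) : option (vocab T) :=
  if C is v0 :: C' then
    let vi := last v0 C' in
    [pick v | [forall u, (u != v) ==> (logit C vi u < logit C vi v)]]
  else None.

Definition slide (C : seq (vocab T)) (w : vocab T) : seq (vocab T) :=
  if grow w then rcons C w else rcons (behead C) w.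

Definition swt_step (C : seq (vocab T)) : option (seq (vocab T)) :=
  omap (slide C) (next_token C).

End Inference.

(** * Finite precision *)

(* Rounding to the nearest [p]-bit fixed-point number [k / 2 ^ (p / 2)], where
   [k] is a signed [p]-bit integer; values out of range saturate. *)
Definition fixpt (R : realType) (p : nat) (x : R) : R :=
  let k := Num.floor (x * 2 ^+ p./2 + 2^-1) in
  (Num.min (Num.max (- 2 ^+ p.-1) k) (2 ^+ p.-1 - 1))%:~R / 2 ^+ p./2.

Definition log_bits (c n : nat) : nat := (c * (trunc_log 2 n).+1)%N.

(* The window after [i] generated tokens, starting from the prompt [C]; the
   number of bits is a function [prec] of the current window length. *)
Definition swt_run (R : realType) (T : swt R) (prec : nat -> nat)
    (C : seq (vocab T)) (i : nat) : option (seq (vocab T)) :=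
  iter i (obind (fun C' => swt_step (fixpt (prec (size C'))) C')) (Some C).

Definition dyadic (R : realType) (x : R) : Prop :=
  exists (m : int) (k : nat), x = m%:~R / 2 ^+ k.

Definition dyadic_mx (R : realType) m n (A : 'M[R]_(m, n)) : Prop :=
  forall i j, dyadic (A i j).

Fixpoint dyadic_net (R : realType) m n (N : relu_net R m n) : Prop :=
  match N with
  | Affine _ _ A b => dyadic_mx A /\ dyadic_mx b
  | Hidden _ _ _ A b N' => [/\ dyadic_mx A, dyadic_mx b & dyadic_net N']
  end.

(* Every parameter has finitely many bits.  Arbitrary real parameters, read to
   a precision that grows with the window, would act as an infinite advice
   string. *)
Definition finite_params (R : realType) (T : swt R) : Prop :=
  (forall v : vocab T, dyadic_mx (emb v)) /\
  [/\ dyadic_mx (WQ T), dyadic_mx (WK T), dyadic_mx (WV T)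
    & dyadic_net (mlp T)].

(** * Prompts *)

(* A prompt is the output of a sequential finite-state transducer on the input
   bits: the tokens standing for a bit can depend on the bits before it only
   through a finite state. *)
Record prompter (V : Type) := Prompter {
  pr_state : finType;
  pr_init : pr_state;
  pr_next : pr_state -> bool -> pr_state;
  pr_out : pr_state -> bool -> seq V;
  pr_final : pr_state -> seq V
}.

Fixpoint prompt_from V (E : prompter V) (k : pr_state E) (x : seq bool)
    : seq V :=
  if x is b :: x' then pr_out k b ++ prompt_from (pr_next k b) x'
  else pr_final k.

Definition prompt V (E : prompter V) (x : seq bool) : seq V :=
  prompt_from (pr_init E) x.

Definition olast V (s : seq V) : option V :=
  if s is v :: s' then Some (last v s') else None.

(** * Simulation *)

(* [sym v] is the symbol carried by the token [v] ([None] for an auxiliary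
   token).  [st v = Some q] marks the end of the block of tokens that performs
   one transition, [q] being the state reached. *)
Definition represents V (M : parity_hist)
    (sym : V -> option (ph_sym M)) (st : V -> option (ph_state M))
    (C : seq V) (c : ph_config M) : Prop :=
  obind st (olast C) = Some c.1 /\ pmap sym C = c.2.

(* For every prefix of an execution whose windows have length at most [S],
   generation with O(log S) bits passes through windows representing all its
   configurations, in order, each transition taking at least one and at most
   [k] generated tokens; [tm s] is the number of tokens generated when
   configuration [s] is reached.  The transformer, the prompts, the readout
   [sym], [st] and the constants [k], [c] do not depend on the input, on [S] or
   on the length of the execution. *)
Definition simulates (R : realType) (T : swt R) (M : parity_hist) : Prop :=
  exists (E : prompter (vocab T))
         (sym : vocab T -> option (ph_sym M))
         (st : vocab T -> option (ph_state M)) (k c : nat),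
  forall (x : seq bool) (S t : nat),
    (forall s, (s < t)%N -> (ph_run M x s).1 != ph_halt M) ->
    (forall s, (s <= t)%N -> (size (ph_run M x s).2 <= S)%N) ->
    let window := swt_run (fun=> log_bits c S) (prompt E x) in
    exists tm : nat -> nat,
      [/\ tm 0%N = 0%N,
          forall s, (s <= t)%N ->
            exists2 C, window (tm s) = Some C
                     & represents sym st C (ph_run M x s),
          forall s, (s < t)%N -> (tm s < tm s.+1 <= tm s + k)%N
        & forall s i, (s < t)%N -> (tm s < i < tm s.+1)%N ->
            exists2 C, window i = Some C & obind st (olast C) = None].

(** * Turing machines and Turing completeness *)

Inductive move := MoveLeft | MoveRight | Stay.

(* Deterministic machines with one two-way infinite tape. *)
Record turing_machine := TuringMachine {
  tm_sym : finType;
  tm_blank : tm_sym;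
  tm_zero : tm_sym;
  tm_one : tm_sym;
  tm_sym_uniq : uniq [:: tm_blank; tm_zero; tm_one];
  tm_state : finType;
  tm_start : tm_state;
  tm_accept : tm_state;
  tm_reject : tm_state;
  tm_answers : tm_accept != tm_reject;
  tm_delta : tm_state -> tm_sym -> tm_state * tm_sym * move
}.

Section TuringMachine.
Variable M : turing_machine.

(* [(q, l, r)]: the scanned cell is the head of [r], and [l] lists the cells to
   its left, nearest first; all the cells not listed are blank. *)
Definition tm_config : Type := tm_state M * seq (tm_sym M) * seq (tm_sym M).

Definition tm_step (c : tm_config) : tm_config :=
  let: (q, l, r) := c in
  if (q == tm_accept M) || (q == tm_reject M) then c else
  let: (q', a, d) := tm_delta q (head (tm_blank M) r) in
  match d with
  | MoveLeft => (q', behead l, head (tm_blank M) l :: a :: behead r)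
  | MoveRight => (q', a :: l, behead r)
  | Stay => (q', l, a :: behead r)
  end.

Definition tm_input (x : seq bool) : seq (tm_sym M) :=
  [seq if b then tm_one M else tm_zero M | b <- x].

Definition tm_run (x : seq bool) (t : nat) : tm_config :=
  iter t tm_step (tm_start M, [::], tm_input x).

Definition tm_answer (x : seq bool) (b : bool) : Prop :=
  exists t, (tm_run x t).1.1 = if b then tm_accept M else tm_reject M.

End TuringMachine.

(* A partial decision problem: [f x b] means that the answer on [x] is [b];
   there is no answer when the computation diverges. *)
Definition problem : Type := seq bool -> bool -> Prop.

Definition tm_computable (f : problem) : Prop :=
  exists M : turing_machine, forall x b, tm_answer M x b <-> f x b.

(* [b] is the first answer read off the generated tokens. *)
Definition swt_answer (R : realType) (T : swt R) (prec : nat -> nat)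
    (ans : vocab T -> option bool) (C : seq (vocab T)) (b : bool) : Prop :=
  let token i := obind (@olast (vocab T)) (swt_run prec C i) in
  exists2 i, obind ans (token i.+1) = Some b
           & forall j, (j < i)%N -> obind ans (token j.+1) = None.

(* Since windows never shrink, using O(log |C|) bits on the current window [C]
   amounts to O(log S) bits for an execution with windows of length at
   most [S], without having to know [S] in advance. *)
Definition swt_computable (R : realType) (f : problem) : Prop :=
  exists (T : swt R) (E : prompter (vocab T)) (ans : vocab T -> option bool)
         (c : nat),
    finite_params T /\
    forall x b, swt_answer (log_bits c) ans (prompt E x) b <-> f x b.

Definition turing_complete (computable : problem -> Prop) : Prop :=
  forall f : problem, computable f <-> tm_computable f.

(* Main.v *)
(* The window of a parity-HIST machine is stored as [f w1 f w2 ... f wn f], where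
   the fences [f] carry the state.  Successive occurrences of a symbol carry
   opposite signs, so the sum of the signs of a symbol over a window, which only
   loses tokens at its front, is [0] or [1] up to a sign known to the last fence,
   according to the parity of the number of occurrences; uniform attention
   multiplies this sum by some [r > 0].  Since there is exactly one more fence
   than symbols, a further coordinate holds [r] itself, and gates
   [relu (r * (1 - number of mismatched parities))] select the next token.  All
   parameters are integers, and with enough bits the only rounded operation is
   [1 / n].

   A Turing machine becomes a queue automaton on a circular tape, and then a
   parity-HIST machine, which recovers the symbol deleted from its window by
   comparing parities before and after.  Conversely, inference is recursive: only
   the exponential needs an argument.  Once the precision is large, attention
   scores are fixed dyadic numbers, so only finitely many reals [expR y] have to
   be rounded; when [expR y] is not dyadic, comparing it with dyadic numbers
   terminates thanks to the bounds [(1 + y / n) ^ n] and [(1 - y / n) ^ - n].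
   Recursive functions are compiled to counter programs, and these to Turing
   machines. *)
Require Import Defs.
From HB Require Import structures.
From mathcomp Require Import all_boot all_order all_algebra.
From mathcomp Require Import reals sequences exp.
From mathcomp Require Import boolp zify ring lra.
Set Implicit Arguments.
Unset Strict Implicit.
Unset Printing Implicit Defensive.
Import Order.TTheory GRing.Theory Num.Theory.

(** * Counter programs *)

(** Two obstacles shape the proof. Attention normalises, so a parity reaches the network only as a
    multiple of a factor [r] that shrinks as the window grows. No fixed threshold can separate the
    cases; each decision is therefore arranged so that one token has a positive score and all the
    others have score zero. Moreover, deletions at the front are invisible to the last token, so
    what this token knows must stay valid for every suffix of the window. Turing completeness is an
    equivalence between partial answers, so the absence of an answer has to be preserved too. In one
    direction the parity-HIST machine never halts: it keeps rotating its window, and answers are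
    read off its states. In the other, the compiled machine must be shown to run forever when no
    answer comes, which a big-step semantics of programs does not express by itself. Recursiveness
    is a predicate on functions, not a choice of programs. A classical case distinction, such as
    whether [expR y] is dyadic, is therefore harmless as soon as each case has its own program. *)

Inductive cmd :=
| Inc of nat
| Dec of nat
| Inp of nat & bool & nat
| Seq of cmd & cmd
| While of nat & cmd.

HB.instance Definition _ := gen_eqMixin cmd.
HB.instance Definition _ := gen_choiceMixin cmd.

Definition store := nat -> nat.

Definition upd (T : Type) (t : nat -> T) (i : nat) (v : T) : nat -> T :=
  fun j => if j == i then v else t j.

Lemma upd_id (T : Type) (t : nat -> T) i : upd t i (t i) = t.
Proof. by apply/funext => j; rewrite /upd; case: eqP => [->|]. Qed.

Inductive exec (x : seq bool) : cmd -> store -> store -> Prop :=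
| exec_inc i s : exec x (Inc i) s (upd s i ((s i).+1))
| exec_dec i s : exec x (Dec i) s (upd s i ((s i).-1))
| exec_inp i b d s :
    exec x (Inp i b d) s (upd s d (s d + (onth x (s i) == Some b)))
| exec_seq c1 c2 s1 s2 s3 :
    exec x c1 s1 s2 -> exec x c2 s2 s3 -> exec x (Seq c1 c2) s1 s3
| exec_while0 i c s : s i = 0 -> exec x (While i c) s s
| exec_whileS i c s1 s2 s3 : s1 i != 0 ->
    exec x c s1 s2 -> exec x (While i c) s2 s3 -> exec x (While i c) s1 s3.

Fixpoint regs (c : cmd) : nat :=
  match c with
  | Inc i | Dec i => i
  | Inp i _ d => maxn i d
  | Seq c1 c2 => maxn (regs c1) (regs c2)
  | While i c => maxn i (regs c)
  end.

(** The continuations met while [c] runs above [K]. A loop body is pushed above the loop itself, so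
    the list is finite and can serve as the control of a Turing machine. The extra entry for [Inp]
    is due to its execution as a test followed by [Inc]. *)
Fixpoint stacks (c : cmd) (K : seq cmd) : seq (seq cmd) :=
  (c :: K) ::
  match c with
  | Inc _ | Dec _ => [::]
  | Inp _ _ d => [:: Inc d :: K]
  | Seq c1 c2 => stacks c1 (c2 :: K) ++ stacks c2 K
  | While i c' => stacks c' (While i c' :: K)
  end.

Lemma mem_stacks c K : c :: K \in stacks c K.
Proof. by case: c => *; rewrite inE eqxx. Qed.

(** [Go] executes the top command, including the walk right across the unary block of a register;
    [Clear] erases the last bit of that block after one step back; [Return] walks left to the
    flagged cell. *)
Inductive phase := Go | Clear | Return.
Definition phase_code (p : phase) : 'I_3 :=
  match p with Go => inord 0 | Clear => inord 1 | Return => inord 2 end.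
Definition phase_decode (i : 'I_3) : phase :=
  match val i with 0 => Go | 1 => Clear | _ => Return end.
Lemma phase_codeK : cancel phase_code phase_decode.
Proof. by case; rewrite /phase_decode /= ?inordK. Qed.
HB.instance Definition _ := Countable.copy phase (can_type phase_codeK).
HB.instance Definition _ : isFinite phase := CanIsFinite phase_codeK.

(** * Counter programs on Turing machines *)

Section Compile.
Variables (prog : cmd) (res : nat).

Let k := maxn res (regs prog).

(* A cell holds an input symbol, one bit for each register (the register
   containing [n] has its bit set in the cells [0, ..., n - 1]), and a flag
   marking cell [0]. *)
Definition cell : finType := (option bool * {ffun 'I_k.+1 -> bool} * bool)%type.

Definition bit (a : cell) (i : nat) : bool := a.1.2 (inord i).
Definition set_bit (a : cell) (i : nat) (b : bool) : cell :=
  (a.1.1, [ffun j : 'I_k.+1 => if j == inord i then b else a.1.2 j], a.2).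
Definition input_cell (o : option bool) : cell := (o, [ffun=> false], false).

Lemma cell_uniq :
  uniq [:: input_cell None; input_cell (Some false); input_cell (Some true)].
Proof. by []. Qed.

Definition all_stacks := [::] :: stacks prog [::].

Definition ctrl : finType := option (bool + seq_sub all_stacks * phase)%type.
Definition halt (b : bool) : ctrl := Some (inl b).

Lemma nil_stack : [::] \in all_stacks. Proof. exact: mem_head. Qed.

Definition at_stack (K : seq cmd) (p : phase) : ctrl :=
  Some (inr (insubd (SeqSub nil_stack) K, p)).

(** Unary registers make addressing free: the first cell without the bit of register [i] is the cell
    whose number is the content of [i], so it holds the letter that [Inp] asks for. *)
Definition compiled_delta (q : ctrl) (a : cell) : ctrl * cell * move :=
  match q with
  | None => (at_stack [:: prog] Go, (a.1, true), Stay)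
  | Some (inl _) => (q, a, Stay)
  | Some (inr (K, Return)) =>
      if a.2 then (at_stack (val K) Go, a, Stay) else (q, a, MoveLeft)
  | Some (inr (K, Clear)) =>
      match val K with
      | Dec i :: K' => (at_stack K' Return, set_bit a i false, Stay)
      | _ => (q, a, Stay)
      end
  | Some (inr (K, Go)) =>
      match val K with
      | [::] => (halt (bit a res), a, Stay)
      | Inc i :: K' =>
          if bit a i then (q, a, MoveRight)
          else (at_stack K' Return, set_bit a i true, Stay)
      | Dec i :: K' =>
          if bit a i then (q, a, MoveRight)
          else if a.2 then (at_stack K' Go, a, Stay)
          else (at_stack (val K) Clear, a, MoveLeft)
      | Inp i b d :: K' =>
          if bit a i then (q, a, MoveRight)
          else (at_stack (if a.1.1 == Some b then Inc d :: K' else K') Return,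
                a, Stay)
      | Seq c1 c2 :: K' => (at_stack (c1 :: c2 :: K') Go, a, Stay)
      | While i c :: K' =>
          (at_stack (if bit a i then c :: val K else K') Go, a, Stay)
      end
  end.

Lemma halt_neq : halt true != halt false. Proof. by []. Qed.

Definition compiled : turing_machine :=
  TuringMachine cell_uniq (None : ctrl) halt_neq compiled_delta.

Notation conf := (tm_config compiled).

(** Viewing the two lists as one function on cells makes trailing blanks irrelevant. The length of
    the left list is the head position, since the head never goes left of cell [0]. *)
Definition holds (q : ctrl) (pos : nat) (t : nat -> cell) (c : conf) : Prop :=
  [/\ c.1.1 = q, size c.1.2 = pos
    & forall j, nth (input_cell None) (catrev c.1.2 c.2) j = t j].

Definition running (q : ctrl) := if q is Some (inl _) then false else true.

Lemma holds_step q pos t c q' a d : running q -> holds q pos t c ->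
  compiled_delta q (t pos) = (q', a, d) ->
  let t' := (upd t pos (a)) in
  match d with
  | Stay => holds q' pos t' (tm_step c)
  | MoveRight => holds q' pos.+1 t' (tm_step c)
  | MoveLeft => 0 < pos -> holds q' pos.-1 t' (tm_step c)
  end.
Proof.
move=> rq; case: c => [[q0 l] r] [qE lE tE] dE t'.
rewrite /= in qE lE tE; subst q0 pos.
have hE : head (input_cell None) r = t (size l).
  by rewrite -tE catrevE nth_cat size_rev ltnn subnn; case: (r).
have t'E j : nth (input_cell None) (catrev l (a :: behead r)) j =
    (upd t (size l) (a)) j.
  rewrite /upd -tE !catrevE !nth_cat size_rev; case: (ltngtP j (size l)) => //.
    by move=> lj; rewrite -(subnSK lj) /= nth_behead.
  by move=> ->; rewrite subnn.
have stepE : tm_step (M := compiled) (q, l, r) =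
    match d with
    | MoveLeft => (q', behead l, head (input_cell None) l :: a :: behead r)
    | MoveRight => (q', a :: l, behead r)
    | Stay => (q', l, a :: behead r)
    end.
  rewrite /tm_step /= hE dE; case: (q) rq => [[]|] //.
rewrite stepE {stepE}; case: d {dE} => //.
by case: l @t' {tE hE} t'E => //= b l t'E _; split.
Qed.

Definition leads q pos t q' pos' t' := forall c, holds q pos t c ->
  exists n, holds q' pos' t' (iter n (@tm_step compiled) c).

Lemma leads_refl q pos t : leads q pos t q pos t.
Proof. by move=> c cE; exists 0. Qed.

Lemma leads_trans q1 p1 t1 q2 p2 t2 q3 p3 t3 :
  leads q1 p1 t1 q2 p2 t2 -> leads q2 p2 t2 q3 p3 t3 -> leads q1 p1 t1 q3 p3 t3.
Proof.
move=> h1 h2 c /h1[n1] /h2[n2]; rewrite -iterD => h; by exists (n2 + n1).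
Qed.

Arguments leads_trans {q1 p1 t1 q2 p2 t2 q3 p3 t3} _ _ c.

Lemma leads_stay q pos t q' a : running q ->
  compiled_delta q (t pos) = (q', a, Stay) ->
  leads q pos t q' pos (upd t pos (a)).
Proof. by move=> rq dE c cE; exists 1; exact: holds_step rq cE dE. Qed.

Lemma leads_stay_id q pos t q' : running q ->
  compiled_delta q (t pos) = (q', t pos, Stay) -> leads q pos t q' pos t.
Proof. by move=> rq /(leads_stay rq); rewrite upd_id. Qed.

Lemma leads_right q pos t q' : running q ->
  compiled_delta q (t pos) = (q', t pos, MoveRight) ->
  leads q pos t q' pos.+1 t.
Proof.
by move=> rq dE c cE; exists 1; have := holds_step rq cE dE; rewrite /= upd_id.
Qed.

Lemma leads_left q pos t q' : running q ->
  compiled_delta q (t pos.+1) = (q', t pos.+1, MoveLeft) ->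
  leads q pos.+1 t q' pos t.
Proof.
move=> rq dE c cE; exists 1.
by have := holds_step rq cE dE; rewrite /= upd_id; apply.
Qed.

Variable x : seq bool.

Definition tape (s : store) : nat -> cell :=
  fun j => (onth x j, [ffun i : 'I_k.+1 => j < s i], j == 0).

Lemma bit_tape s j i : i <= k -> bit (tape s j) i = (j < s i).
Proof. by move=> ik; rewrite /bit ffunE inordK. Qed.

Lemma set_bit_tape s i b n j : i <= k -> (forall j', j' != j ->
    (j' < n) = (j' < s i)) -> (j < n) = b ->
  (upd (tape s) j (set_bit (tape s j) i b)) = tape (upd s i (n)).
Proof.
move=> ik nE bE; apply/funext => j'; rewrite /upd /tape.
case: eqVneq => [->|j'j].
  congr (_, _, _); apply/ffunP => i'; rewrite !ffunE -val_eqE /= inordK //.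
  by case: eqP => // _; rewrite -bE.
congr (_, _, _); apply/ffunP => i'; rewrite !ffunE.
by case: eqP => // ->; rewrite nE.
Qed.

Lemma at_stackE K p : K \in all_stacks ->
  exists2 K' : seq_sub all_stacks, val K' = K & at_stack K p = Some (inr (K', p)).
Proof.
move=> KP; exists (insubd (SeqSub nil_stack) K) => //.
by rewrite val_insubd KP.
Qed.

Lemma leads_return K s j : K \in all_stacks ->
  leads (at_stack K Return) j (tape s) (at_stack K Go) 0 (tape s).
Proof.
move=> KP; have [K' K'E qE] := at_stackE Return KP; rewrite qE.
elim: j => [|j IH].
  by apply: leads_stay_id => //=; rewrite K'E.
by apply: (leads_trans _ IH); apply: leads_left.
Qed.

Arguments leads_return : clear implicits.

Lemma leads_seek q s i j : i <= k -> running q ->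
  (forall a, bit a i -> compiled_delta q a = (q, a, MoveRight)) ->
  j <= s i -> leads q 0 (tape s) q j (tape s).
Proof.
move=> ik rq qE; elim: j => [|j IH] js; first exact: leads_refl.
apply: leads_trans (IH (ltnW js)) _; apply: leads_right => //.
by apply: qE; rewrite bit_tape.
Qed.

Lemma leads_inc i K s : i <= k -> K \in all_stacks -> Inc i :: K \in all_stacks ->
  leads (at_stack (Inc i :: K) Go) 0 (tape s)
        (at_stack K Go) 0 (tape (upd s i ((s i).+1))).
Proof.
move=> ik KP iKP; have [K' K'E qE] := at_stackE Go iKP; rewrite qE.
apply: (leads_trans _ (leads_return _ _ (s i) KP)).
apply: (@leads_trans _ _ _ (Some (inr (K', Go))) (s i) (tape s)).
  by apply: (@leads_seek _ _ i) => // a ai; rewrite /= K'E ai.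
rewrite -(@set_bit_tape s i true _ (s i)) //; first last.
- exact: ltnSn.
- by move=> j' j's; rewrite ltnS leq_eqVlt (negPf j's).
by apply: leads_stay => //=; rewrite K'E bit_tape // ltnn.
Qed.

Lemma leads_dec i K s : i <= k -> K \in all_stacks -> Dec i :: K \in all_stacks ->
  leads (at_stack (Dec i :: K) Go) 0 (tape s)
        (at_stack K Go) 0 (tape (upd s i ((s i).-1))).
Proof.
move=> ik KP iKP; have [K' K'E qE] := at_stackE Go iKP.
have qE' : at_stack (Dec i :: K) Clear = Some (inr (K', Clear)).
  rewrite /at_stack; congr (Some (inr (_, _))).
  by apply: val_inj; rewrite val_insubd iKP K'E.
case si: (s i) => [|n].
  have -> : (upd s i (0.-1)) = s.
    by apply/funext => j; rewrite /upd; case: eqP => // ->.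
  by rewrite qE; apply: leads_stay_id => //=; rewrite K'E bit_tape ?si.
apply: (leads_trans _ (leads_return _ _ n KP)).
rewrite qE; apply: (@leads_trans _ _ _ (Some (inr (K', Go))) n.+1 (tape s)).
  by apply: (@leads_seek _ _ i); rewrite ?si // => a ai; rewrite /= K'E ai.
apply: (@leads_trans _ _ _ (Some (inr (K', Clear))) n (tape s)).
  apply: leads_left => //=; rewrite K'E bit_tape // si ltnn.
  by rewrite -[Dec i :: K]K'E -[in RHS]qE' K'E.
rewrite -(@set_bit_tape s i false _ n) ?ltnn //; first last.
- by move=> j' j'n; rewrite si ltnS [RHS]leq_eqVlt (negPf j'n).
by apply: leads_stay => //=; rewrite K'E.
Qed.

Lemma leads_exec c s s' : exec x c s s' -> forall K, regs c <= k ->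
    {subset stacks c K <= all_stacks} -> K \in all_stacks ->
  leads (at_stack (c :: K) Go) 0 (tape s) (at_stack K Go) 0 (tape s').
Proof.
elim=> {c s s'} [i s|i s|i b d s|c1 c2 s1 s2 s3 _ IH1 _ IH2|i c s si|i c s1 s2 s3
    si _ IH1 _ IH2] K ck sub KP; have cKP := sub _ (mem_stacks _ _).
- exact: leads_inc.
- exact: leads_dec.
- move: ck; rewrite /= geq_max => /andP[ik dk].
  have dKP : Inc d :: K \in all_stacks by apply: sub; rewrite !inE eqxx orbT.
  have [K' K'E qE] := at_stackE Go cKP; rewrite qE.
  apply: (@leads_trans _ _ _ (Some (inr (K', Go))) (s i) (tape s)).
    by apply: (@leads_seek _ _ i) => // a ai; rewrite /= K'E ai.
  apply: (@leads_trans _ _ _ (at_stack (if onth x (s i) == Some b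
             then Inc d :: K else K) Return) (s i) (tape s)).
    by apply: leads_stay_id => //=; rewrite K'E bit_tape // ltnn.
  apply: (leads_trans (leads_return _ _ _ _)); first by case: ifP.
  case: ifP => _; first by rewrite addn1; exact: leads_inc.
  by rewrite addn0 upd_id; exact: leads_refl.
- move: ck; rewrite /= geq_max => /andP[c1k c2k].
  have sub2 : {subset stacks c2 K <= all_stacks}.
    by move=> y yP; apply: sub; rewrite inE mem_cat yP !orbT.
  have sub1 : {subset stacks c1 (c2 :: K) <= all_stacks}.
    by move=> y yP; apply: sub; rewrite inE mem_cat yP !orbT.
  have [K' K'E qE] := at_stackE Go cKP; rewrite qE.
  apply: (leads_trans _ (leads_trans (IH1 _ c1k sub1 _) (IH2 _ c2k sub2 KP))).
    by apply: leads_stay_id => //=; rewrite K'E.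
  exact/sub2/mem_stacks.
- move: ck; rewrite /= geq_max => /andP[ik _].
  have [K' K'E qE] := at_stackE Go cKP; rewrite qE.
  by apply: leads_stay_id => //=; rewrite K'E bit_tape // si.
- move: (ck); rewrite /= geq_max => /andP[ik c1k].
  have sub1 : {subset stacks c (While i c :: K) <= all_stacks}.
    by move=> y yP; apply: sub; rewrite inE yP orbT.
  apply: (leads_trans _ (leads_trans (IH1 _ c1k sub1 _) (IH2 _ ck sub KP))) => //.
  have [K' K'E qE] := at_stackE Go cKP; rewrite qE.
  by apply: leads_stay_id => //=; rewrite K'E bit_tape // lt0n si.
Qed.


Lemma holds_input : holds None 0 (fun j => input_cell (onth x j)) (tm_run compiled x 0).
Proof.
split=> // j; rewrite /= /tm_input; elim: (x) j => [|b w IH] [|j] //=.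
by case: b.
Qed.

Lemma leads_start : leads None 0 (fun j => input_cell (onth x j))
  (at_stack [:: prog] Go) 0 (tape (fun=> 0)).
Proof.
have -> : tape (fun=> 0) = upd (fun j => input_cell (onth x j)) 0
    ((input_cell (onth x 0)).1, true).
  apply/funext => j; rewrite /upd /tape /input_cell.
  have -> : [ffun i : 'I_k.+1 => j < 0] = [ffun=> false].
    by apply/ffunP => i; rewrite !ffunE.
  by case: eqP => [->|/eqP/negPf] // ->.
exact: leads_stay.
Qed.

Lemma running_compiled (c : conf) : running c.1.1 =
  ~~ ((c.1.1 == tm_accept compiled) || (c.1.1 == tm_reject compiled)).
Proof. by case: c => [[[[[]|]|] l] r]. Qed.

Lemma halted_iter (c : conf) n : ~~ running c.1.1 -> iter n (@tm_step compiled) c = c.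
Proof.
move=> nr; elim: n => //= n ->; move: nr.
by case: c => [[q l] r]; rewrite running_compiled negbK /tm_step /= => ->.
Qed.

(** Halting states are absorbing, so an answer is visible at all late times; two answers can then be
    compared at a common time. *)
Lemma tm_answer_inf b : tm_answer compiled x b ->
  exists n, forall m, n <= m -> (tm_run compiled x m).1.1 = halt b.
Proof.
case=> n nE; exists n => m nm; have nE' : (tm_run compiled x n).1.1 = halt b.
  by rewrite nE; case: (b).
rewrite /tm_run -(subnK nm) iterD -/(tm_run compiled x n) halted_iter nE' //.
Qed.

Lemma exec_answer s : exec x prog (fun=> 0) s ->
  tm_answer compiled x (0 < s res).
Proof.
move=> /leads_exec/(_ [::]) h.
have {}h : leads None 0 (fun j => input_cell (onth x j)) (halt (0 < s res)) 0 (tape s).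
  apply: (leads_trans leads_start (leads_trans (h _ _ _) _)).
  - exact: leq_maxr.
  - by move=> K KP; rewrite inE KP orbT.
  - exact: nil_stack.
  have [K' K'E ->] := at_stackE Go nil_stack.
  by apply: leads_stay_id => //=; rewrite K'E bit_tape ?leq_maxl.
have [n [nE _ _]] := h _ holds_input; exists n; rewrite /tm_run nE.
by case: (0 < _).
Qed.

End Compile.

(** Divergence, which [exec] cannot express, is obtained on the machine side: the head of the loop
    is reached at arbitrarily late times, and its control state is not a halting one. *)
Lemma exec_loop_answer x c i body c' res s1 (inv : store -> Prop) b :
  exec x c (fun=> 0) s1 -> inv s1 ->
  (forall s, inv s -> s i != 0 /\ exists2 s', exec x body s s' & inv s') ->
  ~ tm_answer (compiled (Seq c (Seq (While i body) c')) res) x b.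
Proof.
set prog := Seq c _; move=> cE inv1 invE /tm_answer_inf[n nE].
have pk : regs prog <= maxn res (regs prog) by exact: leq_maxr.
have [ck [ik [bk _]]] : [/\ regs c <= regs prog, i <= regs prog,
  regs body <= regs prog & True] by rewrite /=; split; lia.
have sub0 : {subset stacks prog [::] <= all_stacks prog}.
  by move=> K KP; rewrite inE KP orbT.
set K1 := [:: Seq (While i body) c']; set K2 := [:: While i body; c'].
have K1P : K1 \in all_stacks prog.
  by apply: sub0; rewrite inE mem_cat mem_stacks !orbT.
have subw : {subset stacks (While i body) [:: c'] <= all_stacks prog}.
  by move=> K KP; apply: sub0; rewrite inE mem_cat inE mem_cat KP !orbT.
have K2P : K2 \in all_stacks prog by apply/subw/mem_stacks.
have subb : {subset stacks body K2 <= all_stacks prog}.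
  by move=> K KP; apply: subw; rewrite inE KP orbT.
have subc : {subset stacks c K1 <= all_stacks prog}.
  by move=> K KP; apply: sub0; rewrite inE mem_cat KP !orbT.
pose loop m := exists2 s, inv s & holds (at_stack prog K2 Go) 0 (tape prog res x s)
  (tm_run (compiled prog res) x m).
suff [m nm [s _ [qE _ _]]] : exists2 m, n <= m & loop m.
  by have := nE _ nm; rewrite qE /at_stack /halt.
elim: n {nE} => [|n [m nm [s sinv sP]]].
  have [K' K'E qE] := at_stackE Go (sub0 _ (mem_stacks _ _)).
  have [K1' K1'E q1E] := at_stackE Go K1P.
  suff h : leads None 0 (fun j => input_cell prog res (onth x j))
      (at_stack prog K2 Go) 0 (tape prog res x s1).
    by have [m mP] := h _ (holds_input _ _ _); exists m => //; exists s1.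
  apply: (leads_trans (@leads_start prog res x)).
  apply: (leads_trans (t2 := tape prog res x (fun=> 0)) (q2 := at_stack prog (c :: K1) Go) (p2 := 0)).
    by rewrite qE; apply: leads_stay_id => //=; rewrite K'E.
  apply: (leads_trans (leads_exec cE (leq_trans ck pk) subc K1P)).
  by rewrite q1E; apply: leads_stay_id => //=; rewrite K1'E.
have [si [s' bE s'inv]] := invE _ sinv.
have [K2' K2'E q2E] := at_stackE Go K2P.
(* Entering the body is done by one explicit step, since [leads] may take none and time has to
   increase strictly. *)
have h1 : holds (at_stack prog (body :: K2) Go) 0 (tape prog res x s)
    (tm_run (compiled prog res) x m.+1).
  rewrite q2E in sP.
  have := holds_step (a := tape prog res x s 0) (d := Stay) (q' := at_stack prog (body :: K2) Go) _ sP.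
  by rewrite /= upd_id; apply=> //; rewrite K2'E /K2 /= bit_tape ?lt0n ?si ?(leq_trans ik pk).
have [m' m'P] := leads_exec bE (leq_trans bk pk) subb K2P h1.
exists (m' + m.+1); first by rewrite addnS ltnS (leq_trans nm) ?leq_addl.
by exists s' => //; rewrite /tm_run iterD.
Qed.

(** * Recursive functions *)

Definition fn (A : Type) := seq bool -> (nat -> nat) -> A.

Definition scons (n : nat) (e : nat -> nat) : nat -> nat :=
  fun i => if i is j.+1 then e j else n.

(* Total recursive functions of a word [x], which can be read bit by bit, and
   of numbered variables. *)
Inductive rec : fn nat -> Prop :=
| rec_var i : rec (fun x e => e i)
| rec_zero : rec (fun x e => 0)
| rec_succ f : rec f -> rec (fun x e => (f x e).+1)
| rec_inp f b : rec f -> rec (fun x e => onth x (f x e) == Some b)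
| rec_let f g : rec f -> rec g -> rec (fun x e => f x (scons (g x e) e))
| rec_ren f r : rec f -> rec (fun x e => f x (fun i => e (r i)))
| rec_iter n z s : rec n -> rec z -> rec s ->
    rec (fun x e => nat_rect (fun=> nat) (z x e)
                      (fun k a => s x (scons k (scons a e))) (n x e))
| rec_mu f g : rec f ->
    (forall x e, f x (scons (g x e) e) = 0 /\
                 forall n, n < g x e -> f x (scons n e) != 0) ->
    rec g.

Ltac case_eqs := repeat match goal with
  | |- context [@eq_op ?T ?a ?b] => case: (@eqP T a b) => ? //=
  end; try (subst; lia).

(** * Counter programs for recursive functions *)

Definition Clr i := While i (Dec i).
Definition Move i j := While i (Seq (Dec i) (Inc j)).

Lemma exec_eq x c s s1 s2 : exec x c s s1 -> s1 = s2 -> exec x c s s2.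
Proof. by move=> h <-. Qed.

Lemma exec_clr x i s : exec x (Clr i) s (upd s i 0).
Proof.
elim: {s}(s i) {-2}s (erefl (s i)) => [|n IH] s si.
  by apply: (exec_eq (exec_while0 _ _ si)); rewrite -[in RHS]si upd_id.
apply: exec_whileS; [by rewrite si | exact: exec_dec |].
apply: exec_eq (IH _ _) _; first by rewrite /upd eqxx si.
by apply/funext => j; rewrite /upd; case: eqP.
Qed.

Lemma exec_move x i j s : i != j ->
  exec x (Move i j) s (upd (upd s i 0) j (s j + s i)).
Proof.
move=> ij; elim: {s}(s i) {-2}s (erefl (s i)) => [|n IH] s si.
  apply: (exec_eq (exec_while0 _ _ si)).
  by rewrite si addn0 -[X in upd s i X]si !upd_id.
apply: exec_whileS; [by rewrite si | apply: exec_seq; [exact: exec_dec|exact: exec_inc] |].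
apply: exec_eq (IH _ _) _; first by rewrite /upd (negPf ij) eqxx si.
apply/funext => l; rewrite /upd; case: (eqVneq l j) => [_|lj] /=.
  by rewrite ?eqxx eq_sym (negPf ij) ?eqxx; lia.
by case: eqP.
Qed.

Lemma exec_copy x i j l s : i != j -> i != l -> j != l -> s l = 0 ->
  exec x (Seq (While i (Seq (Dec i) (Seq (Inc j) (Inc l)))) (Move l i)) s
    (upd s j (s j + s i)).
Proof.
move=> ij il jl sl.
have h : forall n t, t i = n ->
    exec x (While i (Seq (Dec i) (Seq (Inc j) (Inc l)))) t
         (upd (upd (upd t i 0) j (t j + n)) l (t l + n)).
  elim=> [|n IH] t tn.
    apply: (exec_eq (exec_while0 _ _ tn)).
    by rewrite !addn0 -[X in upd t i X]tn !upd_id.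
  apply: exec_whileS; [by rewrite tn | |].
    apply: exec_seq; [exact: exec_dec|].
    by apply: exec_seq; exact: exec_inc.
  apply: exec_eq (IH _ _) _; first by rewrite /upd (negPf ij) (negPf il) eqxx tn.
  by apply/funext => m; rewrite /upd; case_eqs.
apply: exec_seq (h _ _ erefl) _; apply: exec_eq; first by apply: exec_move; rewrite eq_sym.
by apply/funext => m; rewrite /upd; case_eqs.
Qed.

(** Registers from [m] on are scratch space: null at the start, and null again at the end except for
    the result in [m]. Programs can therefore be chained without interference. *)
Definition computes (c : cmd) (m : nat) (f : seq bool -> store -> nat) :=
  forall x s, (forall j, m <= j -> s j = 0) -> exec x c s (upd s m (f x s)).

(** Register [m] holds the candidate and [m.+1] the tested value. The loop is left when [m.+1] is
    null, so the scratch space is clean without further work. *)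
Definition Search m c := Seq c (While m.+1 (Seq (Clr m.+1) (Seq (Inc m) c))).

Lemma exec_search_body x c m f s n : computes c m.+1 f ->
  (forall j, m < j -> s j = 0) ->
  let st i := upd (upd s m i) m.+1 (f x (upd s m i)) in
  exec x (Seq (Clr m.+1) (Seq (Inc m) c)) (st n) (st n.+1).
Proof.
move=> cP s0 st.
apply: exec_seq; first exact: exec_clr.
apply: exec_seq; first exact: exec_inc.
have -> : upd (upd (st n) m.+1 0) m (upd (st n) m.+1 0 m).+1 = upd s m n.+1.
  have s1 := s0 _ (ltnSn m).
  by apply/funext => j; rewrite /st /upd; case_eqs.
by apply: cP => j mj; rewrite /upd gtn_eqF // s0.
Qed.

Lemma exec_search x c m f s n : computes c m.+1 f ->
  (forall j, m <= j -> s j = 0) ->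
  f x (upd s m n) = 0 -> (forall i, i < n -> f x (upd s m i) != 0) ->
  exec x (Search m c) s (upd s m n).
Proof.
move=> cP s0 fn fi; pose st i := upd (upd s m i) m.+1 (f x (upd s m i)).
have stn : st n = upd s m n.
  apply/funext => j; rewrite /st /upd; case: eqP => // ->.
  by rewrite gtn_eqF // s0.
apply: (@exec_seq _ _ _ _ (st 0)).
  apply: exec_eq (cP _ _ _) _ => [j mj|]; first by rewrite s0 // ltnW.
  by rewrite /st -(s0 _ (leqnn m)) upd_id.
suff : forall k, k <= n -> exec x (While m.+1 (Seq (Clr m.+1) (Seq (Inc m) c)))
   (st (n - k)) (st n) by move=> /(_ n (leqnn n)); rewrite subnn stn.
elim=> [|k IH] kn.
  by rewrite subn0; apply: exec_while0; rewrite /st /upd eqxx.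
apply: (exec_whileS (s2 := st (n - k))).
- by rewrite /st {1}/upd eqxx fi //; lia.
- have -> : n - k = (n - k.+1).+1 by lia.
  by apply: exec_search_body => // j mj; apply/s0/ltnW.
- exact/IH/ltnW.
Qed.

(** The map [r] from variables to registers is kept general because binding a variable amounts to
    using [scons m r]: the result register of the bound value becomes variable [0]. *)
Lemma rec_compile f : rec f -> forall r m, (forall i, r i < m) ->
  exists c, computes c m (fun x s => f x (fun i => s (r i))).
Proof.
have consE m s a r : (forall i, r i < m) ->
    (fun i => upd s m a (scons m r i)) = scons a (fun i => s (r i)).
  move=> rm; apply/funext => -[|i] /=; rewrite /upd ?eqxx //.
  by rewrite ltn_eqF.
have consP m r : (forall i, r i < m) -> forall i, scons m r i < m.+1.
  by move=> rm [|i] //=; rewrite ltnS ltnW.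
elim=> {f} [i||f _ IH|f b _ IH|f g _ IHf _ IHg|f r' _ IH|n z t _ IHn _ IHz _ IHt|
    f g _ IH gP] r m rm.
- eexists => x s s0; apply: exec_eq.
    apply: (@exec_copy _ (r i) m m.+1); first [by rewrite ltn_eqF // ltnS ltnW //|exact: s0].
  by rewrite s0.
- by exists (Dec m) => x s s0; apply: exec_eq (exec_dec _ _ _) _; rewrite s0.
- have [c cP] := IH r m rm; exists (Seq c (Inc m)) => x s s0.
  apply: exec_seq (cP _ _ s0) _; apply: exec_eq (exec_inc _ _ _) _.
  by apply/funext => j; rewrite /upd eqxx; case: eqP.
- have [c cP] := IH r m.+1 (fun i => leqW (rm i)).
  exists (Seq c (Seq (Inp m.+1 b m) (Clr m.+1))) => x s s0.
  have s0' j : m < j -> s j = 0 by move=> /ltnW/s0.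
  apply: exec_seq (cP _ _ s0') _.
  apply: exec_seq (exec_inp _ _ _ _ _) _; apply: exec_eq (exec_clr _ _ _) _.
  apply/funext => j; rewrite /upd eqxx (ltn_eqF (ltnSn m)) [s m]s0 //.
  case: (eqVneq j m.+1) => [->|//]; by rewrite gtn_eqF // s0.
- have [cg gP] := IHg r m rm.
  have [cf fP] := IHf (scons m r) m.+1 (consP _ _ rm).
  exists (Seq cg (Seq cf (Seq (Clr m) (Move m.+1 m)))) => x s s0.
  apply: exec_seq (gP _ _ s0) _.
  apply: exec_seq (fP _ _ _) _.
    by move=> j mj; rewrite /upd gtn_eqF // s0 // ltnW.
  rewrite consE //; apply: exec_seq (exec_clr _ _ _) _.
  apply: exec_eq; first by apply: exec_move; rewrite gtn_eqF.
  apply/funext => j; rewrite /upd !eqxx (gtn_eqF (ltnSn m)).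
  case: eqP => // jm; case: eqP => // ->; by rewrite s0.
- have [c cP] := IH (fun i => r (r' i)) m (fun i => rm _); by exists c.
- have [cn nP] := IHn r m rm.
  have [cz zP] := IHz r m.+1 (fun i => leqW (rm i)).
  pose r2 := scons m.+2 (scons m.+1 r).
  have r2P i : r2 i < m.+3.
    by case: i => [|[|i]] //=; rewrite (leq_trans (rm i)) // !leqW.
  have [ct tP] := IHt r2 m.+3 r2P.
  pose body := Seq (Dec m) (Seq ct (Seq (Clr m.+1) (Seq (Move m.+3 m.+1) (Inc m.+2)))).
  exists (Seq cn (Seq cz (Seq (While m body) (Seq (Clr m.+2) (Move m.+1 m))))) => x s s0.
  set e := fun i => s (r i).
  pose F k := nat_rect (fun=> nat) (z x e) (fun k a => t x (scons k (scons a e))) k.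
  (* After [k] rounds, [m] holds the number of rounds left, [m.+1] the accumulator and [m.+2] the
     index of the round; [m.+3] receives the new value before it is moved. *)
  pose st k := upd (upd (upd s m (n x e - k)) m.+1 (F k)) m.+2 k.
  apply: exec_seq (nP _ _ s0) _.
  apply: (@exec_seq _ _ _ _ (st 0)).
    apply: exec_eq (zP _ _ _) _.
      by move=> j mj; rewrite /upd gtn_eqF // s0 // ltnW.
    apply/funext => j; rewrite /st subn0 /F /=.
    rewrite (_ : (fun i => upd s m _ (r i)) = e); last first.
      by apply/funext => i; rewrite /upd ltn_eqF.
    rewrite /upd; case: (eqVneq j m.+2) => [->|//].
    by rewrite !gtn_eqF // s0 // !leqW.
  apply: (@exec_seq _ _ _ _ (st (n x e))).
    suff: forall k, k <= n x e -> exec x (While m body) (st (n x e - k)) (st (n x e)).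
      by move=> /(_ _ (leqnn _)); rewrite subnn.
    elim=> [|k IH] kn.
      by rewrite subn0; apply: exec_while0; rewrite /st /upd; case_eqs.
    apply: (exec_whileS (s2 := st (n x e - k))); last exact/IH/ltnW.
      by rewrite -lt0n /st /upd; case_eqs.
    have -> : n x e - k = (n x e - k.+1).+1 by lia.
    have := leq_subr k.+1 (n x e); set i := n x e - k.+1 => ie.
    have {}ie : i < n x e by rewrite /i; lia.
    apply: exec_seq (exec_dec _ _ _) _.
    apply: exec_seq (tP _ _ _) _.
      move=> j mj; rewrite /st /upd !gtn_eqF //; try lia.
      by rewrite s0; lia.
    rewrite (_ : (fun i0 => _) = scons i (scons (F i) e)); last first.
      apply/funext => -[|[|l]]; rewrite /st /upd /=; first by case_eqs.
        by case_eqs.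
      by have := rm l; rewrite /e => h; case_eqs.
    apply: exec_seq (exec_clr _ _ _) _.
    apply: exec_seq; first by apply: exec_move; rewrite gtn_eqF.
    apply: exec_eq (exec_inc _ _ _) _; apply/funext => j; rewrite /st /upd.
    by have s3 := s0 m.+3; case_eqs; rewrite ?s0; lia.
  apply: exec_seq (exec_clr _ _ _) _.
  apply: exec_eq; first by apply: exec_move; rewrite gtn_eqF.
  apply/funext => j; rewrite /st /upd subnn -/e -/(F _).
  by case_eqs; rewrite ?s0; lia.
- have [c cP] := IH (scons m r) m.+1 (consP _ _ rm).
  exists (Search m c) => x s s0; have [g0 gm] := gP x (fun i => s (r i)).
  apply: (exec_search cP) => //.
    by rewrite consE.
  by move=> i; rewrite consE //; exact: gm.
Qed.

(** The only unbounded search that may fail is kept outside [rec], whose members are total. The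
    search program is the outermost loop, so its failure is exactly the divergence of the
    machine. *)
Lemma rec_search_tm u v : rec u -> rec v ->
  exists M : turing_machine, forall x b, tm_answer M x b <->
    exists i, [/\ u x (fun=> i) = 0, forall j, j < i -> u x (fun=> j) != 0
      & b = (0 < v x (fun=> i))].
Proof.
move=> /rec_compile/(_ (fun=> 0) 1)[//|cu uP].
move=> /rec_compile/(_ (fun=> 0) 1)[//|cv vP].
pose body := Seq (Clr 1) (Seq (Inc 0) cu).
exists (compiled (Seq cu (Seq (While 1 body) cv)) 1) => x.
have ansP i : u x (fun=> i) = 0 -> (forall j, j < i -> u x (fun=> j) != 0) ->
    tm_answer (compiled (Seq cu (Seq (While 1 body) cv)) 1) x (0 < v x (fun=> i)).
  move=> ui uj; pose s := upd (fun=> 0) 0 i.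
  have h := @exec_search x cu 0 _ (fun=> 0) i uP (fun _ _ => erefl) ui uj.
  have e : exec x (Seq cu (Seq (While 1 body) cv)) (fun=> 0) (upd s 1 (v x (fun=> i))).
    inversion h; subst; apply: exec_seq; first eassumption.
    apply: exec_seq; first eassumption.
    by apply: exec_eq (vP _ _ _) _ => // -[].
  by have := exec_answer 1 e.
split=> [|[i [ui uj ->]]]; last exact: ansP.
have [ex|nu] := pselect (exists i, u x (fun=> i) == 0).
  case: (ex_minnP ex) => i /eqP ui im bE; exists i.
  have uj j : j < i -> u x (fun=> j) != 0.
    by move=> ji; apply: contraTN ji => /im; rewrite -leqNgt.
  split=> //; have [n nP] := tm_answer_inf bE; have [m mP] := tm_answer_inf (ansP _ ui uj).
  have := nP (maxn n m) (leq_maxl _ _); rewrite mP ?leq_maxr //.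
  by case.
(* Without a zero of [u], the test register is never null at the head of the loop, so the stores
   [st i] form an invariant for [exec_loop_answer]. *)
pose st i := upd (upd (fun=> 0) 0 i) 1 (u x (fun=> i)).
move=> bE; exfalso; apply: (@exec_loop_answer _ _ _ _ _ _ (st 0) (fun s => exists i, s = st i) _ _ _ _ bE).
- apply: exec_eq (uP _ _ _) _ => //.
  by apply/funext => j; rewrite /st /upd; case_eqs.
- by exists 0.
- move=> s [i ->]; split.
    by rewrite {1}/st /upd /=; apply/eqP => ui; apply: nu; exists i; rewrite ui.
  exists (st i.+1); last by exists i.+1.
  by apply: (@exec_search_body x cu 0 _ (fun=> 0) i uP).
Qed.

Lemma tm_answer_fun (M : turing_machine) x b b' :
  tm_answer M x b -> tm_answer M x b' -> b = b'.
Proof.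
have inf t q m : (tm_run M x t).1.1 = q -> (q == tm_accept M) || (q == tm_reject M) ->
    t <= m -> (tm_run M x m).1.1 = q.
  move=> tE qE /subnK <-; rewrite /tm_run iterD -/(tm_run M x t).
  elim: (m - t) => //= n; case: (iter n _ _) => [[q' l] r] /= ->.
  by rewrite qE.
pose a (b : bool) := if b then tm_accept M else tm_reject M.
have aP c : (a c == tm_accept M) || (a c == tm_reject M).
  by rewrite /a; case: c; rewrite eqxx ?orbT.
case=> t tE [t' t'E]; have := inf _ _ (maxn t t') tE (aP b) (leq_maxl _ _).
rewrite (inf _ _ (maxn t t') t'E (aP b') (leq_maxr _ _)).
move: (tm_answers M) => /eqP; case: (b) (b') => [] [] //=; by [|move=> + /esym].
Qed.

(** * Closure properties of recursive functions and predicates *)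

Notation recb P := (rec (fun x e => nat_of_bool (P x e))).

Lemma rec_ext f g : (forall x e, f x e = g x e) -> rec f -> rec g.
Proof. by move=> fg; suff -> : g = f by []; apply/funext => x; apply/funext. Qed.

Lemma rec1 (F : nat -> nat) f : rec (fun x e => F (e 0)) -> rec f ->
  rec (fun x e => F (f x e)).
Proof. by move=> FP fP; exact: (rec_let FP fP). Qed.

Lemma rec2 (F : nat -> nat -> nat) f g : rec (fun x e => F (e 0) (e 1)) ->
  rec f -> rec g -> rec (fun x e => F (f x e) (g x e)).
Proof.
by move=> FP fP gP; exact: (rec_let (rec_let FP (rec_ren S fP)) gP).
Qed.

Lemma rec_iteri n z (t : seq bool -> nat -> nat -> (nat -> nat) -> nat) :
  rec n -> rec z -> rec (fun x e => t x (e 0) (e 1) (fun i => e i.+2)) ->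
  rec (fun x e => iteri (n x e) (fun k a => t x k a e) (z x e)).
Proof.
move=> nP zP tP; apply: rec_ext (rec_iter nP zP tP) => x e /=.
by elim: (n x e) => //= m ->.
Qed.

Lemma rec_const n : rec (fun x e => n).
Proof. by elim: n => [|n IH]; [exact: rec_zero|exact: rec_succ]. Qed.

Lemma rec_add f g : rec f -> rec g -> rec (fun x e => f x e + g x e).
Proof.
move=> fP gP.
apply: (@rec_ext (fun x e => iteri (g x e) (fun k a => a.+1) (f x e))).
  by move=> x e; elim: (g x e) => [|m /= ->]; rewrite ?addn0 ?addnS.
apply: (@rec_iteri g f (fun _ _ a _ => a.+1)) => //.
exact/rec_succ/rec_var.
Qed.

Lemma rec_pred f : rec f -> rec (fun x e => (f x e).-1).
Proof.
apply: rec1; apply: (@rec_ext (fun x e => iteri (e 0) (fun k a => k) 0)).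
  by move=> x e; case: (e 0).
by apply: (@rec_iteri _ _ (fun _ k _ _ => k)); [exact: rec_var|exact: rec_zero|exact: rec_var].
Qed.

Lemma rec_sub f g : rec f -> rec g -> rec (fun x e => f x e - g x e).
Proof.
move=> fP gP.
apply: (@rec_ext (fun x e => iteri (g x e) (fun k a => a.-1) (f x e))).
  by move=> x e; elim: (g x e) => [|m /= ->]; rewrite ?subn0 ?subnS.
apply: (@rec_iteri g f (fun _ _ a _ => a.-1)) => //.
exact/rec_pred/rec_var.
Qed.

Lemma rec_mul f g : rec f -> rec g -> rec (fun x e => f x e * g x e).
Proof.
move=> fP gP.
apply: (@rec_ext (fun x e => iteri (g x e) (fun k a => a + f x e) 0)).
  by move=> x e; elim: (g x e) => [|m /= ->]; rewrite ?muln0 // mulnSr.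
apply: (@rec_iteri g _ (fun x _ a e => a + f x e)) => //; first exact: rec_zero.
by apply: rec_add (rec_var _) _; exact: rec_ren.
Qed.

Lemma rec_exp f g : rec f -> rec g -> rec (fun x e => f x e ^ g x e).
Proof.
move=> fP gP.
apply: (@rec_ext (fun x e => iteri (g x e) (fun k a => a * f x e) 1)).
  by move=> x e; elim: (g x e) => [|m /= ->] //; rewrite expnSr.
apply: (@rec_iteri g _ (fun x _ a e => a * f x e)) => //; first exact: rec_const.
by apply: rec_mul (rec_var _) _; exact: rec_ren.
Qed.

Lemma recb_eq0 f : rec f -> recb (fun x e => f x e == 0).
Proof.
move=> fP; apply: (@rec_ext (fun x e => 1 - f x e)).
  by move=> x e; case: (f x e) => [|[]].
exact: rec_sub (rec_const 1) fP.
Qed.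

Lemma recb_not (P : fn bool) : recb P -> recb (fun x e => ~~ P x e).
Proof.
by move=> /recb_eq0; apply: rec_ext => x e; case: (P x e).
Qed.

Lemma recb_and (P Q : fn bool) : recb P -> recb Q -> recb (fun x e => P x e && Q x e).
Proof.
by move=> PP QP; apply: rec_ext (rec_mul PP QP) => x e; rewrite mulnb.
Qed.

Lemma recb_or (P Q : fn bool) : recb P -> recb Q -> recb (fun x e => P x e || Q x e).
Proof.
move=> PP QP; apply: rec_ext (recb_not (recb_and (recb_not PP) (recb_not QP))) => x e.
by rewrite negb_and !negbK.
Qed.

Lemma recb_leq f g : rec f -> rec g -> recb (fun x e => f x e <= g x e).
Proof. by move=> fP gP; exact: (recb_eq0 (rec_sub fP gP)). Qed.

Lemma recb_ltn f g : rec f -> rec g -> recb (fun x e => f x e < g x e).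
Proof. by move=> fP gP; exact: (recb_leq (rec_succ fP) gP). Qed.

Lemma recb_eqn f g : rec f -> rec g -> recb (fun x e => f x e == g x e).
Proof.
move=> fP gP; apply: rec_ext (recb_and (recb_leq fP gP) (recb_leq gP fP)) => x e.
by rewrite eqn_leq.
Qed.

Lemma recb_const (b : bool) : recb (fun x e => b).
Proof. exact: rec_const. Qed.

Lemma rec_if (P : fn bool) f g : recb P -> rec f -> rec g ->
  rec (fun x e => if P x e then f x e else g x e).
Proof.
move=> PP fP gP.
apply: rec_ext (rec_add (rec_mul PP fP) (rec_mul (recb_not PP) gP)) => x e.
by case: (P x e); rewrite ?mul1n ?mul0n ?addn0.
Qed.

(** The usual way to prove recursiveness below: however [g] is defined, it is enough to characterise
    its value as the least number passing a recursive test. *)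
Lemma rec_least (P : fn bool) g : recb P ->
  (forall x e, P x (scons (g x e) e) /\ forall n, n < g x e -> ~~ P x (scons n e)) ->
  rec g.
Proof.
move=> /recb_not PP gP; apply: (rec_mu PP) => x e.
have [-> gm] := gP x e; split=> // n /gm -> //.
Qed.

Lemma rec_div f g : rec f -> rec g -> rec (fun x e => f x e %/ g x e).
Proof.
(* The first disjunct stops the search at [0] for a null divisor, in accordance with the convention
   for [%/]. *)
apply: rec2; apply: (@rec_least (fun x e => (e 2 == 0) || (e 1 < (e 0).+1 * e 2))).
  apply: recb_or; first exact/recb_eq0/rec_var.
  by apply: recb_ltn (rec_var _) (rec_mul (rec_succ _) _); exact: rec_var.
move=> x e /=; have [->|d0] := eqVneq (e 1) 0; first by rewrite divn0; split.
rewrite ltn_ceil ?lt0n //; split=> // n nd.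
by rewrite -leqNgt -leq_divRL ?lt0n.
Qed.

Lemma rec_mod f g : rec f -> rec g -> rec (fun x e => f x e %% g x e).
Proof.
move=> fP gP.
apply: rec_ext (rec_sub fP (rec_mul (rec_div fP gP) gP)) => x e.
by rewrite {1}(divn_eq (f x e) (g x e)) addKn.
Qed.

Lemma rec_half f : rec f -> rec (fun x e => (f x e)./2).
Proof.
by move=> fP; apply: rec_ext (rec_div fP (rec_const 2)) => x e; rewrite divn2.
Qed.

Lemma recb_odd f : rec f -> recb (fun x e => odd (f x e)).
Proof.
by move=> fP; apply: rec_ext (rec_mod fP (rec_const 2)) => x e; rewrite modn2.
Qed.

Lemma rec_trunc_log f : rec f -> rec (fun x e => trunc_log 2 (f x e)).
Proof.
apply: rec1; apply: (@rec_least (fun x e => e 1 < 2 ^ (e 0).+1)).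
  apply: recb_ltn (rec_var _) (rec_exp (rec_const 2) _).
  exact/rec_succ/rec_var.
move=> x e /=; split; first exact: trunc_log_ltn.
move=> n nl; rewrite -leqNgt; case: (posnP (e 0)) nl => [->|e0 nl].
  by rewrite trunc_log0.
by apply: (leq_trans _ (trunc_logP (isT : 1 < 2) e0)); rewrite leq_exp2l.
Qed.

Lemma rec_sum (I : Type) (r : seq I) (F : I -> fn nat) : (forall i, rec (F i)) ->
  rec (fun x e => \sum_(i <- r) F i x e).
Proof.
move=> FP; elim: r => [|i r IH].
  by apply: rec_ext (rec_const 0) => x e; rewrite big_nil.
by apply: rec_ext (rec_add (FP i) IH) => x e; rewrite big_cons.
Qed.

Lemma recb_has (I : Type) (r : seq I) (P : I -> fn bool) : (forall i, recb (P i)) ->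
  recb (fun x e => has (fun i => P i x e) r).
Proof.
by move=> PP; elim: r => [|i r IH] /=; [exact: rec_const|exact: recb_or].
Qed.

Lemma recb_all (I : Type) (r : seq I) (P : I -> fn bool) : (forall i, recb (P i)) ->
  recb (fun x e => all (fun i => P i x e) r).
Proof.
by move=> PP; elim: r => [|i r IH] /=; [exact: rec_const|exact: recb_and].
Qed.

Lemma recb_exists (I : finType) (P : I -> fn bool) : (forall i, recb (P i)) ->
  recb (fun x e => [exists i, P i x e]).
Proof.
move=> /(recb_has (enum I)); apply: rec_ext => x e; congr nat_of_bool.
by apply/hasP/existsP => [[i _ iP]|[i iP]]; exists i => //; rewrite mem_enum.
Qed.

Lemma recb_forall (I : finType) (P : I -> fn bool) : (forall i, recb (P i)) ->
  recb (fun x e => [forall i, P i x e]).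
Proof.
move=> /(recb_all (enum I)); apply: rec_ext => x e; congr nat_of_bool.
apply/allP/forallP => [h i|h i _]; last exact: h.
by apply: h; rewrite mem_enum.
Qed.

(** * Integer-valued recursive functions *)

Local Open Scope ring_scope.

(** Formal differences, not signed absolute values: ring operations then act by polynomials on the
    two components, without any case analysis. *)
Definition recz (f : fn int) := exists p n : fn nat,
  [/\ rec p, rec n & forall x e, f x e = (p x e)%:Z - (n x e)%:Z].

Lemma recz_ext f g : (forall x e, f x e = g x e) -> recz f -> recz g.
Proof. by move=> fg [p [n [pP nP fE]]]; exists p, n; split=> // x e; rewrite -fg. Qed.

Lemma recz_ren f r : recz f -> recz (fun x e => f x (fun i => e (r i))).
Proof.
move=> [p [n [pP nP fE]]].
by exists (fun x e => p x (fun i => e (r i))), (fun x e => n x (fun i => e (r i)));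
  split; [exact: rec_ren|exact: rec_ren|move=> *; rewrite fE].
Qed.

Lemma recz_nat f : rec f -> recz (fun x e => (f x e)%:Z).
Proof. by move=> fP; exists f, (fun _ _ => 0%N); split=> // *; rewrite ?subr0 //; exact: rec_zero. Qed.

Lemma recz_opp f : recz f -> recz (fun x e => - f x e).
Proof. by move=> [p [n [pP nP fE]]]; exists n, p; split=> // *; rewrite fE opprB. Qed.

Lemma recz_const z : recz (fun x e => z).
Proof.
case: z => n; first exact: (recz_nat (rec_const n)).
by rewrite NegzE; exact: (recz_opp (recz_nat (rec_const n.+1))).
Qed.

Lemma recz_add f g : recz f -> recz g -> recz (fun x e => f x e + g x e).
Proof.
move=> [p [n [pP nP fE]]] [p' [n' [pP' nP' gE]]].
exists (fun x e => p x e + p' x e)%N, (fun x e => n x e + n' x e)%N.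
by split=> *; rewrite ?fE ?gE; [exact: rec_add|exact: rec_add|lia].
Qed.

Lemma recz_sub f g : recz f -> recz g -> recz (fun x e => f x e - g x e).
Proof. by move=> fP /recz_opp; exact: recz_add. Qed.

Lemma recz_mul f g : recz f -> recz g -> recz (fun x e => f x e * g x e).
Proof.
move=> [p [n [pP nP fE]]] [p' [n' [pP' nP' gE]]].
exists (fun x e => p x e * p' x e + n x e * n' x e)%N,
       (fun x e => p x e * n' x e + n x e * p' x e)%N.
by split=> *; rewrite ?fE ?gE; [do !apply: rec_add; exact: rec_mul
  |do !apply: rec_add; exact: rec_mul|lia].
Qed.

Lemma recz_if (P : fn bool) f g : recb P -> recz f -> recz g ->
  recz (fun x e => if P x e then f x e else g x e).
Proof.
move=> PP [p [n [pP nP fE]]] [p' [n' [pP' nP' gE]]].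
exists (fun x e => if P x e then p x e else p' x e),
       (fun x e => if P x e then n x e else n' x e).
by split; [exact: rec_if|exact: rec_if|move=> x e; case: ifP].
Qed.

Lemma recb_lez f g : recz f -> recz g -> recb (fun x e => f x e <= g x e).
Proof.
move=> [p [n [pP nP fE]]] [p' [n' [pP' nP' gE]]].
apply: rec_ext (recb_leq (rec_add pP nP') (rec_add pP' nP)) => x e.
by rewrite fE gE; congr nat_of_bool; lia.
Qed.

Lemma recb_ltz f g : recz f -> recz g -> recb (fun x e => f x e < g x e).
Proof.
move=> fP gP; apply: rec_ext (recb_not (recb_lez gP fP)) => x e.
by rewrite -ltNge.
Qed.

Lemma recz_min f g : recz f -> recz g -> recz (fun x e => Num.min (f x e) (g x e)).
Proof.
by move=> fP gP; apply: recz_ext (recz_if (recb_ltz fP gP) fP gP) => x e.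
Qed.

Lemma recz_max f g : recz f -> recz g -> recz (fun x e => Num.max (f x e) (g x e)).
Proof.
by move=> fP gP; apply: recz_ext (recz_if (recb_ltz fP gP) gP fP) => x e.
Qed.

Lemma rec_absz f : recz f -> rec (fun x e => `|f x e|%N).
Proof.
move=> [p [n [pP nP fE]]].
apply: rec_ext (rec_add (rec_sub pP nP) (rec_sub nP pP)) => x e.
by rewrite fE; lia.
Qed.

Lemma recz_pow2 f : rec f -> recz (fun x e => 2 ^+ f x e).
Proof.
move=> /(rec_exp (rec_const 2))/recz_nat; apply: recz_ext => x e.
by rewrite -natrX natz.
Qed.

Lemma recz_divz f d : recz f -> rec d -> recz (fun x e => (f x e %/ (d x e)%:Z)%Z).
Proof.
move=> [p [n [pP nP fE]]] dP.
have pos := recz_nat (rec_div (rec_sub pP nP) dP).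
(* The floor of a negative quotient is minus the ceiling of its opposite; adding [d - 1] before
   dividing turns floor into ceiling. *)
have neg := recz_opp (recz_nat (rec_div (rec_add (rec_sub nP pP) (rec_pred dP)) dP)).
apply: recz_ext (recz_if (recb_leq nP pP) pos neg) => x e; rewrite fE.
case: leqP => [le|lt]; first by rewrite subzn // divz_nat.
case: (d x e) => [|k]; first by rewrite divn0 divz0.
have -> : (p x e)%:Z - (n x e)%:Z = Negz (n x e - p x e).-1 by lia.
rewrite divNz_nat // -[X in (X + _)%N]prednK ?subn_gt0 // addSn -addnS /=.
by rewrite divnDr ?dvdnn // divnn addn1.
Qed.

(** Unlike a formal difference, this code is a single number, so that an integer can be the
    accumulator of an iteration. *)
Definition zcode (z : int) : nat := (`|z|%N).*2 + (z < 0)%R.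
Definition zdecode (c : nat) : int := if odd c then - (c./2)%:Z else (c./2)%:Z.

Lemma zcodeK : cancel zcode zdecode.
Proof.
move=> z; rewrite /zdecode /zcode addnC oddD odd_double addbF half_bit_double.
by case: (ltrP z 0) => z0 /=; lia.
Qed.

Lemma rec_zcode f : recz f -> rec (fun x e => zcode (f x e)).
Proof.
move=> fP; apply: rec_add; last exact: recb_ltz fP (recz_const 0).
by apply: rec_ext (rec_mul (rec_absz fP) (rec_const 2)) => x e; rewrite muln2.
Qed.

Lemma recz_zdecode f : rec f -> recz (fun x e => zdecode (f x e)).
Proof.
move=> fP; have hP := recz_nat (rec_half fP).
exact: recz_if (recb_odd fP) (recz_opp hP) hP.
Qed.

Lemma recz_iteri n (z : fn int) (t : seq bool -> nat -> int -> (nat -> nat) -> int) :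
  rec n -> recz z ->
  recz (fun x e => t x (e 0%N) (zdecode (e 1%N)) (fun i => e i.+2)) ->
  recz (fun x e => iteri (n x e) (fun k a => t x k a e) (z x e)).
Proof.
move=> nP zP /rec_zcode tP.
have := recz_zdecode (rec_iteri (t := fun x k a e => zcode (t x k (zdecode a) e))
  nP (rec_zcode zP) tP).
apply: recz_ext => x e; elim: (n x e) => [|m IH] /=; first by rewrite zcodeK.
by rewrite IH zcodeK.
Qed.

(** * Rounded exponentials are recursive *)

Section ExpR.
Variable R : realType.

Lemma bernoulli (u : R) n : 0 <= u <= 1 -> 1 - n%:R * u <= (1 - u) ^+ n.
Proof.
move=> u01; elim: n => [|n IH]; first by rewrite mul0r subr0 expr0.
rewrite exprS -natr1; apply: (le_trans _ (ler_wpM2l _ IH)); last by lra.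
have : 0 <= n%:R * (u * u) by rewrite mulr_ge0 ?mulr_ge0 //; lra.
by nra.
Qed.

Lemma expR_lower (y : R) n : `|y| < n%:R -> (1 + y / n%:R) ^+ n <= expR y.
Proof.
move=> yn; have n0 : 0 < n%:R :> R by apply: le_lt_trans yn.
have -> : expR y = expR (y / n%:R) ^+ n.
  by rewrite -expRM_natr divfK // gt_eqF.
apply: lerXn2r; rewrite ?nnegrE ?expR_ge0 ?expR_ge1Dx //.
move: yn; rewrite ltr_norml => /andP[yn _].
by have : -1 < y / n%:R by [rewrite ltr_pdivlMr // mulN1r]; lra.
Qed.

(** The product of [(1 + y / n) ^ n] and [(1 - y / n) ^ n] is [(1 - (y / n) ^ 2) ^ n], at least
    [1 - y ^ 2 / n] by Bernoulli, while the second factor is at most [expR (- y)]. *)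
Lemma expR_lower_cvg (y : R) n : `|y| < n%:R ->
  (1 - y ^+ 2 / n%:R) * expR y <= (1 + y / n%:R) ^+ n.
Proof.
move=> yn; have n0 : 0 < n%:R :> R by apply: le_lt_trans yn.
have hN : (1 - y / n%:R) ^+ n <= expR (- y).
  by have := @expR_lower (- y) n; rewrite normrN mulNr; exact.
have [y1 y2] : -1 < y / n%:R /\ y / n%:R < 1.
  move: yn; rewrite ltr_norml => /andP[yn1 yn2].
  by rewrite ltr_pdivlMr // mulN1r ltr_pdivrMr // mul1r.
have h0 : 0 < (1 - y / n%:R) ^+ n by apply: exprn_gt0; lra.
have h1 : 1 - y ^+ 2 / n%:R <= (1 + y / n%:R) ^+ n * (1 - y / n%:R) ^+ n.
  rewrite -exprMn.
  have -> : (1 + y / n%:R) * (1 - y / n%:R) = 1 - (y / n%:R) ^+ 2 by ring.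
  apply: le_trans (bernoulli n _); last first.
    by rewrite sqr_ge0 /= expr2; nra.
  have -> : n%:R * (y / n%:R) ^+ 2 = y ^+ 2 / n%:R by field; rewrite gt_eqF.
  exact: lexx.
rewrite -(@ler_pM2r _ (expR (- y))) ?expR_gt0 // -mulrA -expRD subrr expR0 mulr1.
apply: le_trans h1 _; apply: ler_wpM2l => //.
by apply: exprn_ge0; lra.
Qed.

Lemma expR_lower_lim (y q : R) : q < expR y ->
  exists n : nat, `|y| < n%:R /\ q < (1 + y / n%:R) ^+ n.
Proof.
move=> qy; set d := expR y - q; have d0 : 0 < d by rewrite subr_gt0.
(* Any [n] above [z] exceeds the absolute value of [y] and makes the error [y ^ 2 * expR y / n]
   smaller than the gap [d]. *)
pose z := `|y| + y ^+ 2 * expR y / d.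
have w0 : 0 <= y ^+ 2 * expR y / d.
  by rewrite divr_ge0 ?(ltW d0) // mulr_ge0 ?sqr_ge0 ?expR_ge0.
have z0 : 0 <= z by rewrite addr_ge0.
have := archi_boundP z0; set n := Num.Def.archi_bound z => zn; exists n.
have n0 : 0 < n%:R :> R by apply: le_lt_trans zn.
have yn : `|y| < n%:R.
  by apply: le_lt_trans zn; rewrite lerDl.
split=> //; apply: lt_le_trans (expR_lower_cvg yn).
rewrite mulrBl mul1r ltrBrDl -ltrBrDr -/d mulrAC ltr_pdivrMr // -ltr_pdivrMl //.
by rewrite mulrC; apply: le_lt_trans zn; rewrite lerDr.
Qed.

(* [s / 2 ^ j] is the argument of the exponential and [n] the number of factors
   in the bound [(1 + y / n) ^ n]. *)
Definition exp_test (s : int) (j a b n : nat) : bool :=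
  (`|s| < n * 2 ^ j)%N &&
  (a * (n * 2 ^ j) ^ n < absz ((n * 2 ^ j)%N%:Z + s)%R ^ n * b)%N.

(** Clearing denominators turns the comparison with [(1 + y / n) ^ n] into one between natural
    numbers. As these lower bounds converge, a strict inequality is always witnessed by some [n]. *)
Lemma exp_testP (s : int) (j a b : nat) :
  reflect (exists n, exp_test s j a b n) (a%:R < expR (s%:~R / 2 ^+ j) * b%:R :> R).
Proof.
set y := s%:~R / 2 ^+ j.
have key n : exp_test s j a b n <->
    `|y| < n%:R /\ a%:R < (1 + y / n%:R) ^+ n * b%:R.
  have p2 : 0 < 2 ^+ j :> R by rewrite exprn_gt0.
  have e1 : (`|s| < n * 2 ^ j)%N = (`|y| < n%:R).
    rewrite /y normrM normfV (gtr0_norm p2) ltr_pdivrMr // -[2 ^+ j]natrX -natrM.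
    by rewrite -intr_norm -natr_absz ltr_nat.
  rewrite /exp_test e1; case yn: (_ < _) => /=; last by split=> // -[].
  have n0 : 0 < n%:R :> R by apply: le_lt_trans yn.
  have M0 : 0 < (n * 2 ^ j)%:R :> R by rewrite natrM natrX mulr_gt0.
  have -> : 1 + y / n%:R = (absz ((n * 2 ^ j)%N%:Z + s)%R)%:R / (n * 2 ^ j)%:R.
    have Ms : 0 <= (n * 2 ^ j)%N%:Z + s by move: e1; rewrite yn; lia.
    rewrite -[X in X / _](_ : ((n * 2 ^ j)%N%:Z + s)%:~R = _); last first.
      by rewrite -[in LHS](gez0_abs Ms).
    rewrite intrD -pmulrn natrM natrX /y; field.
    by rewrite !gt_eqF.
  rewrite expr_div_n mulrAC ltr_pdivlMr ?exprn_gt0 //.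
  rewrite -!natrX -!natrM ltr_nat; split=> [|[]] //.
apply: (iffP idP) => [ay|[n /key[yn an]]]; last first.
  by apply: lt_le_trans an _; rewrite ler_wpM2r // expR_lower.
have b0 : 0 < b%:R :> R.
  by case: (b) ay => [|b']; rewrite ?ltr0Sn // mulr0 ltNge ler0n.
have [|n [yn an]] := @expR_lower_lim y (a%:R / b%:R).
  by rewrite ltr_pdivrMr.
by exists n; apply/key; split=> //; rewrite -ltr_pdivrMr.
Qed.

Lemma recb_exp_test s j (a b n : fn nat) : rec a -> rec b -> rec n ->
  recb (fun x e => exp_test s j (a x e) (b x e) (n x e)).
Proof.
move=> aP bP nP; have MP := rec_mul nP (rec_const (2 ^ j)).
apply: recb_and; first exact: recb_ltn (rec_const _) MP.
apply: recb_ltn; first exact: rec_mul aP (rec_exp MP nP).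
apply: rec_mul bP; apply: rec_exp nP; apply: rec_absz.
exact: recz_add (recz_nat MP) (recz_const s).
Qed.

(** Since [exp_test] only bounds from below, an upper bound on [expR y] is searched as a lower bound
    on [expR (- y)]. Both searches run in parallel, and the first success [m a b] tells which side
    holds. *)
Lemma expR_lt_rec (y : R) : dyadic y -> exists P : nat -> nat -> bool,
  recb (fun x e => P (e 0%N) (e 1%N)) /\
  forall a b, P a b = (expR y * 2 ^+ b < a%:R).
Proof.
move=> [s [j ->]]; set Y := expR _.
have [[a0 [b0 Y0]]|Ynd] := pselect (exists a b : nat, Y * 2 ^+ b = a%:R).
  exists (fun a b => a0 * 2 ^ b < a * 2 ^ b0)%N; split.
    apply: recb_ltn; apply: rec_mul; try exact: rec_const; try exact: rec_var.
    exact: rec_exp (rec_const 2) (rec_var _).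
  move=> a b; rewrite -(ltr_nat R) !natrM !natrX -Y0.
  by rewrite mulrAC ltr_pM2r // exprn_gt0.
have ex a b : exists n, exp_test s j a (2 ^ b) n || exp_test (- s) j (2 ^ b) a n.
  have : Y * 2 ^+ b != a%:R by apply/eqP => Yab; apply: Ynd; exists a, b.
  rewrite neq_lt => /orP[Ya|aY].
    suff /exp_testP[n nP] : (2 ^ b)%:R < expR ((- s)%:~R / 2 ^+ j) * a%:R :> R.
      by exists n; rewrite nP orbT.
    rewrite intrN mulNr expRN -/Y natrX ltr_pdivlMl ?expR_gt0 //.
  suff /exp_testP[n nP] : a%:R < Y * (2 ^ b)%:R by exists n; rewrite nP.
  by rewrite natrX.
pose m a b := ex_minn (ex a b).
exists (fun a b => exp_test (- s) j (2 ^ b) a (m a b)); split.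
  have mP : rec (fun x e => m (e 0%N) (e 1%N)).
    apply: (@rec_least (fun x e => exp_test s j (e 1%N) (2 ^ e 2) (e 0%N)
        || exp_test (- s) j (2 ^ e 2) (e 1%N) (e 0%N))).
      have p2 := rec_exp (rec_const 2) (rec_var 2).
      by apply: recb_or; apply: recb_exp_test => //; exact: rec_var.
    move=> x e /=; rewrite /m; case: ex_minnP => n nP nmin; split=> // i.
    by apply: contraTN => /nmin; rewrite -leqNgt.
  apply: recb_exp_test mP; last exact: rec_var.
  exact: rec_exp (rec_const 2) (rec_var _).
move=> a b; have tP n : exp_test (- s) j (2 ^ b) a n -> Y * 2 ^+ b < a%:R.
  move=> nP; have /exp_testP : exists n, exp_test (- s) j (2 ^ b) a n by exists n.
  rewrite intrN mulNr expRN -/Y natrX ltr_pdivlMl ?expR_gt0 //.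
apply/idP/idP => [/tP//|Yab]; rewrite /m; case: ex_minnP => n /orP[nP|//] _.
have /exp_testP : exists n, exp_test s j a (2 ^ b) n by exists n.
by rewrite natrX -/Y ltNge ltW.
Qed.

Lemma recz_floor_exp (y : R) (h : fn nat) : dyadic y -> rec h ->
  recz (fun x e => Num.floor (expR y * 2 ^+ h x e + 2^-1)).
Proof.
move=> /expR_lt_rec[P [PP PE]].
suff F : rec (fun x e => `|Num.floor (expR y * 2 ^+ e 0%N + 2^-1)|%N).
  move=> hP; have := recz_nat (rec1 (F := fun n => `|Num.floor (expR y * 2 ^+ n + 2^-1)|%N) F hP).
  apply: recz_ext => x e; rewrite gez0_abs // floor_ge0.
  by rewrite addr_ge0 ?mulr_ge0 ?expR_ge0 ?exprn_ge0 ?invr_ge0.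
(* The floor is the least [n] with [expR y * 2 ^ b + 1 / 2 < n + 1]; doubling gives
   [expR y * 2 ^ (b + 1) < 2 * n + 1], a comparison of the form decided by [P]. *)
apply: (@rec_least (fun x e => P (e 0%N).*2.+1 (e 1%N).+1)).
  apply: (rec2 (F := fun a b => P a b) PP (f := fun x e => (e 0%N).*2.+1) (g := fun x e => (e 1%N).+1)); last exact/rec_succ/rec_var.
  apply: rec_succ; apply: rec_ext (rec_mul (rec_var 0) (rec_const 2)) => x e.
  by rewrite muln2.
move=> x e /=; set z := expR y * 2 ^+ e 0%N + 2^-1.
have PzE n : P n.*2.+1 (e 0%N).+1 = (z < n%:R + 1).
  rewrite PE /z exprSr mulrA.
  have -> : (n.*2.+1)%:R = 2 * n%:R + 1 :> R by rewrite -addn1 natrD -mul2n natrM.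
  by apply/idP/idP; lra.
have z0 : 0 <= Num.floor z.
  by rewrite floor_ge0 addr_ge0 ?mulr_ge0 ?expR_ge0 ?exprn_ge0 ?invr_ge0.
have zE : (`|Num.floor z|%N)%:R = (Num.floor z)%:~R :> R.
  by rewrite -[in RHS](gez0_abs z0).
have /andP[z1 z2] := floor_itv z; split.
  by rewrite PzE zE; move: z2; rewrite intrD.
move=> n nz; rewrite PzE -leNgt; apply: le_trans z1; rewrite -zE.
by rewrite natr1 ler_nat.
Qed.

End ExpR.

(** * Fixed-point inference is recursive *)

Section FixedPoint.
Variable R : realType.

Definition clip (p : nat) (k : int) : int :=
  Num.min (Num.max (- 2 ^+ p.-1) k) (2 ^+ p.-1 - 1).

Definition recr (p : fn nat) (f : fn R) := exists2 k : fn int, recz k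
  & forall x e, f x e = (k x e)%:~R / 2 ^+ (p x e)./2.

Lemma recr_ext p f g : (forall x e, f x e = g x e) -> recr p f -> recr p g.
Proof. by move=> fg [k kP fE]; exists k => // x e; rewrite -fg. Qed.

Lemma recz_clip p k : rec p -> recz k -> recz (fun x e => clip (p x e) (k x e)).
Proof.
move=> /rec_pred/recz_pow2 pP kP.
apply: recz_min (recz_sub pP (recz_const 1)).
exact: recz_max (recz_opp pP) kP.
Qed.

Lemma recr_fixpt p u k : rec p -> recz k ->
  (forall x e, Num.floor (u x e * 2 ^+ (p x e)./2 + 2^-1) = k x e) ->
  recr p (fun x e => fixpt (p x e) (u x e)).
Proof.
move=> pP kP uE; exists (fun x e => clip (p x e) (k x e)); first exact: recz_clip.
by move=> x e; rewrite /fixpt uE.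
Qed.

Lemma floor_divz (a : int) (d : nat) :
  Num.floor (a%:~R / d%:R : R) = (a %/ d%:Z)%Z.
Proof.
have [->|d0] := posnP d; first by rewrite divz0 invr0 mulr0 floor0.
have d0' : 0 < d%:R :> R by rewrite ltr0n.
apply: floor_def; rewrite ler_pdivlMr // ltr_pdivrMr // !pmulrn -!intrM.
rewrite ler_int ltr_int; have d1 : d%:Z != 0 by lia.
have m0 := modz_ge0 a d1; have m1 : (a %% d)%Z < d by apply: ltz_pmod; lia.
have aE := divz_eq a d; rewrite mulrDl mul1r.
by move: aE m0 m1; set q := (a %/ d)%Z; set m := (a %% d)%Z => *; apply/andP; split; lia.
Qed.

Lemma floor_divz_half (a : int) (d : nat) : (0 < d)%N ->
  Num.floor (a%:~R / d%:R + 2^-1 : R) = ((2 * a + d%:Z) %/ (2 * d)%N%:Z)%Z.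
Proof.
move=> d0; rewrite -floor_divz; congr Num.floor.
have d0' : 0 < d%:R :> R by rewrite ltr0n.
rewrite natrM intrD intrM -pmulrn; field.
by rewrite gt_eqF.
Qed.

Lemma pow2_gt0 n : 0 < 2 ^+ n :> R. Proof. by rewrite exprn_gt0. Qed.
Lemma pow2_neq0 n : 2 ^+ n != 0 :> R. Proof. by rewrite gt_eqF ?pow2_gt0. Qed.
Hint Resolve pow2_gt0 pow2_neq0 : core.

Lemma floor_int_half (k : int) : Num.floor (k%:~R + 2^-1 : R) = k.
Proof.
apply: floor_def; rewrite intrD mulr1z lerDl ltrD2l invr_ge0 ler0n /=.
by rewrite invf_lt1 ?ltr1n ?ltr0n.
Qed.

Lemma recr_dyadic p (y : R) : rec p -> dyadic y -> recr p (fun x e => fixpt (p x e) y).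
Proof.
move=> pP [m [j ->]].
apply: (@recr_fixpt _ _ (fun x e => ((2 * (m * 2 ^+ (p x e)./2) + (2 ^ j)%N%:Z)
    %/ (2 * 2 ^ j)%N%:Z)%Z)) => //.
  apply: recz_divz; last exact: rec_const.
  apply: recz_add; last exact: recz_const.
  apply: recz_mul; first exact: recz_const.
  by apply: recz_mul; [exact: recz_const|exact/recz_pow2/rec_half].
move=> x e; rewrite -floor_divz_half ?expn_gt0 //; congr Num.floor.
by rewrite natrX intrM rmorphXn /= mulrAC.
Qed.

Section Ops.
Variable p : fn nat.
Hypothesis pP : rec p.

Lemma recr0 : recr p (fun x e => 0).
Proof. by exists (fun x e => 0) => [|x e]; [exact: recz_const|rewrite mul0r]. Qed.

Lemma recr_radd f g : recr p f -> recr p g ->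
  recr p (fun x e => radd (fixpt (p x e)) (f x e) (g x e)).
Proof.
move=> [kf kfP fE] [kg kgP gE]; apply: recr_fixpt (recz_add kfP kgP) _ => // x e.
by rewrite -[RHS]floor_int_half fE gE intrD -mulrDl divfK.
Qed.

Lemma recr_rmul f g : recr p f -> recr p g ->
  recr p (fun x e => rmul (fixpt (p x e)) (f x e) (g x e)).
Proof.
move=> [kf kfP fE] [kg kgP gE].
apply: (@recr_fixpt _ _ (fun x e => ((2 * (kf x e * kg x e) + (2 ^ (p x e)./2)%N%:Z)
    %/ (2 * 2 ^ (p x e)./2)%N%:Z)%Z)) => //.
  have dP := rec_exp (rec_const 2) (rec_half pP).
  apply: recz_divz (rec_mul (rec_const 2) dP).
  apply: recz_add (recz_nat dP).
  exact: recz_mul (recz_const 2) (recz_mul kfP kgP).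
move=> x e; rewrite -floor_divz_half ?expn_gt0 // fE gE; congr (Num.floor (_ + _)).
by rewrite natrX intrM; field.
Qed.

Lemma recr_rdiv f g : recr p f -> recr p g ->
  recr p (fun x e => fixpt (p x e) (f x e / g x e)).
Proof.
move=> [kf kfP fE] [kg kgP gE].
(* The sign of the divisor moves to the numerator, because [recz_divz] divides by a natural
   number. *)
pose a x e := (if kg x e < 0 then - kf x e else kf x e) * 2 ^+ (p x e)./2.
pose d x e := `|kg x e|%N.
apply: (@recr_fixpt _ _ (fun x e => ((2 * a x e + (d x e)%:Z)
    %/ (2 * d x e)%N%:Z)%Z)) => //.
  have dP := rec_absz kgP.
  apply: recz_divz (rec_mul (rec_const 2) dP).
  apply: recz_add (recz_nat dP); apply: recz_mul (recz_const 2) _.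
  apply: recz_mul (recz_pow2 (rec_half pP)).
  by apply: recz_if (recz_opp kfP) kfP; exact: recb_ltz (recz_const 0).
(* For a null divisor both conventions, in the field and in [int], give [0], and so do the
   roundings. *)
move=> x e; rewrite fE gE; case: (posnP (d x e)) => [d0|d0].
  rewrite d0 muln0 divz0; have -> : kg x e = 0 by apply/eqP; rewrite -absz_eq0 -/(d x e) d0.
  by rewrite mul0r invr0 mulr0 mul0r -[RHS]floor_int_half.
rewrite -floor_divz_half //; congr (Num.floor (_ + _)).
have kg0 : kg x e != 0 by rewrite -absz_gt0.
have kg0' : (kg x e)%:~R != 0 :> R by rewrite intr_eq0.
rewrite /a /d natr_absz; case: ltrP => kgs.
  rewrite (ltr0_norm kgs) intrM !intrN rmorphXn /=; field.
  by rewrite kg0' pow2_neq0.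
rewrite (ger0_norm kgs) intrM rmorphXn /=; field.
by rewrite kg0' pow2_neq0.
Qed.

Lemma recr_max0 f : recr p f -> recr p (fun x e => Num.max 0 (f x e)).
Proof.
move=> [k kP fE]; exists (fun x e => Num.max 0 (k x e)).
  exact: recz_max (recz_const 0) kP.
move=> x e; rewrite fE; have i0 : 0 <= (2 ^+ (p x e)./2)^-1 :> R by rewrite invr_ge0 ltW.
have [k0|k0] := leP 0 (k x e).
  by rewrite max_r // mulr_ge0 // ler0z.
by rewrite mul0r max_l // mulr_le0_ge0 // lerz0 ltW.
Qed.

Lemma recb_ltr f g : recr p f -> recr p g -> recb (fun x e => f x e < g x e).
Proof.
move=> [kf kfP fE] [kg kgP gE]; apply: rec_ext (recb_ltz kfP kgP) => x e.
by rewrite fE gE ltr_pM2r ?invr_gt0 // ltr_int.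
Qed.

Lemma recr_big (I : Type) (r : seq I) (F : I -> fn R) : (forall i, recr p (F i)) ->
  recr p (fun x e => \big[radd (fixpt (p x e))/0]_(i <- r) F i x e).
Proof.
move=> FP; elim: r => [|i r IH].
  by apply: recr_ext recr0 => x e; rewrite big_nil.
by apply: recr_ext (recr_radd (FP i) IH) => x e; rewrite big_cons.
Qed.

Definition recv n (u : fn 'cV[R]_n) := forall i, recr p (fun x e => u x e i 0).

Lemma recr_rdot n (u v : fn 'cV[R]_n) : recv u -> recv v ->
  recr p (fun x e => rdot (fixpt (p x e)) (u x e) (v x e)).
Proof. by move=> uP vP; apply: recr_big => i; exact: recr_rmul. Qed.

Lemma recr_load m n (A : 'M[R]_(m, n)) i j : dyadic_mx A ->
  recr p (fun x e => load (fixpt (p x e)) A i j).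
Proof.
by move=> AP; apply: recr_ext (recr_dyadic pP (AP i j)) => x e; rewrite mxE.
Qed.

Lemma recv_rmulmx m n (A : 'M[R]_(m, n)) (u : fn 'cV[R]_n) : dyadic_mx A -> recv u ->
  recv (fun x e => rmulmx (fixpt (p x e)) (load (fixpt (p x e)) A) (u x e)).
Proof.
move=> AP uP i; apply: recr_ext; first by move=> x e; rewrite mxE; reflexivity.
by apply: recr_big => j; apply: recr_rmul => //; exact: recr_load.
Qed.

Lemma recv_raddv n (u v : fn 'cV[R]_n) : recv u -> recv v ->
  recv (fun x e => raddv (fixpt (p x e)) (u x e) (v x e)).
Proof.
by move=> uP vP i; apply: recr_ext (recr_radd (uP i) (vP i)) => x e; rewrite mxE.
Qed.

Lemma recv_relu n (u : fn 'cV[R]_n) : recv u -> recv (fun x e => relu (u x e)).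
Proof. by move=> uP i; apply: recr_ext (recr_max0 (uP i)) => x e; rewrite mxE. Qed.

Lemma recv_load n (b : 'cV[R]_n) : dyadic_mx b ->
  recv (fun x e => load (fixpt (p x e)) b).
Proof. by move=> bP i; exact: recr_load. Qed.

Lemma recv_net_eval m n (N : relu_net R m n) (u : fn 'cV[R]_m) :
  dyadic_net N -> recv u -> recv (fun x e => net_eval (fixpt (p x e)) N (u x e)).
Proof.
elim: N u => {m n} [m n A b u [AP bP] uP|m k n A b N IH u [AP bP NP] uP] /=.
  by apply: recv_raddv; [exact: recv_rmulmx|exact: recv_load].
apply: (IH (fun x e => relu (raddv (fixpt (p x e)) (rmulmx (fixpt (p x e))
  (load (fixpt (p x e)) A) (u x e)) (load (fixpt (p x e)) b)))) => //.
by apply/recv_relu/recv_raddv; [exact: recv_rmulmx|exact: recv_load].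
Qed.

End Ops.

(** * Attention scores are eventually independent of the precision *)

Lemma dyadicD (y z : R) : dyadic y -> dyadic z -> dyadic (y + z).
Proof.
move=> [m [j ->]] [m' [j' ->]]; exists (m * 2 ^+ j' + m' * 2 ^+ j), (j + j')%N.
by rewrite intrD !intrM !rmorphXn exprD /=; field; rewrite !pow2_neq0.
Qed.

Lemma dyadicM (y z : R) : dyadic y -> dyadic z -> dyadic (y * z).
Proof.
move=> [m [j ->]] [m' [j' ->]]; exists (m * m'), (j + j')%N.
by rewrite intrM exprD; field; rewrite !pow2_neq0.
Qed.

Lemma dyadic_int (m : int) : dyadic (m%:~R : R).
Proof. by exists m, 0%N; rewrite expr0 divr1. Qed.

Lemma fixpt_exact p (k : int) : `|k| < 2 ^+ p.-1 ->
  fixpt p (k%:~R / 2 ^+ p./2) = k%:~R / 2 ^+ p./2 :> R.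
Proof.
move=> kp; rewrite /fixpt divfK // floor_int_half.
by rewrite min_l ?max_r //; lia.
Qed.

Lemma fixpt_dyadic (y : R) : dyadic y ->
  exists p0, forall p, (p0 <= p)%N -> fixpt p y = y.
Proof.
(* The term [2 * j] provides enough fractional bits; the rest prevents saturation, through the crude
   bound of [m] by two to the power of its absolute value. *)
move=> [m [j ->]]; exists (2 * j + 2 * `|m| + 4)%N => p pp.
have jp : (j <= p./2)%N by lia.
have -> : m%:~R / 2 ^+ j = (m * 2 ^+ (p./2 - j))%:~R / 2 ^+ p./2 :> R.
  rewrite intrM rmorphXn /= -[in RHS](subnK jp) exprD addnK; field.
  by rewrite !pow2_neq0.
apply: fixpt_exact; rewrite normrM normrX.
apply: (@le_lt_trans _ _ (`|m| * 2 ^+ p./2)).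
  by rewrite ler_wpM2l // ler_weXn2l // leq_subr.
have -> : p.-1 = ((p.-1 - p./2) + p./2)%N by lia.
rewrite exprD ltr_pM2r ?exprn_gt0 //.
apply: (@lt_le_trans _ _ (2 ^+ `|m|)); last by rewrite ler_weXn2l //; lia.
by have := ltn_expl `|m| (isT : 1 < 2)%N; rewrite -natrX natz -abszE ltz_nat.
Qed.

(** Sums and products preserve this property, since a fixed dyadic number is eventually represented
    exactly. Quotients would not, as [1 / 3] shows, but attention scores before the exponential
    involve none. *)
Definition evdyadic (f : nat -> R) := exists p0 y, dyadic y /\
  forall p, (p0 <= p)%N -> f p = y.

Lemma evdyadic_fixpt f : evdyadic f -> evdyadic (fun p => fixpt p (f p)).
Proof.
move=> [p0 [y [yP fE]]]; have [p1 p1P] := fixpt_dyadic yP.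
exists (maxn p0 p1), y; split=> // p; rewrite geq_max => /andP[h0 h1].
by rewrite fE // p1P.
Qed.

Lemma evdyadic_cst y : dyadic y -> evdyadic (fun=> y).
Proof. by exists 0%N, y. Qed.

Lemma evdyadic_radd f g : evdyadic f -> evdyadic g ->
  evdyadic (fun p => radd (fixpt p) (f p) (g p)).
Proof.
move=> [p0 [y [yP fE]]] [p1 [z [zP gE]]]; apply: evdyadic_fixpt.
exists (maxn p0 p1), (y + z); split; first exact: dyadicD.
by move=> p; rewrite geq_max => /andP[h0 h1]; rewrite fE ?gE.
Qed.

Lemma evdyadic_rmul f g : evdyadic f -> evdyadic g ->
  evdyadic (fun p => rmul (fixpt p) (f p) (g p)).
Proof.
move=> [p0 [y [yP fE]]] [p1 [z [zP gE]]]; apply: evdyadic_fixpt.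
exists (maxn p0 p1), (y * z); split; first exact: dyadicM.
by move=> p; rewrite geq_max => /andP[h0 h1]; rewrite fE ?gE.
Qed.

Lemma evdyadic_big (I : Type) (r : seq I) (F : I -> nat -> R) :
  (forall i, evdyadic (F i)) ->
  evdyadic (fun p => \big[radd (fixpt p)/0]_(i <- r) F i p).
Proof.
move=> FP; elim: r => [|i r [p0 [y [yP rE]]]].
  by exists 0%N, 0; split; [exact: (dyadic_int 0)|move=> p _; rewrite big_nil].
have [p1 [z [zP sE]]] := evdyadic_radd (FP i) (ex_intro _ p0 (ex_intro _ y (conj yP rE))).
by exists p1, z; split=> // p /sE <-; rewrite big_cons.
Qed.

Lemma evdyadic_load m n (A : 'M[R]_(m, n)) i j : dyadic_mx A ->
  evdyadic (fun p => load (fixpt p) A i j).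
Proof.
move=> AP; have [p0 [y [yP fE]]] := evdyadic_fixpt (evdyadic_cst (AP i j)).
by exists p0, y; split=> // p /fE <-; rewrite mxE.
Qed.

Lemma evdyadic_rmulmx m n (A : 'M[R]_(m, n)) (u : nat -> 'cV[R]_n) i :
  dyadic_mx A -> (forall j, evdyadic (fun p => u p j 0)) ->
  evdyadic (fun p => rmulmx (fixpt p) (load (fixpt p) A) (u p) i 0).
Proof.
move=> AP uP; have [p0 [y [yP fE]]] := evdyadic_big (index_enum 'I_n)
  (fun j => evdyadic_rmul (evdyadic_load i j AP) (uP j)).
by exists p0, y; split=> // p /fE <-; rewrite mxE.
Qed.

Lemma evdyadic_rdot n (u v : nat -> 'cV[R]_n) :
  (forall j, evdyadic (fun p => u p j 0)) -> (forall j, evdyadic (fun p => v p j 0)) ->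
  evdyadic (fun p => rdot (fixpt p) (u p) (v p)).
Proof. by move=> uP vP; apply: evdyadic_big => i; exact: evdyadic_rmul. Qed.

(** The finitely many values at precisions below [p0] are hard-wired as constants, one at each step
    of the induction. *)
Lemma recz_eventually (k : nat -> int) (p : fn nat) (k' : fn int) p0 :
  rec p -> recz k' -> (forall x e, (p0 <= p x e)%N -> k (p x e) = k' x e) ->
  recz (fun x e => k (p x e)).
Proof.
move=> pP; elim: p0 k' => [|p0 IH] k' kP kE.
  by apply: recz_ext kP => x e; rewrite kE.
apply: (IH (fun x e => if p x e == p0 then k p0 else k' x e)).
  by apply: recz_if kP; [exact: recb_eqn (rec_const _)|exact: recz_const].
by move=> x e; case: eqVneq => [->//|ne le]; apply: kE; lia.
Qed.

Lemma recr_exp (p : fn nat) (f : nat -> R) : rec p -> evdyadic f ->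
  recr p (fun x e => fixpt (p x e) (expR (f (p x e)))).
Proof.
move=> pP [p0 [y [yP fE]]].
pose k q := Num.floor (expR (f q) * 2 ^+ q./2 + 2^-1).
apply: (recr_fixpt (k := fun x e => k (p x e))) => //.
apply: (recz_eventually (p0 := p0) pP (recz_floor_exp yP (rec_half pP))) => x e p0p.
by rewrite /k fE.
Qed.

End FixedPoint.

(** * Windows are coded by natural numbers *)

Local Open Scope nat_scope.

Definition reco (V : eqType) (g : fn (option V)) :=
  forall v, recb (fun x e => g x e == Some v).

Lemma rec_case (V : finType) (g : fn (option V)) (t : V -> fn nat) :
  reco g -> (forall v, rec (t v)) ->
  rec (fun x e => if g x e is Some v then t v x e else 0).
Proof.
move=> gP tP; apply: rec_ext (rec_sum (index_enum V)
  (fun v => rec_mul (gP v) (tP v))) => x e.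
case: (g x e) => [v|]; last by rewrite big1.
rewrite (bigD1 v) //= eqxx mul1n big1 ?addn0 // => w /negPf wv.
by rewrite (_ : Some v == Some w = false) // eq_sym.
Qed.

Lemma recz_case (V : finType) (g : fn (option V)) (t : V -> fn int) :
  reco g -> (forall v, recz (t v)) ->
  recz (fun x e => if g x e is Some v then t v x e else 0%R).
Proof.
move=> gP tP; apply: recz_ext (recz_zdecode (rec_case gP (fun v => rec_zcode (tP v)))).
by move=> x e; case: (g x e) => [v|//]; rewrite zcodeK.
Qed.

Lemma reco_inp f : rec f -> reco (fun x e => onth x (f x e)).
Proof. by move=> fP b; exact: rec_inp. Qed.

(** Iteration counts upwards while [foldr] starts from the end of the word, hence the index
    [size s - j.+1]. The default [z0] is never reached. *)
Lemma foldr_iteri (T S : Type) (f : T -> S -> S) (z0 z : S) (s : seq T) :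
  foldr f z s = iteri (size s) (fun j a =>
    if ohead (drop (size s - j.+1) s) is Some v then f v a else z0) z.
Proof.
suff h j : j <= size s -> foldr f z (drop (size s - j) s) =
    iteri j (fun j a =>
      if ohead (drop (size s - j.+1) s) is Some v then f v a else z0) z.
  by rewrite -h // subnn drop0.
elim: j => [|j IH] js; first by rewrite subn0 drop_size.
rewrite /= -(IH (ltnW js)); case: s js {IH} => // v0 s js.
by rewrite (drop_nth v0) ?subnSK //=; lia.
Qed.

Section Windows.
Variable V : finType.
Hypothesis V_gt0 : 0 < #|V|.

(** Bijective numeration with digits from [1] to [#|V|]: each natural number codes exactly one word,
    so decoding is total and leading zeros do not arise. *)
Definition wcode (C : seq V) : nat :=
  foldr (fun v w => (enum_rank v).+1 + #|V| * w) 0 C.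

Lemma wcode_cons v C : wcode (v :: C) = (enum_rank v).+1 + #|V| * wcode C.
Proof. by []. Qed.

Lemma wcode_mod v C : (wcode (v :: C)).-1 %% #|V| = enum_rank v.
Proof. by rewrite wcode_cons addSn /= addnC mulnC modnMDl modn_small ?ltn_ord. Qed.

Lemma wcode_div v C : (wcode (v :: C)).-1 %/ #|V| = wcode C.
Proof.
by rewrite wcode_cons addSn /= addnC mulnC divnMDl // divn_small ?ltn_ord ?addn0.
Qed.

Lemma wcode_inj : injective wcode.
Proof.
elim=> [|v C IH] [|w D] //= E.
have := congr1 (fun n => n.-1 %% #|V|) E.
rewrite (wcode_mod v C) (wcode_mod w D) => /ord_inj/enum_rank_inj ->.
have := congr1 (fun n => n.-1 %/ #|V|) E.
by rewrite (wcode_div v C) (wcode_div w D) => /IH ->.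
Qed.

Lemma wcode_surj w : exists C, wcode C = w.
Proof.
elim/ltn_ind: w => -[_|w IH]; first by exists [::].
have [C CE] := IH (w %/ #|V|) (leq_ltn_trans (leq_div _ _) (ltnSn w)).
exists (enum_val (Ordinal (ltn_pmod w V_gt0)) :: C).
by rewrite wcode_cons CE enum_valK /= addSn addnC mulnC -divn_eq.
Qed.

Definition wdecode (w : nat) : seq V := projT1 (cid (wcode_surj w)).

Lemma wdecodeK w : wcode (wdecode w) = w.
Proof. by rewrite /wdecode; case: cid. Qed.

Lemma wcodeK C : wdecode (wcode C) = C.
Proof. by apply: wcode_inj; rewrite wdecodeK. Qed.

Definition recw (C : fn (seq V)) := rec (fun x e => wcode (C x e)).

Lemma recw_ext C D : (forall x e, C x e = D x e) -> recw C -> recw D.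
Proof. by move=> CD; apply: rec_ext => x e; rewrite CD. Qed.

Lemma recw_decode f : rec f -> recw (fun x e => wdecode (f x e)).
Proof. by apply: rec_ext => x e; rewrite wdecodeK. Qed.

Lemma recw_behead C : recw C -> recw (fun x e => behead (C x e)).
Proof.
move=> CP; apply: rec_ext (rec_div (rec_pred CP) (rec_const #|V|)) => x e.
by case: (C x e) => [|v D]; [rewrite div0n|exact: wcode_div].
Qed.

Lemma reco_ohead C : recw C -> reco (fun x e => ohead (C x e)).
Proof.
move=> CP v; apply: rec_ext (recb_and (recb_not (recb_eq0 CP))
   (recb_eqn (rec_mod (rec_pred CP) (rec_const #|V|)) (rec_const (enum_rank v)))) => x e.
case: (C x e) => [//|w D]; rewrite wcode_mod wcode_cons addSn /=.
congr nat_of_bool; apply/eqP/eqP => [/ord_inj/enum_rank_inj -> //|[->] //].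
Qed.

Lemma recw_drop C i : recw C -> rec i -> recw (fun x e => drop (i x e) (C x e)).
Proof.
move=> CP iP; have wP : rec (fun x e => (e 1).-1 %/ #|V|).
  exact: rec_div (rec_pred (rec_var _)) (rec_const _).
apply: rec_ext (rec_iteri (t := fun _ _ a _ => a.-1 %/ #|V|) iP CP wP) => x e.
elim: (i x e) => [|n IH] /=; first by rewrite drop0.
rewrite IH -addn1 addnC -drop_drop.
by case: (drop n _) => [|v D]; [rewrite div0n|rewrite /= drop0; exact: wcode_div].
Qed.

Lemma recb_nil C : recw C -> recb (fun x e => nilp (C x e)).
Proof.
by move=> CP; apply: rec_ext (recb_eq0 CP) => x e; case: (C x e).
Qed.

Lemma rec_size C : recw C -> rec (fun x e => size (C x e)).
Proof.
move=> CP; apply: (@rec_least (fun x e => nilp (drop (e 0) (C x (fun i => e i.+1))))).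
  apply: recb_nil; apply: (recw_drop (C := fun x e => C x (fun i => e i.+1))).
    exact: (rec_ren S CP).
  exact: rec_var.
move=> x e /=; split; first by rewrite /nilp size_drop subnn.
by move=> n nC; rewrite /nilp size_drop -lt0n subn_gt0.
Qed.

Lemma wcode_rcons C v :
  wcode (rcons C v) = wcode C + (enum_rank v).+1 * #|V| ^ size C.
Proof.
elim: C => [|w C IH]; first by rewrite /= muln0 addn0 add0n expn0 muln1.
by rewrite rcons_cons !wcode_cons IH expnS mulnDr addnA mulnCA.
Qed.

Lemma recw_rcons C v : recw C -> recw (fun x e => rcons (C x e) v).
Proof.
move=> CP; apply: rec_ext (rec_add CP (rec_mul (rec_const (enum_rank v).+1)
  (rec_exp (rec_const #|V|) (rec_size CP)))) => x e.
by rewrite wcode_rcons.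
Qed.

Lemma recw_cat C D : recw C -> recw (fun x e => C x e ++ D).
Proof.
elim: D C => [|v D IH] C CP; first by apply: recw_ext CP => x e; rewrite cats0.
apply: recw_ext (IH _ (recw_rcons v CP)) => x e.
by rewrite cat_rcons.
Qed.

Lemma reco_olast C : recw C -> reco (fun x e => olast (C x e)).
Proof.
move=> CP v; apply: rec_ext (reco_ohead (recw_drop CP (rec_pred (rec_size CP))) v).
move=> x e; congr (nat_of_bool (_ == _)); case: (C x e) => // w D.
by rewrite /olast; elim: D w => //= w' D IH w; exact: IH.
Qed.

Lemma recz_foldr C (t : V -> seq bool -> int -> (nat -> nat) -> int) : recw C ->
  (forall v, recz (fun x e => t v x (zdecode (e 1)) (fun i => e i.+2))) ->
  recz (fun x e => foldr (fun v a => t v x a e) 0%R (C x e)).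
Proof.
move=> CP tP; have CP2 : recw (fun x e => C x (fun i => e i.+2)) := rec_ren (fun i => i.+2) CP.
have gP : reco (fun x e => ohead (drop (size (C x (fun i => e i.+2)) - (e 0).+1)
    (C x (fun i => e i.+2)))).
  apply/reco_ohead/recw_drop => //.
  exact: rec_sub (rec_size CP2) (rec_succ (rec_var 0)).
have := recz_iteri (t := fun x j a e =>
  if ohead (drop (size (C x e) - j.+1) (C x e)) is Some v then t v x a e else 0%R)
  (rec_size CP) (recz_const 0%R) (recz_case gP tP).
by apply: recz_ext => x e; rewrite -foldr_iteri.
Qed.

(** * Prompts are recursive in the input *)

Section Prompt.
Variable E : prompter V.

Fixpoint outputs (k : pr_state E) (x : seq bool) : seq V :=
  if x is b :: x' then pr_out k b ++ outputs (pr_next k b) x' else [::].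

Lemma prompt_from_outputs k x :
  prompt_from k x = outputs k x ++ pr_final (foldl (@pr_next _ E) k x).
Proof. by elim: x k => //= b x IH k; rewrite IH catA. Qed.

Lemma outputs_rcons k x b :
  outputs k (rcons x b) = outputs k x ++ pr_out (foldl (@pr_next _ E) k x) b.
Proof. by elim: x k => [|c x IH] k /=; rewrite ?cats0 // IH catA. Qed.

(** The sum is a table look-up: only the state whose rank is [a] contributes. The same device is
    used for the output and the final state. *)
Definition state_code (x : seq bool) (j : nat) : nat :=
  @iteri nat j (fun i a => if onth x i is Some b
    then \sum_(q : pr_state E) (a == enum_rank q :> nat) * enum_rank (pr_next q b)
    else 0) (enum_rank (pr_init E)).

Definition out_code (x : seq bool) (j : nat) : nat :=
  iteri j (fun i w => if onth x i is Some b
    then \sum_(q : pr_state E)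
           (state_code x i == enum_rank q :> nat) * wcode (wdecode w ++ pr_out q b)
    else 0) 0.

Lemma sum_state (k : pr_state E) (F : pr_state E -> nat) :
  \sum_q (enum_rank k == enum_rank q :> nat) * F q = F k.
Proof.
rewrite (bigD1 k) //= eqxx mul1n big1 ?addn0 // => q qk.
by case: eqP => // /ord_inj/enum_rank_inj kq; rewrite kq eqxx in qk.
Qed.

Lemma state_codeE x j : j <= size x ->
  state_code x j = enum_rank (foldl (@pr_next _ E) (pr_init E) (take j x)).
Proof.
elim: j => [|j IH] jx; first by rewrite take0.
rewrite /state_code /= -/(state_code x j) IH ?(ltnW jx) //.
rewrite (take_nth false) // foldl_rcons.
have -> : onth x j = Some (nth false x j) by rewrite onthE (nth_map false).
by rewrite sum_state.
Qed.

Lemma out_codeE x j : j <= size x ->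
  out_code x j = wcode (outputs (pr_init E) (take j x)).
Proof.
elim: j => [|j IH] jx; first by rewrite take0.
rewrite /out_code /= -/(out_code x j) IH ?(ltnW jx) // state_codeE ?(ltnW jx) //.
rewrite (take_nth false) // outputs_rcons.
have -> : onth x j = Some (nth false x j) by rewrite onthE (nth_map false).
by rewrite wcodeK sum_state.
Qed.

Lemma rec_input_size : rec (fun x e => size x).
Proof.
apply: (@rec_least (fun x e => ~~ ((onth x (e 0) == Some true) || (onth x (e 0) == Some false)))).
  by apply: recb_not; apply: recb_or; exact: rec_inp (rec_var 0).
move=> x e /=; split; first by rewrite onthE nth_default ?size_map.
move=> n nx; rewrite onthE (nth_map false) // negbK.
by case: (nth _ _ _).
Qed.

Lemma rec_state_code f : rec f -> rec (fun x e => state_code x (f x e)).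
Proof.
move=> fP; pose t b (a : nat) := \sum_(q : pr_state E)
    (a == enum_rank q :> nat) * enum_rank (pr_next q b).
apply: (rec_iteri (t := fun x i a _ => if onth x i is Some b then t b a else 0)) fP _ _.
  exact: rec_const.
apply: (@rec_case _ _ (fun b x e => t b (e 1))) => [|b]; first exact/reco_inp/rec_var.
apply: rec_sum => q; apply: rec_mul (rec_const _).
exact: recb_eqn (rec_var 1) (rec_const _).
Qed.

Lemma rec_out_code f : rec f -> rec (fun x e => out_code x (f x e)).
Proof.
move=> fP; pose t b x i w := \sum_(q : pr_state E)
    (state_code x i == enum_rank q :> nat) * wcode (wdecode w ++ pr_out q b).
apply: (rec_iteri (t := fun x i w _ => if onth x i is Some b then t b x i w else 0)) fP _ _.
  exact: rec_const.
apply: (@rec_case _ _ (fun b x e => t b x (e 0) (e 1))) => [|b]; first exact/reco_inp/rec_var.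
apply: rec_sum => q; apply: rec_mul.
  exact: recb_eqn (rec_state_code (rec_var 0)) (rec_const _).
exact/recw_cat/recw_decode/rec_var.
Qed.

Lemma recw_prompt : recw (fun x e => prompt E x).
Proof.
have sP := rec_state_code rec_input_size; have oP := rec_out_code rec_input_size.
apply: rec_ext (rec_sum (index_enum (pr_state E)) (fun q =>
  rec_mul (recb_eqn sP (rec_const (enum_rank q)))
    (recw_cat (pr_final q) (recw_decode oP)))) => x e.
rewrite state_codeE // out_codeE // take_size wcodeK.
by rewrite (sum_state _ (fun q => wcode (_ ++ pr_final q))) /prompt prompt_from_outputs.
Qed.

End Prompt.

End Windows.

(** * Generation is recursive *)

Local Open Scope ring_scope.

Lemma rec_log_bits c f : rec f -> rec (fun x e => log_bits c (f x e)).
Proof.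
by move=> fP; exact: rec_mul (rec_const c) (rec_succ (rec_trunc_log fP)).
Qed.

Lemma radd_clip (R : realType) p (a b : int) :
  radd (fixpt p) (a%:~R / 2 ^+ p./2) (b%:~R / 2 ^+ p./2) =
  (clip p (a + b))%:~R / 2 ^+ p./2 :> R.
Proof.
rewrite /radd /fixpt /clip -mulrDl -intrD divfK ?floor_int_half //.
exact: pow2_neq0.
Qed.

(** Here the index list itself depends on the input. Terms are folded in the order of the big
    operator, as saturating addition is not associative. *)
Lemma recr_big_window (R : realType) (V : finType) (p : fn nat) (C : fn (seq V))
    (F : V -> fn R) : (0 < #|V|)%N -> rec p -> recw C -> (forall v, recr p (F v)) ->
  recr p (fun x e => \big[radd (fixpt (p x e))/0]_(v <- C x e) F v x e).
Proof.
move=> V0 pP CP FP.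
have /choice[k kP] : forall v, exists k, recz k /\
    forall x e, F v x e = (k x e)%:~R / 2 ^+ (p x e)./2.
  by move=> v; have [k kP kE] := FP v; exists k.
exists (fun x e => foldr (fun v a => clip (p x e) (k v x e + a)) 0 (C x e)).
  apply: (@recz_foldr _ V0 C (fun v x a e => clip (p x e) (k v x e + a))) => // v.
  apply: recz_clip; first exact: (rec_ren (fun i => i.+2) pP).
  apply: recz_add; last exact/recz_zdecode/rec_var.
  exact: (recz_ren (fun i => i.+2) (kP v).1).
move=> x e; elim: (C x e) => [|v D IH] /=; first by rewrite big_nil mul0r.
by rewrite big_cons IH (kP v).2 radd_clip.
Qed.

Section Generation.
Variables (R : realType) (T : swt R).
Hypotheses (TP : finite_params T) (V_gt0 : (0 < #|vocab T|)%N).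

Section Step.
Variables (C : fn (seq (vocab T))) (p : fn nat).
Hypotheses (CP : recw C) (pP : rec p).
Notation rd x e := (fixpt (p x e) : R -> R).

Lemma evdyadic_h0 (v : vocab T) j : evdyadic (fun q => h0 (fixpt q : R -> R) v j 0).
Proof. by apply: evdyadic_load; case: TP. Qed.

Lemma recv_h0 (v : vocab T) : recv p (fun x e => h0 (rd x e) v).
Proof. by apply: recv_load => //; case: TP. Qed.

Lemma recr_att_exp (vi v : vocab T) : recr p (fun x e => att_exp (rd x e) vi v).
Proof.
have [_ [QP KP _ _]] := TP.
apply: (recr_exp (f := fun q => rdot (fixpt q) (rmulmx (fixpt q) (load (fixpt q) (WQ T))
  (h0 (fixpt q) vi)) (rmulmx (fixpt q) (load (fixpt q) (WK T)) (h0 (fixpt q) v)))) => //.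
by apply: evdyadic_rdot => j; apply: evdyadic_rmulmx => // i; exact: evdyadic_h0.
Qed.

Lemma recr_logit (vi v : vocab T) : recr p (fun x e => logit (rd x e) (C x e) vi v).
Proof.
have [_ [_ _ WP NP]] := TP.
apply: recr_rdot => //; first exact: recv_h0.
have hP : recv p (fun x e => h_half (rd x e) (C x e) vi).
  apply: recv_raddv => //; first exact: recv_h0.
  move=> i; apply: recr_ext; first by move=> x e; rewrite mxE; reflexivity.
  apply: (recr_big_window (F := fun v x e => rmul (rd x e) (att_weight (rd x e) (C x e) vi v)
     (rmulmx (rd x e) (load (rd x e) (WV T)) (h0 (rd x e) v) i 0))) => // w.
  apply: recr_rmul => //; last exact: recv_rmulmx (recv_h0 w) i.
  apply: recr_rdiv => //; first exact: recr_att_exp.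
  by apply: recr_big_window => // u; exact: recr_att_exp.
by apply: recv_raddv => //; exact: recv_net_eval.
Qed.

Lemma next_tokenE (r : R -> R) D v : (next_token (T := T) r D == Some v) =
  [exists vi, (olast D == Some vi) &&
     [forall u, (u == v) || (logit r D vi u < logit r D vi v)]].
Proof.
case: D => [|v0 D].
  by symmetry; apply/existsP => -[vi].
set vi := last v0 D; rewrite /next_token -/vi.
have -> : [exists vi', (olast (v0 :: D) == Some vi') &&
     [forall u, (u == v) || (logit r (v0 :: D) vi' u < logit r (v0 :: D) vi' v)]] =
   [forall u, (u != v) ==> (logit r (v0 :: D) vi u < logit r (v0 :: D) vi v)].
  apply/existsP/forallP => [[vi' /andP[/eqP[<-] /forallP h]] u|h].
    by rewrite implyNb.
  by exists vi; rewrite eqxx; apply/forallP => u; rewrite -implyNb.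
case: pickP => [w wP|/(_ v) -> //]; apply/eqP/idP => [[<-] //|vP].
congr Some; apply/eqP; apply/negPn/negP => wv.
have := forallP vP w; have := forallP wP v; rewrite wv eq_sym wv /=.
by move=> h1 /(lt_trans h1); rewrite ltxx.
Qed.

Lemma reco_next_token : reco (fun x e => next_token (T := T) (rd x e) (C x e)).
Proof.
move=> v; apply: rec_ext (recb_exists (P := fun vi x e => (olast (C x e) == Some vi) &&
   [forall u, (u == v) || (logit (rd x e) (C x e) vi u < logit (rd x e) (C x e) vi v)]) _).
  by move=> x e; rewrite next_tokenE.
move=> vi; apply: recb_and; first exact: reco_olast.
apply: recb_forall => u; apply: recb_or; first exact: recb_const.
by apply: recb_ltr; exact: recr_logit.
Qed.

Lemma recw_slide w : recw (fun x e => slide (C x e) w).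
Proof.
by rewrite /slide; case: (grow w); apply: recw_rcons => //; exact: recw_behead.
Qed.

End Step.

Variables (E : prompter (vocab T)) (c : nat).

Definition ocode (o : option (seq (vocab T))) : nat :=
  if o is Some C then (wcode C).+1 else 0%N.

Definition step_code (a : nat) : nat :=
  if a is w.+1 then
    let C := wdecode V_gt0 w in
    if next_token (fixpt (log_bits c (size C)) : R -> R) C is Some v
    then (wcode (slide C v)).+1 else 0%N
  else 0%N.

Lemma rec_step_code f : rec f -> rec (fun x e => step_code (f x e)).
Proof.
move=> fP; have CP := recw_decode V_gt0 (rec_pred fP).
have pP := rec_log_bits c (rec_size V_gt0 CP).
have nP := rec_case (reco_next_token CP pP) (fun v => rec_succ (recw_slide CP v)).
apply: rec_ext (rec_if (recb_eq0 fP) (rec_const 0) nP) => x e.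
by rewrite /step_code; case: (f x e).
Qed.

Lemma rec_run f : rec f ->
  rec (fun x e => ocode (swt_run (T := T) (log_bits c) (prompt E x) (f x e))).
Proof.
move=> fP; have := rec_iteri (t := fun _ _ a _ => step_code a) fP
  (rec_succ (recw_prompt V_gt0 E)) (rec_step_code (rec_var 1)).
apply: rec_ext => x e; elim: (f x e) => //= n ->.
rewrite /swt_run /=; case: (iter n _ _) => //= C.
rewrite wcodeK /swt_step; by case: next_token.
Qed.

Lemma reco_token f : rec f -> reco (fun x e =>
  obind (@olast _) (swt_run (T := T) (log_bits c) (prompt E x) (f x e))).
Proof.
move=> fP v; have rP := rec_run fP.
apply: rec_ext (recb_and (recb_not (recb_eq0 rP))
  (reco_olast V_gt0 (recw_decode V_gt0 (rec_pred rP)) v)) => x e.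
by case: swt_run => //= C; rewrite wcodeK.
Qed.

Lemma recb_answer (ans : vocab T -> option bool) f b : rec f -> recb (fun x e =>
  obind ans (obind (@olast _) (swt_run (T := T) (log_bits c) (prompt E x) (f x e)))
    == Some b).
Proof.
move=> fP; apply: rec_ext (recb_has (index_enum (vocab T)) (P := fun v x e =>
  (ans v == Some b) && (obind (@olast _) (swt_run (T := T) (log_bits c)
     (prompt E x) (f x e)) == Some v)) _).
  move=> x e; congr nat_of_bool.
  case: (obind (@olast _) _) => [v|] /=; last by apply/hasP => -[v _ /andP[]].
  apply/hasP/idP => [[w _ /andP[wb /eqP[->]]] //|vb].
  by exists v; rewrite ?mem_index_enum // vb eqxx.
by move=> v; apply: recb_and; [exact: recb_const|exact: reco_token].
Qed.

End Generation.

Theorem swt_computable_tm (R : realType) (f : problem) :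
  swt_computable R f -> tm_computable f.
Proof.
move=> [T [E [ans [c [TP fE]]]]].
pose a x i := obind ans (obind (@olast _) (swt_run (T := T) (log_bits c) (prompt E x) i.+1)).
have aP b : recb (fun x e => a x (e 0%N) == Some b).
  (* The coding of windows needs a nonempty vocabulary; an empty one generates nothing, hence never
     answers. *)
  have [V0|V0] := posnP #|vocab T|.
    apply: rec_ext (rec_const 0) => x e; rewrite /a.
    case: (obind (@olast _) _) => [v|//].
    by have := fintype0 v V0.
  exact: recb_answer (rec_succ (rec_var 0)).
have [M MP] := rec_search_tm (recb_not (recb_or (aP true) (aP false))) (aP true).
exists M => x b; rewrite MP -fE /swt_answer -/(a x _).
have aE i : (nat_of_bool (~~ ((a x i == Some true) || (a x i == Some false))) == 0%N) = (a x i != None).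
  by case: (a x i) => [[]|].
split=> [[i [/eqP]]|[i ai aj]].
  rewrite aE => ai aj ->; exists i; rewrite -/(a x i).
    by case: (a x i) ai => [[]|].
  by move=> j /aj; rewrite aE -/(a x j) negbK => /eqP.
exists i; move: ai; rewrite -/(a x i) => ai; split.
- by apply/eqP; rewrite aE ai.
- by move=> j /aj; rewrite -/(a x j) aE => ->.
- by rewrite ai; case: (b).
Qed.

(** * Inference without rounding errors *)

Section Exact.
Variables (R : realType) (h : nat).
Hypothesis h_gt1 : (1 < h)%N.
Notation rd := (fixpt h.*2 : R -> R).
Notation L := (2 ^+ h.-1 : R).

(** With [h] fractional bits out of [2 * h], grid numbers below [L] are represented exactly. The
    grid is not closed under products, only under integer multiples, which is why all the weights
    are integers. *)
Definition grid (x : R) := exists k : int, x = k%:~R / 2 ^+ h.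

Lemma grid_int (k : int) : grid k%:~R.
Proof.
by exists (k * 2 ^+ h); rewrite intrM rmorphXn /= mulfK // pow2_neq0.
Qed.

Lemma gridD x y : grid x -> grid y -> grid (x + y).
Proof. by move=> [k ->] [l ->]; exists (k + l); rewrite intrD mulrDl. Qed.

Lemma grid_intM (k : int) x : grid x -> grid (k%:~R * x).
Proof. by move=> [l ->]; exists (k * l); rewrite intrM mulrA. Qed.

Lemma grid_sum (I : Type) (r : seq I) (f : I -> R) :
  (forall i, grid (f i)) -> grid (\sum_(i <- r) f i).
Proof.
move=> fP; elim: r => [|i r IH]; first by rewrite big_nil; exact: (grid_int 0).
by rewrite big_cons; exact: gridD.
Qed.

Lemma grid_max0 x : grid x -> grid (Num.max 0 x).
Proof. by move=> xP; case: (leP 0 x) => // _; exact: (grid_int 0). Qed.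

Lemma rd_grid x : grid x -> `|x| < L -> rd x = x.
Proof.
move=> [k ->]; have p0 : 0 < 2 ^+ h :> R by exact: pow2_gt0.
rewrite normrM normfV (gtr0_norm p0) ltr_pdivrMr // -exprD => kL.
rewrite -[h in _ / 2 ^+ h]doubleK; apply: fixpt_exact.
rewrite -(ltr_int R) intr_norm rmorphXn /=; apply: lt_le_trans kL _.
by rewrite ler_weXn2l ?ler1n //; lia.
Qed.

(** Bounding the sum of absolute values controls every partial sum at once, so no intermediate
    result saturates. *)
Lemma big_radd (I : Type) (r : seq I) (f : I -> R) : (forall i, grid (f i)) ->
  \sum_(i <- r) `|f i| < L -> \big[radd rd/0]_(i <- r) f i = \sum_(i <- r) f i.
Proof.
move=> fP; elim: r => [|i r IH]; first by rewrite !big_nil.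
rewrite !big_cons => sL; have sL' : \sum_(j <- r) `|f j| < L.
  by apply: le_lt_trans sL; rewrite lerDr.
rewrite IH // /radd rd_grid //; first by apply: gridD => //; exact: grid_sum.
apply: le_lt_trans sL; apply: le_trans (ler_normD _ _) _.
by rewrite lerD2l ler_norm_sum.
Qed.

Definition int_entries (a : nat) m n (A : 'M[R]_(m, n)) :=
  forall i j, exists2 k : int, A i j = k%:~R & `|k| <= a%:Z.

Definition grid_entries (b : nat) n (u : 'cV[R]_n) :=
  forall i, grid (u i 0) /\ `|u i 0| <= b%:R.

Lemma int_grid_entries a n (u : 'cV[R]_n) : int_entries a u -> grid_entries a u.
Proof.
move=> uP i; have [k -> ka] := uP i 0; split; first exact: grid_int.
by rewrite -intr_norm -[a%:R]/((Posz a)%:~R) ler_int.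
Qed.

Lemma load_int a m n (A : 'M[R]_(m, n)) : int_entries a A -> a%:R < L ->
  load rd A = A.
Proof.
move=> AP aL; apply/matrixP => i j; rewrite mxE; have [k -> ka] := AP i j.
apply: rd_grid; first exact: grid_int.
by apply: le_lt_trans aL; rewrite -intr_norm -[a%:R]/((Posz a)%:~R) ler_int.
Qed.

Lemma dot_bound a b n (x y : 'I_n -> R) :
  (forall i, exists2 k : int, x i = k%:~R & `|k| <= a%:Z) ->
  (forall i, grid (y i) /\ `|y i| <= b%:R) -> (n * a * b)%:R < L ->
  \big[radd rd/0]_(i < n) rmul rd (x i) (y i) = \sum_i x i * y i /\
  `|\sum_i x i * y i| <= (n * a * b)%:R.
Proof.
move=> xP yP nL.
have xyg i : grid (x i * y i).
  by have [k -> _] := xP i; apply: grid_intM; case: (yP i).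
have xyb i : `|x i * y i| <= (a * b)%:R.
  rewrite normrM natrM; apply: ler_pM => //; last by case: (yP i).
  have [k -> ka] := xP i.
  by rewrite -intr_norm -[a%:R]/((Posz a)%:~R) ler_int.
have sb : \sum_i `|x i * y i| <= (n * a * b)%:R.
  apply: le_trans (ler_sum _ (fun i _ => xyb i)) _.
  by rewrite sumr_const card_ord -mulnA -[leLHS]mulr_natl -natrM.
split; last exact: le_trans (ler_norm_sum _ _ _) sb.
rewrite -big_radd //; last exact: le_lt_trans sb nL.
apply: eq_bigr => i _; apply: rd_grid => //.
apply: le_lt_trans (xyb i) _; apply: le_lt_trans nL; rewrite ler_nat -mulnA.
by apply: leq_pmull; case: n i {x y xP yP xyg xyb sb} => // -[].
Qed.

Lemma rdot_exact a b n (u v : 'cV[R]_n) : int_entries a u -> grid_entries b v ->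
  (n * a * b)%:R < L -> rdot rd u v = \sum_i u i 0 * v i 0.
Proof. by move=> uP vP nL; case: (dot_bound (fun i => uP i 0) vP nL). Qed.

Lemma rmulmx_exact a b m n (A : 'M[R]_(m, n)) (u : 'cV[R]_n) :
  int_entries a A -> grid_entries b u -> a%:R < L -> (n * a * b)%:R < L ->
  rmulmx rd (load rd A) u = A *m u /\ grid_entries (n * a * b) (A *m u).
Proof.
move=> AP uP aL nL; rewrite (load_int AP aL); split.
  by apply/matrixP => i j; rewrite !mxE (ord1 j); case: (dot_bound (AP i) uP nL).
move=> i; rewrite mxE; split; last by case: (dot_bound (AP i) uP nL).
apply: grid_sum => j; have [k -> _] := AP i j.
by apply: grid_intM; case: (uP j).
Qed.

Lemma raddv_exact a b n (u v : 'cV[R]_n) : grid_entries a u -> grid_entries b v ->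
  (a + b)%:R < L -> raddv rd u v = u + v /\ grid_entries (a + b) (u + v).
Proof.
move=> uP vP abL.
have g i : grid ((u + v) i 0) /\ `|(u + v) i 0| <= (a + b)%:R.
  have [u1 u2] := uP i; have [v1 v2] := vP i; rewrite mxE; split; first exact: gridD.
  by apply: le_trans (ler_normD _ _) _; rewrite natrD lerD.
split=> //; apply/matrixP => i j; have [] := g i; rewrite !mxE (ord1 j) => g1 g2.
by apply: rd_grid => //; exact: le_lt_trans g2 abL.
Qed.

Lemma relu_grid a n (u : 'cV[R]_n) : grid_entries a u -> grid_entries a (relu u).
Proof.
move=> uP i; have [g b] := uP i; rewrite mxE; split; first exact: grid_max0.
by case: (leP 0 (u i 0)) => // _; rewrite normr0 ler0n.
Qed.

(** As [m < L], the number [2 ^ h / m] is at least [2], so its rounding is not null. How close [r]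
    is to [1 / m] does not matter: positivity and [m * r <= 2] are what the network relies on. *)
Lemma weight_exact m : (0 < m)%N -> m%:R < L -> exists r,
  [/\ rd (1 / m%:R) = r, grid r, 0 < r <= 1 & m%:R * r <= 2].
Proof.
move=> m0 mL; have m0' : 0 < m%:R :> R by rewrite ltr0n.
have m1 : 1 <= m%:R :> R by rewrite ler1n.
set k := Num.floor (2 ^+ h / m%:R + 2^-1 : R).
have p0 : 0 < 2 ^+ h :> R by exact: pow2_gt0.
have pE : 2 ^+ h = 2 * L by rewrite -exprS prednK // ltnW.
have w1 : 2 ^+ h / m%:R <= 2 ^+ h :> R by rewrite ler_pdivrMr // ler_peMr // ltW.
have w2 : 2 <= 2 ^+ h / m%:R :> R by rewrite ler_pdivlMr // pE ler_pM2l // ltW.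
have /andP[k1 k2] := floor_itv (2 ^+ h / m%:R + 2^-1 : R); rewrite -/k in k1 k2.
have kh : k <= 2 ^+ h.
  rewrite -ltzD1 -(ltr_int R) intrD rmorphXn /= mulr1z.
  apply: le_lt_trans k1 _; rewrite -[2%:~R]/(2 : R).
  by move: w1; set y := _ / _; set z := 2 ^+ h; lra.
have k_gt0 : 0 < k.
  rewrite floor_gt0; move: w2; set y := _ / _; lra.
exists (k%:~R / 2 ^+ h); split.
- have kE : clip h.*2 k = k.
    rewrite /clip; have : 2 ^+ h < 2 ^+ h.*2.-1 :> int.
      by rewrite ltr_eXn2l //; lia.
    by move=> kp; rewrite max_r ?min_l //; lia.
  by rewrite /fixpt doubleK mul1r [_^-1 * _]mulrC -/k -[in RHS]kE.
- by exists k.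
- rewrite divr_gt0 ?ltr0z //= ler_pdivrMr // mul1r.
  by move: kh; rewrite -(ler_int R) rmorphXn.
- rewrite mulrA ler_pdivrMr //; move: k1; rewrite -(ler_pM2l m0') mulrDr => k1.
  apply: le_trans k1 _.
  have -> : m%:R * (2 ^+ h / m%:R) = 2 ^+ h :> R by field; rewrite gt_eqF.
  by move: mL pE m0'; set l := 2 ^+ h.-1; set q := 2 ^+ h; lra.
Qed.

End Exact.
(** * A transformer reading parities off its window *)

Section Finite.
Variables (R : realType) (I J : finType).

Definition mx_of (f : I -> J -> int) : 'M[R]_(#|I|, #|J|) :=
  \matrix_(i, j) (f (enum_val i) (enum_val j))%:~R.
Definition col_of (f : I -> R) : 'cV[R]_#|I| := \col_i f (enum_val i).

Lemma dyadic_mx_of f : dyadic_mx (mx_of f).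
Proof. by move=> i j; rewrite mxE; exact: dyadic_int. Qed.

Lemma dyadic_col_of (f : I -> int) : dyadic_mx (col_of (fun i => (f i)%:~R)).
Proof. by move=> i j; rewrite mxE; exact: dyadic_int. Qed.

Lemma int_mx_of a f : (forall i j, `|f i j| <= a%:Z) -> int_entries a (mx_of f).
Proof. by move=> fa i j; rewrite mxE; eexists; [reflexivity|]. Qed.

Lemma int_col_of a (f : I -> int) : (forall i, `|f i| <= a%:Z) ->
  int_entries a (col_of (fun i => (f i)%:~R)).
Proof. by move=> fa i j; rewrite mxE; eexists; [reflexivity|]. Qed.

Lemma sum_enum_val (f : I -> R) : \sum_(i < #|I|) f (enum_val i) = \sum_i f i.
Proof. by rewrite [RHS](big_enum_val (A := I)). Qed.

End Finite.

Lemma mulmx_of (R : realType) (I J : finType) (f : I -> J -> int) (g : J -> R) :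
  mx_of R f *m col_of g = col_of (fun i => \sum_j (f i j)%:~R * g j).
Proof.
apply/matrixP => i j; rewrite !mxE -[RHS]sum_enum_val.
by apply: eq_bigr => k _; rewrite !mxE.
Qed.

Lemma add_col_of (R : realType) (I : finType) (f g : I -> R) :
  col_of f + col_of g = col_of (fun i => f i + g i).
Proof. by apply/matrixP => i j; rewrite !mxE. Qed.

Lemma eq_col_of (R : realType) (I : finType) (f g : I -> R) :
  f =1 g -> col_of f = col_of g.
Proof. by move=> fg; apply/matrixP => i j; rewrite !mxE. Qed.

Lemma relu_col_of (R : realType) (I : finType) (f : I -> R) :
  relu (col_of f) = col_of (fun i => Num.max 0 (f i)).
Proof. by apply/matrixP => i j; rewrite !mxE. Qed.

Section Net.
Variables (R : realType) (V S : finType) (grows : V -> bool).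
Variables (val : V -> option S -> int) (flip : V -> S -> bool) (probe : pred V).
Variable next : V -> {ffun S -> bool} -> V.
Hypothesis val_le1 : forall v o, `|val v o| <= 1.

(** The first block holds the last token as an indicator vector, kept by the residual connection;
    attention writes only to the second one, where [None] counts fences minus symbols and [Some s]
    the signs of [s]. *)
Definition coord : finType := (V + option S)%type.
(** The neurons [inl v] copy the indicator of the last token; there is one gate [inr (v, P)] for
    each last token and each possible parity vector, a constant number for a given machine. *)
Definition neuron : finType := (V + V * {ffun S -> bool})%type.

(** Attention coordinates are at most [2] in absolute value, and the parity weights add up to at
    most [2 * #|S| + 1]. A bias of this size thus closes every gate of a token other than the last
    one, and is compensated at the last one. *)
Definition big_weight : nat := (4 * #|S| + 4)%N.

Definition emb_entry (v : V) (i : coord) : int :=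
  if i is inl w then (w == v)%:Z else 0.

Definition value_entry (i j : coord) : int :=
  match i, j with inr o, inl w => val w o | _, _ => 0 end.

(** Once the signs are corrected, coordinate [s] is [r] times the true parity, [0] or [1]. Counting
    it positively where [P s] holds and negatively elsewhere, then subtracting the number of [s]
    with [P s], gives minus the number of mismatches. *)
Definition parity_entry (v : V) (P : {ffun S -> bool}) (o : option S) : int :=
  if o is Some s then (-1) ^+ flip v s * (if P s then 1 else -1)
  else 1 - #|[pred s | P s]|%:Z.

Definition hidden_entry (k : neuron) (i : coord) : int :=
  match k, i with
  | inl v, inl w => (w == v)%:Z
  | inl _, inr _ => 0
  | inr (v, _), inl w => if w == v then big_weight%:Z else 0
  | inr (v, P), inr o => parity_entry v P o
  end.

Definition hidden_bias (k : neuron) : int :=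
  if k is inr _ then - big_weight%:Z else 0.

(* The term [- (w == v)] cancels the residual connection. *)
Definition output_entry (i : coord) (k : neuron) : int :=
  match i, k with
  | inl w, inl v => (~~ probe v && (next v [ffun=> false] == w))%:Z - (w == v)%:Z
  | inl w, inr (v, P) => (probe v && (next v P == w))%:Z
  | inr _, _ => 0
  end.

Definition parity_swt : swt R :=
  @Swt R V grows #|coord| (fun v => col_of (fun i => (emb_entry v i)%:~R)) 0 0
    (mx_of R value_entry)
    (Hidden (mx_of R hidden_entry) (col_of (fun k => (hidden_bias k)%:~R))
      (Affine (mx_of R output_entry) (col_of (fun i => (0 : int)%:~R)))).

Lemma parity_swt_finite : finite_params parity_swt.
Proof.
have d0 : dyadic_mx (0 : 'M[R]_#|coord|).
  by move=> i j; rewrite mxE; exact: (dyadic_int R 0).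
split=> [v|]; first exact: dyadic_col_of.
split=> //=; first exact: dyadic_mx_of.
by split; [exact: dyadic_mx_of|exact: dyadic_col_of|split;
  [exact: dyadic_mx_of|exact: dyadic_col_of]].
Qed.

(** Successive magnitudes, from the inside: a half-layer entry is at most [3] (embedding [1],
    attention [2]), then come the hidden layer, the output layer with its residual connection, and
    the final scalar product. *)
Definition net_bound : nat :=
  (#|coord|.+1 * (#|neuron|.+1 * (#|coord| * big_weight * 3 + big_weight) + 4))%N.

Lemma parity_entry_le v P o : `|parity_entry v P o| <= (#|S| + 1)%N%:Z.
Proof.
case: o => [s|]; rewrite /parity_entry; last first.
  have := max_card [pred s | P s]; move: #|[pred s | P s]| #|S| => m n; lia.
rewrite normrM normrX normrN1 expr1n mul1r.
by case: (P s); rewrite ?normrN normr1; lia.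
Qed.

Lemma hidden_entry_le k i : `|hidden_entry k i| <= big_weight%:Z.
Proof.
case: k i => [v|[v P]] [w|o] /=.
- by case: eqP => _; rewrite ?normr0 ?normr1 // /big_weight; lia.
- by rewrite normr0.
- by case: eqP => _; rewrite ?normr0 ?ger0_norm // lexx.
- by apply: le_trans (parity_entry_le v P o) _; rewrite /big_weight; lia.
Qed.

(** * Exact evaluation of the network *)

Section Inference.
Variable h : nat.
Hypothesis net_lt : (net_bound < 2 ^ h.-1)%N.
Notation rd := (fixpt h.*2 : R -> R).
Notation L := (2 ^+ h.-1 : R).

Let h_gt1 : (1 < h)%N.
Proof.
have : (4 < 2 ^ h.-1)%N.
  by apply: leq_ltn_trans net_lt; rewrite /net_bound; nia.
by case: (h) => [|[|h']].
Qed.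

Let le_net n : (n <= net_bound)%N -> n%:R < L.
Proof. by move=> nN; rewrite -natrX ltr_nat (leq_ltn_trans nN). Qed.

Let D1 : (#|coord| * 1 * 1)%:R < L.
Proof. by apply: le_net; rewrite /net_bound; nia. Qed.

Let L1 : 1%:R < L.
Proof. by apply: le_net; rewrite /net_bound; nia. Qed.

Lemma int_emb v : int_entries 1 (emb (s := parity_swt) v).
Proof.
apply: int_col_of => -[w|o] //=; by case: eqP.
Qed.

Lemma h0_emb v : h0 (T := parity_swt) rd v = emb (s := parity_swt) v.
Proof. by rewrite /h0 (load_int h_gt1 (int_emb v)). Qed.

Lemma att_exp1 u v : att_exp (T := parity_swt) rd u v = 1.
Proof.
have z0 : int_entries 1 (0 : 'M[R]_#|coord|).
  by move=> i j; exists 0; rewrite ?mxE ?normr0.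
have zv : int_entries 1 (0 : 'cV[R]_#|coord|).
  by move=> i j; exists 0; rewrite ?mxE ?normr0.
have m0 w : rmulmx rd (load rd (0 : 'M[R]_#|coord|)) (h0 (T := parity_swt) rd w) = 0.
  have g := int_grid_entries h (int_emb w).
  by rewrite h0_emb (rmulmx_exact h_gt1 z0 g L1 D1).1 mul0mx.
rewrite /att_exp /= !m0 (rdot_exact h_gt1 zv (int_grid_entries h zv) D1).
rewrite big1 => [|i _]; last by rewrite !mxE mul0r.
by rewrite expR0 rd_grid //; [exact: (grid_int R h 1)|rewrite normr1].
Qed.

Variables (C : seq V) (vi : V).
Hypotheses (C_gt0 : (0 < size C)%N) (C_lt : (size C < 2 ^ h.-1)%N).

Definition window_sum (o : option S) : int := \sum_(w <- C) val w o.

Definition half_entry (r : R) (i : coord) : R :=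
  match i with inl w => (w == vi)%:R | inr o => r * (window_sum o)%:~R end.

Definition token_value (i : coord) (w : V) : int :=
  if i is inr o then val w o else 0.

Lemma token_value_le i w : `|token_value i w| <= 1.
Proof. by case: i => [v|o] //=; rewrite normr0. Qed.

Lemma value_exact w : rmulmx rd (load rd (mx_of R value_entry))
    (h0 (T := parity_swt) rd w) = col_of (fun i => (token_value i w)%:~R).
Proof.
have vP : int_entries 1 (mx_of R value_entry).
  apply: int_mx_of => -[v|o] [u|o'] //=; by rewrite normr0.
have g := int_grid_entries h (int_emb w).
rewrite h0_emb (rmulmx_exact h_gt1 vP g L1 D1).1 /= mulmx_of; apply: eq_col_of => i.
rewrite (bigD1 (inl w : coord)) //= eqxx mulr1 big1 ?addr0 => [|[u|o] uw].
- by case: i.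
- by rewrite /= (_ : (u == w) = false) ?mulr0 //; apply: contraNF uw => /eqP ->.
- by rewrite /= mulr0.
Qed.

Lemma h_half_exact : exists r, [/\ 0 < r <= 1, grid h r, (size C)%:R * r <= 2
  & h_half (T := parity_swt) rd C vi = col_of (half_entry r)] /\
    grid_entries h 3 (col_of (half_entry r)).
Proof.
have sC : (size C)%:R < L by rewrite -natrX ltr_nat.
have [r [rE rg r01 rm]] := weight_exact h_gt1 C_gt0 sC; exists r.
have [r0 r1] : 0 < r /\ r <= 1 by apply/andP.
have sum1 : \sum_(w <- C) (1 : R) = (size C)%:R by rewrite -sum1_size natr_sum.
have wE w : att_weight (T := parity_swt) rd C vi w = r.
  rewrite /att_weight att_exp1 -rE; congr (rd (_ / _)).
  under eq_bigr do rewrite att_exp1.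
  rewrite big_radd // => [_|]; first exact: (grid_int R h 1).
  by under eq_bigr do rewrite normr1; rewrite sum1.
have L2 : 2 < L by apply: (le_net (n := 2)); rewrite /net_bound; nia.
have tg i w : grid h (r * (token_value i w)%:~R).
  by rewrite mulrC; exact: grid_intM.
have tb i w : `|r * (token_value i w)%:~R| <= r.
  rewrite normrM (gtr0_norm r0) ler_piMr ?(ltW r0) //.
  by rewrite -intr_norm -[1]/(1%:~R) ler_int token_value_le.
have sb i : \sum_(w <- C) `|r * (token_value i w)%:~R| <= 2.
  apply: le_trans (ler_sum _ (fun w _ => tb i w)) _.
  by rewrite -[X in \sum_(_ <- _) X]mul1r -mulr_suml sum1.
set u := \col_d \big[radd rd/0]_(v <- C) rmul rd (att_weight (T := parity_swt) rd C vi v)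
  (rmulmx rd (load rd (mx_of R value_entry)) (h0 (T := parity_swt) rd v) d 0).
have uE : u = col_of (fun i => r * (\sum_(w <- C) token_value i w)%:~R).
  apply/matrixP => d j; rewrite !mxE rmorph_sum mulr_sumr /= -(big_radd h_gt1).
  - apply: eq_bigr => w _; rewrite wE value_exact mxE; apply: rd_grid => //.
    by apply: le_lt_trans (tb _ _) _; apply: le_lt_trans r1 L1.
  - by move=> w; exact: tg.
  - exact: le_lt_trans (sb _) L2.
have ug : grid_entries h 2 u.
  rewrite uE => i; rewrite mxE rmorph_sum mulr_sumr /=.
  split; first by apply: grid_sum => w; exact: tg.
  exact: le_trans (ler_norm_sum _ _ _) (sb _).
have L3 : (1 + 2)%:R < L by apply: le_net; rewrite /net_bound; nia.
have [hE hg] := raddv_exact h_gt1 (int_grid_entries h (int_emb vi)) ug L3.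
have hc : emb (s := parity_swt) vi + u = col_of (half_entry r).
  rewrite uE /= add_col_of; apply: eq_col_of => -[w|o] /=.
    by rewrite big1_eq mulr0 addr0.
  by rewrite add0r.
rewrite -hc; do !split=> //; rewrite /h_half h0_emb; exact: hE.
Qed.

Definition gate (r : R) (k : neuron) : R :=
  match k with
  | inl v => (v == vi)%:R
  | inr (v, P) => if v == vi
      then Num.max 0 (r * (\sum_o parity_entry vi P o * window_sum o)%:~R) else 0
  end.

Lemma hidden_sum r k : 0 < r -> (size C)%:R * r <= 2 ->
  Num.max 0 (\sum_i (hidden_entry k i)%:~R * half_entry r i + (hidden_bias k)%:~R)
    = gate r k.
Proof.
move=> r0 rm; rewrite big_sumType /=.
have inlE (f : V -> int) : \sum_w (f w)%:~R * (w == vi)%:R = (f vi)%:~R :> R.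
  rewrite (bigD1 vi) //= eqxx mulr1 big1 ?addr0 // => w /negPf ->.
  by rewrite mulr0.
rewrite inlE; case: k => [v|[v P]] /=.
  rewrite big1 => [|o _]; last by rewrite mul0r.
  by rewrite !addr0 [v == vi]eq_sym max_r // ler0n.
have sE : \sum_o (parity_entry v P o)%:~R * (r * (window_sum o)%:~R) =
    r * (\sum_o parity_entry v P o * window_sum o)%:~R.
  rewrite rmorph_sum mulr_sumr; apply: eq_bigr => o _.
  by rewrite rmorphM /= mulrCA.
rewrite sE [v == vi]eq_sym; case: eqVneq => [->|_].
  by rewrite addrAC -intrD subrr add0r.
(* The last token is not [v], so the bias has to outweigh all the parity terms. *)
rewrite add0r; apply: max_l; rewrite intrN subr_le0.
have ws o : `|r * (window_sum o)%:~R| <= 2.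
  apply: le_trans rm; rewrite normrM (gtr0_norm r0) mulrC ler_pM2r //.
  rewrite -intr_norm -[(size C)%:R]/((Posz (size C))%:~R) ler_int.
  apply: le_trans (ler_norm_sum _ _ _) _.
  apply: le_trans (ler_sum _ (fun w _ => val_le1 w o)) _.
  by rewrite -sum1_size -[X in _ <= X]natz natr_sum.
rewrite -sE; apply: le_trans (ler_norm _) _; apply: le_trans (ler_norm_sum _ _ _) _.
have pb o : `|(parity_entry v P o)%:~R * (r * (window_sum o)%:~R)| <=
    2 * (if o is Some _ then 1 else (#|S| + 1)%:R).
  rewrite normrM mulrC; apply: ler_pM => //.
  rewrite -intr_norm; case: o => [s|] /=; last first.
    by rewrite -[(#|S| + 1)%:R]/((Posz (#|S| + 1))%:~R) ler_int;
       exact: (parity_entry_le v P None).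
  by rewrite normrM normrX normrN1 expr1n mul1r; case: (P s); rewrite ?normrN normr1.
apply: le_trans (ler_sum _ (fun o _ => pb o)) _.
rewrite -mulr_sumr (bigD1 None) //=.
have -> : \sum_(o : option S | o != None) (if o is Some _ then 1 else (#|S| + 1)%:R) = #|S|%:R :> R.
  rewrite (eq_bigr (fun=> 1)); last by case.
  rewrite sumr_const; congr (_ *+ _).
  by rewrite -[RHS]/(#|S|.+1.-1) -card_option -(cardC1 (None : option S)); apply: eq_card.
rewrite -[2]/(2%:R) -natrD -natrM -[big_weight%:~R]/(big_weight%:R) ler_nat /big_weight.
by rewrite -addnA addnCA mulnDr addnC leq_add // addnn -mul2n mulnA.
Qed.

(** A token that does not probe has a fixed successor, which gets score [1]; the null vector is then
    a dummy argument of [next]. *)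
Definition score (r : R) (w : V) : R :=
  (~~ probe vi && (next vi [ffun=> false] == w))%:R +
  \sum_P (probe vi && (next vi P == w))%:R * gate r (inr (vi, P)).

Lemma logit_exact : exists r, 0 < r /\
  forall w, logit (T := parity_swt) rd C vi w = score r w.
Proof.
have [r [[/andP[r0 r1] rg rm hE] hg]] := h_half_exact; exists r; split=> // w.
have aP : int_entries big_weight (mx_of R hidden_entry).
  by apply: int_mx_of; exact: hidden_entry_le.
have bP : int_entries big_weight (col_of (fun k => (hidden_bias k)%:~R : R)).
  apply: int_col_of => -[v|k] /=; first by rewrite normr0.
  by rewrite normrN.
have oP : int_entries 1 (mx_of R output_entry).
  apply: int_mx_of => -[u|o] [v|[v P]] /=; rewrite ?normr0 //; last by case: (_ && _).
  by case: (~~ _ && _); case: (u == v).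
have zP : int_entries 0 (col_of (fun i : coord => (0 : int)%:~R : R)).
  by apply: int_col_of => i; rewrite normr0.
have Bw : big_weight%:R < L by apply: le_net; rewrite /net_bound; nia.
have B1 : (#|coord| * big_weight * 3)%:R < L.
  by apply: le_net; rewrite /net_bound; nia.
have [e1 g1] := rmulmx_exact h_gt1 aP hg Bw B1.
have B2 : (#|coord| * big_weight * 3 + big_weight)%:R < L.
  by apply: le_net; rewrite /net_bound; nia.
have [e2 g2] := raddv_exact h_gt1 g1 (int_grid_entries h bP) B2.
have g3 := relu_grid g2.
set Z := (#|coord| * big_weight * 3 + big_weight)%N in B2 g2 g3.
have B4 : (#|neuron| * 1 * Z)%:R < L.
  by apply: le_net; rewrite /net_bound -/Z; nia.
have [e4 g4] := rmulmx_exact h_gt1 oP g3 L1 B4.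
have B5 : (#|neuron| * 1 * Z + 0)%:R < L.
  by apply: le_net; rewrite /net_bound -/Z; nia.
have [e5 g5] := raddv_exact h_gt1 g4 (int_grid_entries h zP) B5.
have B6 : (#|neuron| * 1 * Z + 0 + 3)%:R < L.
  by apply: le_net; rewrite /net_bound -/Z; nia.
have [e6 g6] := raddv_exact h_gt1 g5 hg B6.
have B7 : (#|coord| * 1 * (#|neuron| * 1 * Z + 0 + 3))%:R < L.
  by apply: le_net; rewrite /net_bound -/Z; nia.
have L0 : 0%:R < L by exact: pow2_gt0.
have netE : net_eval rd (mlp parity_swt) (col_of (half_entry r)) =
    mx_of R output_entry *m relu (mx_of R hidden_entry *m col_of (half_entry r)
       + col_of (fun k => (hidden_bias k)%:~R)) + col_of (fun i => (0 : int)%:~R).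
  by rewrite /= (load_int h_gt1 zP L0) (load_int h_gt1 bP Bw) e1 e2 e4 e5.
have -> : logit (T := parity_swt) rd C vi w =
    \sum_i emb (s := parity_swt) w i 0 * (mx_of R output_entry *m
      relu (mx_of R hidden_entry *m col_of (half_entry r) +
        col_of (fun k => (hidden_bias k)%:~R)) + col_of (fun i => (0 : int)%:~R) +
        col_of (half_entry r)) i 0.
  rewrite /logit h0_emb /h1 hE netE e6.
  exact: (rdot_exact h_gt1 (int_emb w) g6 B7).
rewrite mulmx_of add_col_of relu_col_of mulmx_of !add_col_of /=.
rewrite (eq_bigr (fun i => (emb_entry w (enum_val i))%:~R * (\sum_k
   (output_entry (enum_val i) k)%:~R * gate r k + half_entry r (enum_val i)))); last first.
  move=> i _; rewrite !mxE addr0; congr (_ * (_ + _)); apply: eq_bigr => k _.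
  by rewrite hidden_sum.
rewrite (sum_enum_val (fun i => (emb_entry w i)%:~R * (\sum_k
   (output_entry i k)%:~R * gate r k + half_entry r i))).
rewrite (bigD1 (inl w : coord)) //= eqxx mul1r [X in _ + X]big1 ?addr0; last first.
  move=> [u|o] uw /=; last by rewrite mul0r.
  by rewrite (_ : (u == w) = false) ?mul0r //; apply: contraNF uw => /eqP ->.
rewrite big_sumType /= (bigD1 vi) //= [X in _ + X + _ + _]big1; last first.
  by move=> v /negPf vv; rewrite vv mulr0.
rewrite eqxx mulr1 addr0 rmorphB /= addrAC subrK /score; congr (_ + _).
rewrite [LHS](eq_bigr (fun k => (probe k.1 && (next k.1 k.2 == w))%:R *
  gate r (inr (k.1, k.2)))); last by case.
rewrite -(pair_bigA _ (fun v P => (probe v && (next v P == w))%:R *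
  gate r (inr (v, P)))) /=.
rewrite (bigD1 vi) //= [X in _ + X]big1 ?addr0 //.
by move=> v /negPf vv; apply: big1 => P _; rewrite vv mulr0.
Qed.

Lemma next_token_of_score r (v : V) : 0 < r -> olast C = Some vi ->
  (forall w, logit (T := parity_swt) rd C vi w = score r w) ->
  (forall w, w != v -> score r w < score r v) ->
  next_token (T := parity_swt) rd C = Some v.
Proof.
move=> r0 Cvi sE sP; apply/eqP.
case: C C_gt0 Cvi sE => // v0 D _ [viE] sE; rewrite /next_token viE.
case: pickP => [w|/(_ v)/negbT/forallPn[u]]; last first.
  by rewrite negb_imply !sE => /andP[uv]; rewrite sP.
move=> /forallP/(_ v); case: eqVneq => [->//|vw] /=; rewrite !sE.
by move=> /lt_trans/(_ (sP w _)); rewrite ltxx eq_sym => /(_ vw).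
Qed.

Lemma next_token_plain : olast C = Some vi -> ~~ probe vi ->
  next_token (T := parity_swt) rd C = Some (next vi [ffun=> false]).
Proof.
have [r [r0 sE]] := logit_exact; move=> Cvi /negPf np.
have scE w : score r w = (next vi [ffun=> false] == w)%:R.
  by rewrite /score np /= big1 ?addr0 // => P _; rewrite mul0r.
apply: (next_token_of_score r0 Cvi sE) => w /negPf wv.
by rewrite !scE eqxx eq_sym wv ltr01.
Qed.

(** Only the gate of the true parity vector is open, since a single mismatch already makes the
    argument nonpositive. Its height [r] may be tiny, but all the competing scores are exactly
    [0]. *)
Lemma next_token_probe (P : {ffun S -> bool}) :
  olast C = Some vi -> probe vi -> window_sum None = 1 ->
  (forall s, (-1) ^+ flip vi s * window_sum (Some s) = (P s)%:Z) ->
  next_token (T := parity_swt) rd C = Some (next vi P).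
Proof.
have [r [r0 sE]] := logit_exact; move=> Cvi pv w1 wP.
have sumE Q : \sum_o parity_entry vi Q o * window_sum o =
    1 - #|[pred s | P s != Q s]|%:Z.
  rewrite (bigD1 None) //= w1 mulr1.
  rewrite (reindex_omap Some id) => [|[s|]] //=; last first.
  rewrite (eq_bigl xpredT) => [|s]; last by rewrite eqxx.
  rewrite (eq_bigr (fun s => (P s && Q s)%:Z - (P s && ~~ Q s)%:Z)); last first.
    move=> s _; rewrite mulrAC wP; case: (P s) (Q s) => [] [];
      by rewrite ?mulr1 ?mul1r ?mulN1r ?mul0r ?mulr0.
  rewrite -!sum1_card -!natz !natr_sum -addrA; congr (1 + _).
  rewrite !(big_mkcond (fun s => s \in _)) /= -!sumrN -big_split /=.
  by apply: eq_bigr => s _; rewrite !inE; case: (P s) (Q s) => [] [].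
have gE Q : gate r (inr (vi, Q)) = if Q == P then r else 0.
  rewrite /gate eqxx sumE; case: eqVneq => [->|QP].
    by rewrite eq_card0 ?subr0 ?mulr1 ?max_r ?(ltW r0) // => s; rewrite !inE eqxx.
  apply: max_l; rewrite mulr_ge0_le0 ?(ltW r0) // lerz0 subr_le0.
  have [s sP] : exists s, P s != Q s.
    apply/existsP; apply: contraNT QP => /existsPn PQ; apply/eqP/ffunP => s.
    by have := PQ s; rewrite negbK => /eqP.
  by rewrite lez_nat; apply/card_gt0P; exists s.
have scE w : score r w = (next vi P == w)%:R * r.
  rewrite /score pv (_ : (~~ true && _)%:R = 0) // add0r.
  under eq_bigr do rewrite gE.
  by rewrite (bigD1 P) //= eqxx big1 ?addr0 // => Q /negPf ->; rewrite mulr0.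
apply: (next_token_of_score r0 Cvi sE) => w /negPf wv.
by rewrite !scE eqxx eq_sym wv mul0r mul1r; exact: r0.
Qed.

End Inference.
End Net.

(** * Simulating parity-HIST machines *)

Section Simulation.
Variables (R : realType) (M : parity_hist).
Notation sym := (ph_sym M).
Notation state := (ph_state M).
Notation phase := {ffun ph_sym M -> bool}.

(* A window is [f w1 f w2 ... f wn f], where [w1, ..., wn] carry the symbols of
   the machine's window and the tokens [f] are fences.  Successive occurrences
   of a symbol carry alternating bits; the second field of a token is its update
   bit, the third one gives the bit of the next occurrence of every symbol, and
   the last one the current state, together with the symbol still to be written,
   if any. *)
Definition token : finType :=
  (option (sym * bool) * bool * phase * (state + state * sym))%type.

Definition tok_mark (t : token) := t.1.1.1.
Definition tok_grow (t : token) := t.1.1.2.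
Definition tok_phase (t : token) := t.1.2.

Definition tok_sym (t : token) : option sym := omap fst (tok_mark t).

(** A fence with a pending symbol lies in the middle of a four-token transition: it neither ends a
    block nor probes the window. *)
Definition tok_st (t : token) : option state :=
  match tok_mark t, t.2 with None, inl q => Some q | _, _ => None end.

Definition switch (phi : phase) (a : sym) : phase := [ffun s => phi s (+) (s == a)].

Definition write (a : sym) (g : bool) (phi : phase) p : token :=
  (Some (a, phi a), g, switch phi a, p).

(** A transition writes a symbol and a fence with update bit [0], pushing out the oldest fence and
    symbol; a second symbol, if any, follows with its fence and update bit [1]. A fence copies the
    update bit of the symbol before it. *)
Definition tok_next (t : token) (P : phase) : token :=
  let: (m, g, phi, p) := t in
  match m, p with
  | Some _, _ => (None, g, phi, p)
  | None, inr (q, b) => write b true phi (inl q)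
  | None, inl q =>
      match ph_delta q P with
      | (q', inl a) => write a false phi (inl q')
      | (q', inr (a, b)) => write a false phi (inr (q', b))
      end
  end.

Definition tok_val (t : token) (o : option sym) : int :=
  match o, tok_mark t with
  | None, None => 1
  | None, Some _ => -1
  | Some s, Some (a, b) => if a == s then (-1) ^+ b else 0
  | Some s, None => 0
  end.

(** The bit of the latest occurrence is the negation of that of the next one. An alternating sum of
    odd length equals its last term, so this bit gives the sign to correct. *)
Definition tok_flip (t : token) (s : sym) : bool := ~~ tok_phase t s.

Lemma tok_val_le1 t o : `|tok_val t o| <= 1.
Proof.
rewrite /tok_val; case: o (tok_mark t) => [s|] [[a b]|] //.
by case: eqP => _; rewrite ?normr0 // normrX normrN1 expr1n.
Qed.

Definition sim_swt : swt R :=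
  parity_swt R tok_grow tok_val tok_flip (fun t => isSome (tok_st t)) tok_next.

Definition fence (t : token) := ~~ isSome (tok_mark t).

Fixpoint fenced (C : seq token) : bool :=
  match C with
  | [:: f] => fence f
  | f :: w :: C' => [&& fence f, ~~ fence w & fenced C']
  | [::] => false
  end.

(** Quantifying over all suffixes makes the invariant stable under deletions at the front, whatever
    is deleted. *)
Definition alternating (phi : phase) (C : seq token) := forall j s,
  (-1) ^+ (~~ phi s) * \sum_(w <- drop j C) tok_val w (Some s) =
  (odd (count_mem s (pmap tok_sym (drop j C))))%:Z.

Definition encodes (C : seq token) (c : ph_config M) :=
  [/\ fenced C, pmap tok_sym C = c.2 & exists t,
    [/\ olast C = Some t, tok_st t = Some c.1 & alternating (tok_phase t) C]].

Lemma alternating_nil phi : alternating phi [::].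
Proof. by move=> j s; rewrite big_nil mulr0. Qed.

Lemma alternating_behead phi C : alternating phi C -> alternating phi (behead C).
Proof. by move=> CP j s; rewrite -drop1 drop_drop; exact: CP. Qed.

Lemma drop_rcons_cases (T : Type) j (C : seq T) t :
  drop j (rcons C t) = [::] \/ drop j (rcons C t) = rcons (drop j C) t.
Proof.
have [jC|Cj] := leqP j (size C); first by right; rewrite drop_rcons.
by left; apply: drop_oversize; rewrite size_rcons.
Qed.

Lemma alternating_fence phi C t : fence t -> alternating phi C ->
  alternating phi (rcons C t).
Proof.
rewrite /fence => ft CP j s; have [->|->] := drop_rcons_cases j C t.
  by rewrite big_nil mulr0.
rewrite -cats1 big_cat big_seq1 pmap_cat /= /tok_sym /tok_val.
by case: (tok_mark t) ft => //= _; rewrite addr0 cats0; exact: CP.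
Qed.

(** Let [e] be the sign for [a] times its sum. The new token adds the opposite sign and the sign
    itself flips, so [e] becomes [1 - e], as the parity does. *)
Lemma alternating_write phi C a g p : alternating phi C ->
  alternating (switch phi a) (rcons C (write a g phi p)).
Proof.
move=> CP j s; have [->|->] := drop_rcons_cases j C (write a g phi p).
  by rewrite big_nil mulr0.
rewrite -cats1 big_cat big_seq1 pmap_cat /= count_cat /= /switch ffunE mulrDr.
have := CP j s; rewrite /tok_val /= [s == a]eq_sym; case: eqP => [->|_]; last first.
  by rewrite addbF mulr0 !addr0 !addn0.
rewrite addbT addn0 addn1 oddS => CPj.
have -> : (-1) ^+ (~~ ~~ phi s) = - (-1) ^+ (~~ phi s) :> int by case: (phi s).
rewrite mulNr CPj; case: (phi s); case: (odd _) => //.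
Qed.

Lemma fenced_rcons2 C w f : fenced C -> ~~ fence w -> fence f ->
  fenced (rcons (rcons C w) f).
Proof.
move=> + wP fP; elim: {C}(size C) {-2}C (leqnn (size C)) => [[]//|n IH].
move=> [//|f1 [|w1 C]] /= Cn; first by rewrite wP fP => ->.
case/and3P => -> -> CP; exact: (IH _ (ltnW Cn) CP).
Qed.

Lemma fenced_sum C : fenced C -> \sum_(w <- C) tok_val w None = 1.
Proof.
elim: {C}(size C) {-2}C (leqnn (size C)) => [[]//|n IH].
move=> [//|f1 [|w1 C]] /= Cn.
  by rewrite big_seq1 /fence /tok_val => f1P; case: (tok_mark f1) f1P.
case/and3P => f1P w1P CP; rewrite !big_cons (IH _ (ltnW Cn) CP).
move: f1P w1P; rewrite /fence /tok_val.
by case: (tok_mark f1) => //; case: (tok_mark w1).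
Qed.

Lemma fenced_size C : fenced C -> size C = (size (pmap tok_sym C)).*2.+1.
Proof.
elim: {C}(size C) {-2}C (leqnn (size C)) => [[]//|n IH].
move=> [//|f1 [|w1 C]] /= Cn.
  by rewrite /fence /tok_sym; case: (tok_mark f1).
case/and3P => f1P w1P CP; rewrite (IH _ (ltnW Cn) CP).
move: f1P w1P; rewrite /fence /tok_sym.
by case: (tok_mark f1) => //; case: (tok_mark w1).
Qed.

Lemma fenced_behead2 C : fenced C -> (1 < size C)%N ->
  fenced (behead (behead C)) /\
  pmap tok_sym (behead (behead C)) = behead (pmap tok_sym C).
Proof.
case: C => [|f1 [|w1 C]] //= /and3P[f1P w1P CP] _; split=> //.
move: f1P w1P; rewrite /fence /tok_sym.
by case: (tok_mark f1) => //; case: (tok_mark w1).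
Qed.

(** * Transitions as blocks of generated tokens *)

Definition precise (p m : nat) := exists h, [/\ p = h.*2,
  (net_bound token sym < 2 ^ h.-1)%N & (m < 2 ^ h.-1)%N].

Definition gen (prec : nat -> nat) (o : option (seq token)) : option (seq token) :=
  obind (fun C => swt_step (T := sim_swt) (fixpt (prec (size C)) : R -> R) C) o.

Arguments gen : simpl never.

Section Macro.
Variable prec : nat -> nat.

Lemma gen_plain C t : precise (prec (size C)) (size C) -> olast C = Some t ->
  tok_st t = None ->
  gen prec (Some C) = Some (slide (T := sim_swt) C (tok_next t [ffun=> false])).
Proof.
move=> [h [hE hN hC]] Ct tq; rewrite /gen /= hE /swt_step.
have C0 : (0 < size C)%N by case: (C) Ct.
have := @next_token_plain R token sym tok_grow tok_val tok_flip
  (fun t => isSome (tok_st t)) tok_next tok_val_le1 h hN C t C0 hC Ct.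
by rewrite tq => /(_ isT) ->.
Qed.

Lemma gen_probe C c t : precise (prec (size C)) (size C) -> encodes C c ->
  olast C = Some t -> tok_st t = Some c.1 -> alternating (tok_phase t) C ->
  gen prec (Some C) = Some (slide (T := sim_swt) C (tok_next t (hist_mod2 c.2))).
Proof.
move=> [h [hE hN hC]] [Cf Cw _] Ct tq Ca; rewrite /gen /= hE /swt_step.
have C0 : (0 < size C)%N by case: (C) Ct.
have := @next_token_probe R token sym tok_grow tok_val tok_flip
  (fun t => isSome (tok_st t)) tok_next tok_val_le1 h hN C t C0 hC (hist_mod2 c.2) Ct.
rewrite tq => /(_ isT (fenced_sum Cf)) -> // s.
by have := Ca 0%N s; rewrite drop0 !ffunE Cw.
Qed.

Definition duration (c : ph_config M) : nat :=
  if ph_delta c.1 (hist_mod2 c.2) is (_, inl _) then 2 else 4.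

Lemma olast_rcons (T : Type) (C : seq T) t : olast (rcons C t) = Some t.
Proof. by case: C => //= a C; rewrite last_rcons. Qed.

(** Precision is required up to the length coding the next window: lengths never decrease, so this
    covers all the windows inside the block. *)
Lemma gen_step C c : encodes C c -> c.1 != ph_halt M ->
  (forall m, (m <= (size (ph_step c).2).*2.+1)%N -> precise (prec m) m) ->
  (exists2 C', iter (duration c) (gen prec) (Some C) = Some C' & encodes C' (ph_step c)) /\
  forall i, (0 < i < duration c)%N -> exists2 D,
    iter i (gen prec) (Some C) = Some D & obind tok_st (olast D) = None.
Proof.
move=> CP ch; have [Cf Cw [t [Ct tq Ca]]] := CP.
have Cs := fenced_size Cf; rewrite Cw in Cs.
have C0 : (0 < size C)%N by rewrite Cs.
have g1 := @gen_probe C c t _ CP Ct tq Ca.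
rewrite /ph_step (negPf ch) /duration.
have tE : t = (None, tok_grow t, tok_phase t, inl c.1).
  move: tq; rewrite /tok_st /tok_grow /tok_phase /tok_mark.
  by case: (t) => [[[[m|] g] f] [q|qb]] //= [->].
move: g1; rewrite [in tok_next _ _]tE /=.
set phi := tok_phase t in Ca *; case dE: (ph_delta _ _) => [q' a] /=.
pose a0 := match a with inl a => a | inr (a, _) => a end.
pose p0 : state + state * sym := match a with inl a => inl q' | inr (_, b) => inr (q', b) end.
have -> : match a with inl a => write a false phi (inl q')
   | inr (a, b) => write a false phi (inr (q', b)) end = write a0 false phi p0.
  by rewrite /a0 /p0; case: (a) => [|[]].
set w1 := write a0 false phi p0 => g1.
pose w2 : token := (None, false, switch phi a0, p0).
pose C1 := rcons (behead C) w1; pose C2 := rcons (behead C1) w2.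
(* Appending both tokens before deleting two gives the same window, and splits the invariants into a
   writing and a deleting part. This also covers an empty machine window, where the symbol just
   written is the one deleted. *)
pose D := rcons (rcons C w1) w2.
have C2E : C2 = behead (behead D).
  by rewrite /C2 /C1 /D; case: (C) C0 => // f [|w C'].
have Df : fenced D by apply: fenced_rcons2.
have Ds : (1 < size D)%N by rewrite !size_rcons.
have [C2f C2w] := fenced_behead2 Df Ds; rewrite -C2E in C2f C2w.
have DA : alternating (switch phi a0) D.
  by apply: alternating_fence => //; exact: alternating_write.
have C2A : alternating (switch phi a0) C2.
  by rewrite C2E; do 2!apply: alternating_behead.
have Dw : pmap tok_sym D = rcons c.2 a0.
  by rewrite /D -!cats1 !pmap_cat /= Cw cats0.
rewrite Dw in C2w.
have sC1 : size C1 = size C by rewrite size_rcons size_behead prednK.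
have sC2 : size C2 = size C by rewrite size_rcons size_behead sC1 prednK.
have szW : ((size c.2).*2.+1 <= (size (behead (c.2 ++ word_of a))).*2.+1)%N.
  by rewrite size_behead size_cat; case: (a) => [|[]] /=; lia.
move=> prP.
have {}g1 : gen prec (Some C) = Some C1 by apply: g1; apply: prP; rewrite Cs.
have g2 : gen prec (Some C1) = Some C2.
  rewrite (@gen_plain _ w1) ?olast_rcons //.
  by apply: prP; rewrite sC1 Cs.
have n1 : obind tok_st (olast C1) = None by rewrite olast_rcons.
have last2 := olast_rcons (behead C1) w2.
case: a @a0 @p0 dE @w1 @w2 @C1 @C2 @D C2E Df Ds C2f C2w DA C2A Dw sC1 sC2 szW prP g1 g2 n1 last2
  => [a|[a b]] a0 p0 dE w1 w2 C1 C2 D C2E Df Ds C2f C2w DA C2A Dw sC1 sC2 szW prP g1 g2 n1 last2.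
  split; last first.
    move=> i i2; have -> : i = 1%N by lia.
    by exists C1.
  exists C2; first by rewrite /= g1 g2.
  split=> //=; first by rewrite cats1.
  by exists w2; split.
pose w3 := write b true (switch phi a0) (inl q').
pose w4 : token := (None, true, switch (switch phi a0) b, inl q').
have g3 : gen prec (Some C2) = Some (rcons C2 w3).
  rewrite (@gen_plain _ w2) //.
  by apply: prP; rewrite sC2 Cs.
have g4 : gen prec (Some (rcons C2 w3)) = Some (rcons (rcons C2 w3) w4).
  rewrite (@gen_plain _ w3) ?olast_rcons //.
  apply: prP; rewrite size_rcons sC2 Cs size_behead size_cat /=; lia.
split; last first.
  move=> i i4; have [->|[->|->]] : i = 1%N \/ i = 2%N \/ i = 3%N by lia.
  - by exists C1.
  - by exists C2; rewrite /= ?g1 // last2.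
  - by exists (rcons C2 w3); rewrite /= ?g1 ?g2 ?g3 // olast_rcons.
exists (rcons (rcons C2 w3) w4); first by rewrite /= g1 g2 g3 g4.
split=> /=.
- exact: fenced_rcons2.
- rewrite -!cats1 !pmap_cat C2w /= cats0; case: (c.2) => //= s W.
  by rewrite -cats1 -catA.
- exists w4; rewrite olast_rcons; split=> //.
  by apply: alternating_fence => //; exact: alternating_write.
Qed.

End Macro.

Definition sym_of_bit (b : bool) : sym := if b then ph_one M else ph_zero M.

Definition start_fence (phi : phase) : token := (None, false, phi, inl (ph_start M)).

Definition sim_prompter : prompter token :=
  {| pr_init := [ffun=> false] : phase;
     pr_next := fun phi b => switch phi (sym_of_bit b);
     pr_out := fun phi b =>
       [:: start_fence phi; write (sym_of_bit b) false phi (inl (ph_start M))];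
     pr_final := fun phi => [:: start_fence phi] |}.

Lemma encodes_prompt x : encodes (prompt sim_prompter x) (ph_run M x 0).
Proof.
suff h phi D : alternating phi D -> (forall f, fence f -> fenced (rcons D f)) ->
    let C := D ++ prompt_from (E := sim_prompter) phi x in
    [/\ fenced C, pmap tok_sym C = pmap tok_sym D ++ ph_input M x & exists t,
      [/\ olast C = Some t, tok_st t = Some (ph_start M) & alternating (tok_phase t) C]].
  by have := h [ffun=> false] [::] (@alternating_nil _) (fun f fP => fP).
elim: x phi D => [|b x IH] phi D DA Df /=.
  rewrite cats1; split; first exact: Df.
    by rewrite -cats1 pmap_cat.
  exists (start_fence phi); rewrite olast_rcons; split=> //.
  exact: alternating_fence.
rewrite -cat_rcons -cat_rcons.
have [||h1 h2 h3] := IH (switch phi (sym_of_bit b)) (rcons (rcons D (start_fence phi))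
    (write (sym_of_bit b) false phi (inl (ph_start M)))).
- by apply: alternating_write; exact: alternating_fence.
- by move=> f fP; apply: fenced_rcons2 => //; exact: Df.
split=> //; rewrite h2 -!cats1 !pmap_cat /= cats0 -catA; congr (_ ++ (_ :: _)).
Qed.

Definition sim_time (x : seq bool) (s : nat) : nat :=
  \sum_(i < s) duration (ph_run M x i).

Lemma sim_timeS x s : sim_time x s.+1 = (sim_time x s + duration (ph_run M x s))%N.
Proof. by rewrite /sim_time big_ord_recr. Qed.

Lemma sim_run prec x t :
  (forall s, (s < t)%N -> (ph_run M x s).1 != ph_halt M) ->
  (forall s m, (s <= t)%N -> (m <= (size (ph_run M x s).2).*2.+1)%N ->
     precise (prec m) m) ->
  (forall s, (s <= t)%N -> exists2 C,
     swt_run (T := sim_swt) prec (prompt sim_prompter x) (sim_time x s) = Some C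
     & encodes C (ph_run M x s)) /\
  (forall s i, (s < t)%N -> (sim_time x s < i < sim_time x s.+1)%N -> exists2 C,
     swt_run (T := sim_swt) prec (prompt sim_prompter x) i = Some C
     & obind tok_st (olast C) = None).
Proof.
move=> nh pr.
have runD i j : swt_run (T := sim_swt) prec (prompt sim_prompter x) (i + j) =
    iter j (gen prec) (swt_run (T := sim_swt) prec (prompt sim_prompter x) i).
  by rewrite addnC /swt_run iterD.
have main s : (s <= t)%N -> exists2 C,
     swt_run (T := sim_swt) prec (prompt sim_prompter x) (sim_time x s) = Some C
     & encodes C (ph_run M x s).
  elim: s => [_|s IH st].
    by rewrite /sim_time big_ord0; eexists; [reflexivity|exact: encodes_prompt].
  have [C CE CP] := IH (ltnW st).
  have [[C' C'E C'P] _] := gen_step CP (nh s st) (fun m => pr s.+1 m st).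
  by exists C'; rewrite // sim_timeS runD CE.
split=> // s i st; rewrite sim_timeS => i12.
have [C CE CP] := main s (ltnW st).
have [_ mid] := gen_step CP (nh s st) (fun m => pr s.+1 m st).
have [|D DE DP] := mid (i - sim_time x s)%N; first by lia.
by exists D => //; rewrite -(subnKC (n := i) (m := sim_time x s)) ?runD ?CE //; lia.
Qed.

(** Half of the bits, [h = (N + 4) * (trunc_log 2 n).+1] with [N] the network bound, must make
    [2 ^ (h - 1)] exceed both [N] and the length [2 * n + 1] of the fenced window; the summand [4]
    pays for the latter. *)
Definition sim_bits : nat := (net_bound token sym + 4).*2.

Lemma precise_log n m : (m <= n.*2.+1)%N -> precise (log_bits sim_bits n) m.
Proof.
move=> mn; set N := net_bound token sym.
exists ((N + 4) * (trunc_log 2 n).+1)%N; split.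
- by rewrite /log_bits /sim_bits -/N -!mul2n mulnA.
- apply: leq_trans (ltn_expl N (isT : 1 < 2)%N) _.
  by rewrite leq_exp2l // -/N; nia.
- have nl := trunc_log_ltn n (isT : (1 < 2)%N).
  have le : (2 ^ (2 + (trunc_log 2 n).+1) <= 2 ^ ((N + 4) * (trunc_log 2 n).+1).-1)%N.
    by rewrite leq_exp2l //; nia.
  apply: leq_trans le; rewrite expnD (_ : (2 ^ 2 = 4)%N) //; lia.
Qed.

Theorem sim_swt_simulates : simulates sim_swt M.
Proof.
exists sim_prompter, tok_sym, tok_st, 4, sim_bits => x S t nh szS.
have [|run mid] := @sim_run (fun=> log_bits sim_bits S) x t nh.
  by move=> s m st /leq_trans mS; apply/precise_log/mS; rewrite ltnS leq_double szS.
exists (sim_time x); split=> //.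
- by rewrite /sim_time big_ord0.
- move=> s st; have [C CE [_ Cw [u [Cu uq _]]]] := run s st.
  by exists C => //; split; rewrite // Cu.
- move=> s st; rewrite sim_timeS /duration.
  by case: (ph_delta _ _) => q [a|ab]; lia.
Qed.

End Simulation.

(** * Answers of a simulated parity-HIST machine *)

Local Open Scope nat_scope.

Section Answer.
Variables (R : realType) (M : parity_hist) (qans : ph_state M -> option bool).
Variable x : seq bool.
Hypothesis not_halting : forall s, (ph_run M x s).1 != ph_halt M.
Hypothesis qans_start : qans (ph_start M) = None.
Hypothesis qans_fun : forall s s' b b', qans (ph_run M x s).1 = Some b ->
  qans (ph_run M x s').1 = Some b' -> b = b'.

Let token_at i := obind (@olast _) (swt_run (T := sim_swt R M)
  (log_bits (sim_bits M)) (prompt (sim_prompter M) x) i).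

Let ans (t : token M) := obind qans (tok_st t).

Lemma sim_answers : (forall s, obind ans (token_at (sim_time M x s)) = qans (ph_run M x s).1) /\
  (forall s i, sim_time M x s < i < sim_time M x s.+1 -> obind ans (token_at i) = None).
Proof.
have pr m : precise M (log_bits (sim_bits M) m) m by apply: precise_log; lia.
have run t := @sim_run R M (log_bits (sim_bits M)) x t (fun s _ => not_halting s)
  (fun s m _ _ => pr m).
split=> [s|s i si].
  have [/(_ s (leqnn s))[C CE [_ _ [t [Ct tq _]]]] _] := run s.
  by rewrite /token_at CE /= Ct /= /ans tq.
have [_ /(_ s i (ltnSn s) si)[C CE]] := run s.+1.
by rewrite /token_at CE /=; case: (olast C) => //= t; rewrite /ans => ->.
Qed.

(** Every generated token belongs to some block, so no answer can appear that does not come from a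
    configuration. *)
Lemma sim_time_cover i : exists s, sim_time M x s <= i < sim_time M x s.+1.
Proof.
have dur s : sim_time M x s < sim_time M x s.+1.
  by rewrite sim_timeS /duration; case: (ph_delta _ _) => q [a|ab]; lia.
elim: i => [|i [s /andP[s1 s2]]].
  have t0 : sim_time M x 0 = 0 by rewrite /sim_time big_ord0.
  by exists 0; have := dur 0; rewrite t0 => ->.
have [lt|ge] := ltnP i.+1 (sim_time M x s.+1); first by exists s; lia.
by exists s.+1; have := dur s.+1; lia.
Qed.

Lemma sim_answer b : swt_answer (T := sim_swt R M) (log_bits (sim_bits M)) ans
    (prompt (sim_prompter M) x) b <-> exists s, qans (ph_run M x s).1 = Some b.
Proof.
have [aE aN] := sim_answers.
have ansP i b' : obind ans (token_at i) = Some b' ->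
      exists s, qans (ph_run M x s).1 = Some b'.
  move=> ib; have [s /andP[s1 s2]] := sim_time_cover i; exists s; rewrite -aE.
  move: s1; rewrite leq_eqVlt => /orP[/eqP -> //|s1].
  by move: ib; rewrite (aN s i) // s1 s2.
split=> [[i iP _]|[s sb]]; first exact: ansP iP.
(* Time [0] is the prompt, whose last token is not a generated one; [qans_start] ensures that no
   answer is missed there. *)
have s0 : 0 < sim_time M x s.
  case: s sb => [|s _]; first by rewrite /ph_run /= qans_start.
  by rewrite sim_timeS /duration; case: (ph_delta _ _) => q [a|ab]; lia.
have ex : exists i, obind ans (token_at i.+1) != None.
  by exists (sim_time M x s).-1; rewrite prednK // aE sb.
case: (ex_minnP ex) => i; case iE: (obind ans _) => [b'|//] _ imin.
exists i.
  by rewrite -/(token_at i.+1) iE; have [s' s'b] := ansP _ _ iE; rewrite (qans_fun s'b sb).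
move=> j ji; rewrite -/(token_at j.+1); apply/eqP; apply: contraTT ji => /imin.
by rewrite -leqNgt.
Qed.

End Answer.

(** * Turing machines as parity-HIST machines *)

Section Queue.
Variable M : turing_machine.

(* The tape is a circular word, ended by [EndM], in which the scanned cell is
   marked; to mark the left neighbour of the scanned cell, the whole word is
   rotated with a delay of one symbol, the [Hole] standing for the symbol that is
   being held. *)
Definition qsym : finType := (bool + bool * tm_sym M)%type.
Definition EndM : qsym := inl true.
Definition Hole : qsym := inl false.
Definition Cell (s : tm_sym M) : qsym := inr (false, s).
Definition Mark (s : tm_sym M) : qsym := inr (true, s).

(** [Seek] rotates until the scanned cell comes to the front, [MarkNext] completes a move to the
    right, and [Shift a] is the delayed rotation, holding [a], for a move to the left. *)
Variant mode := Seek | MarkNext | Shift of qsym.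
Definition mode_code (m : mode) : option (option qsym) :=
  match m with Seek => None | MarkNext => Some None | Shift a => Some (Some a) end.
Definition mode_decode (m : option (option qsym)) : mode :=
  match m with None => Seek | Some None => MarkNext | Some (Some a) => Shift a end.
Lemma mode_codeK : cancel mode_code mode_decode. Proof. by case. Qed.
HB.instance Definition _ := Countable.copy mode (can_type mode_codeK).
HB.instance Definition _ : isFinite mode := CanIsFinite mode_codeK.

Definition tm_halting (q : tm_state M) := (q == tm_accept M) || (q == tm_reject M).

(** A halted machine is made to stay put, so the rotation goes on forever and the answer remains in
    the state. *)
Definition tm_next (q : tm_state M) (s : tm_sym M) :=
  if tm_halting q then (q, s, Stay) else tm_delta q s.

Definition qctrl : finType := (tm_state M * mode)%type.

(** The two ends of the tape meet at the end marker. Finding it as the neighbour to be marked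
    inserts a blank cell on the proper side, the only case in which two symbols are written. *)
Definition qdelta (c : qctrl) (a : qsym) : qctrl * (qsym + qsym * qsym) :=
  let: (q, m) := c in
  match m, a with
  | Seek, inr (true, s) =>
      match tm_next q s with
      | (q', s', Stay) => ((q', Seek), inl (Mark s'))
      | (q', s', MoveRight) => ((q', MarkNext), inl (Cell s'))
      | (q', s', MoveLeft) => ((q', Shift (Cell s')), inl Hole)
      end
  | Seek, _ => (c, inl a)
  | MarkNext, inr (_, s) => ((q, Seek), inl (Mark s))
  | MarkNext, inl _ => ((q, Seek), inr (Mark (tm_blank M), EndM))
  | Shift (inr (_, s)), inl false => ((q, Seek), inl (Mark s))
  | Shift (inl _), inl false => ((q, Seek), inr (EndM, Mark (tm_blank M)))
  | Shift b, _ => ((q, Shift a), inl b)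
  end.

Definition qconf := (qctrl * seq qsym)%type.

Definition qstep (y : qconf) : qconf :=
  if y.2 is a :: w then
    let: (c, b) := qdelta y.1 a in (c, w ++ word_of b)
  else y.

Definition reaches (y z : qconf) := exists n, iter n qstep y = z.

Lemma reaches_trans y z t : reaches y z -> reaches z t -> reaches y t.
Proof. by move=> [n <-] [m <-]; exists (m + n); rewrite iterD. Qed.

Lemma reaches_step y : reaches y (qstep y).
Proof. by exists 1. Qed.

Definition unmarked (a : qsym) := if a is inr (true, _) then false else true.

Lemma seek_rotate q u v : all unmarked u ->
  reaches ((q, Seek), u ++ v) ((q, Seek), v ++ u).
Proof.
elim: u v => [|a u IH] v /=; first by exists 0; rewrite cats0.
case/andP => au uP; apply: reaches_trans (reaches_step _) _.
have -> : qstep (q, Seek, a :: u ++ v) = (q, Seek, u ++ (v ++ [:: a])).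
  by rewrite /qstep /= catA; case: a au => [|[[]]].
have := IH (v ++ [:: a]) uP; by rewrite -catA.
Qed.

Lemma shift_rotate q b u v : Hole \notin u ->
  reaches ((q, Shift b), u ++ v) ((q, Shift (last b u)), v ++ belast b u).
Proof.
elim: u b v => [|a u IH] b v /=; first by exists 0; rewrite cats0.
rewrite inE negb_or => /andP[au uP]; apply: reaches_trans (reaches_step _) _.
have -> : qstep (q, Shift b, a :: u ++ v) = (q, Shift a, u ++ (v ++ [:: b])).
  by rewrite /qstep /= catA; case: a b au => [[]|p] [?|[]].
have := IH a (v ++ [:: b]) uP; by rewrite -catA.
Qed.

Definition circ (l r : seq (tm_sym M)) : seq qsym :=
  Mark (head (tm_blank M) r) :: map Cell (behead r) ++ EndM :: map Cell (rev l).

Lemma unmarked_cells s : all unmarked (map Cell s).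
Proof. by elim: s. Qed.

Lemma hole_cells s : (Hole \in map Cell s) = false.
Proof. by apply/negP => /mapP[]. Qed.

Lemma queue_tm_step (c : tm_config M) :
  let q' := (tm_step c).1.1 in let l' := (tm_step c).1.2 in let r' := (tm_step c).2 in
  reaches (qstep ((c.1.1, Seek), circ c.1.2 c.2)) ((q', Seek), circ l' r').
Proof.
case: c => [[q l] r] /=; rewrite -/(tm_halting q); set s := head _ r.
rewrite /qstep /= -/s /tm_next.
have stay a q0 : reaches (q0, Seek, (map Cell (behead r) ++ EndM :: map Cell (rev l)) ++ [:: Mark a])
    (q0, Seek, circ l (a :: behead r)).
  by apply: seek_rotate; rewrite all_cat /= !unmarked_cells.
case: ifP => _; first exact: stay.
case: (tm_delta q s) => [[q' a] []] /=; last exact: stay.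
(* When the [Hole] reaches the front, the symbol held is the last one of the circle, which is the
   left neighbour of the scanned cell. *)
- set u := map Cell (behead r) ++ EndM :: map Cell (rev l); apply: reaches_trans (shift_rotate _ _ _ _) _.
    by rewrite /u mem_cat inE !hole_cells.
  apply: reaches_trans (reaches_step _) _.
  case: l @u {stay} => [|s' l'] u.
    have -> : u = rcons (map Cell (behead r)) EndM by rewrite /u -cats1.
    rewrite last_rcons belast_rcons /qstep /=.
    have := @seek_rotate q' ((Cell a :: map Cell (behead r)) ++ [:: EndM])
      [:: Mark (tm_blank M)].
    by rewrite -catA; apply; rewrite all_cat /= unmarked_cells.
  have -> : u = rcons (map Cell (behead r) ++ EndM :: map Cell (rev l')) (Cell s').
    by rewrite /u rev_cons map_rcons rcons_cat.
  rewrite last_rcons belast_rcons /qstep.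
  by apply: (@seek_rotate _ (Cell a :: _)); rewrite /= all_cat /= !unmarked_cells.
- apply: reaches_trans (reaches_step _) _; rewrite /qstep.
  have cE s' r' : Mark s' :: map Cell r' ++ EndM :: map Cell (rev (a :: l)) =
      [:: Mark s'] ++ ((map Cell r' ++ EndM :: map Cell (rev l)) ++ [:: Cell a]).
    by rewrite rev_cons map_rcons -cats1 /= -catA.
  case: (behead r) => [|s' r'] /=.
    rewrite /circ rev_cons map_rcons -cats1.
    apply: (@seek_rotate _ _ [:: Mark (tm_blank M); EndM]).
    by rewrite all_cat /= unmarked_cells.
  rewrite /circ /= cE; apply: seek_rotate.
  by rewrite !all_cat /= !unmarked_cells.
Qed.

Definition qstart (x : seq bool) : qconf :=
  ((tm_start M, MarkNext), map Cell (tm_input M x) ++ [:: EndM]).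

Lemma queue_start x : reaches (qstart x)
  ((tm_start M, Seek), circ [::] (tm_input M x)).
Proof.
apply: reaches_trans (reaches_step _) _; rewrite /qstart /qstep.
case: (tm_input M x) => [|s w] /=; first by exists 0.
by apply: seek_rotate; rewrite all_cat /= unmarked_cells.
Qed.

(** The state changes before the rotation ends, so an answer may show up between two aligned
    configurations. The bound [t <= n] gives aligned ones late enough to compare with. *)
Lemma queue_tm_run x t : exists2 n, t <= n & iter n qstep (qstart x) =
  (((tm_run M x t).1.1, Seek), circ (tm_run M x t).1.2 (tm_run M x t).2).
Proof.
elim: t => [|t [n tn nE]]; first by have [n nE] := queue_start x; exists n.
have [m mE] := queue_tm_step (tm_run M x t).
exists (m + n.+1); last by rewrite iterD iterS nE mE.
by rewrite addnS ltnS (leq_trans tn) ?leq_addl.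
Qed.

Lemma qstep_halting y n : tm_halting y.1.1 -> (iter n qstep y).1.1 = y.1.1.
Proof.
move=> yh; suff h z : z.1.1 = y.1.1 -> (qstep z).1.1 = y.1.1.
  by elim: n => //= n IH; exact: h.
case: z => [[q m] [|a w]] //= qy; rewrite /qstep /=.
have qn s : tm_next q s = (q, s, Stay) by rewrite /tm_next qy yh.
case: m => [||[c|[d c]]]; case: a => [[]|[[] s]] //=.
by rewrite qn.
Qed.

Lemma queue_answer x b : tm_answer M x b <->
  exists n, (iter n qstep (qstart x)).1.1 = if b then tm_accept M else tm_reject M.
Proof.
split=> [[t tE]|[n nE]].
  by have [n _ nE] := queue_tm_run x t; exists n; rewrite nE.
have [m nm mE] := queue_tm_run x n; exists n.
have h : tm_halting (iter n qstep (qstart x)).1.1.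
  by rewrite nE /tm_halting; case: (b); rewrite eqxx ?orbT.
by have := qstep_halting (m - n) h; rewrite -iterD subnK // mE /= nE => ->.
Qed.

(** [None] is the start, where no parities have been recorded yet; [Some None] is the halting state,
    which is never entered. *)
Definition pstate : finType := option (option (qctrl * {ffun qsym -> bool})).

Definition pdelta (s : pstate) (rho : {ffun qsym -> bool}) :
    pstate * (qsym + qsym * qsym) :=
  match s with
  | None => (Some (Some ((tm_start M, MarkNext),
                         [ffun a => rho a (+) (a == EndM)])), inl EndM)
  | Some None => (Some None, inl EndM)
  | Some (Some (c, pi)) =>
      let: (c', b) := qdelta c (odflt EndM [pick a | pi a != rho a]) in
      (Some (Some (c', [ffun a => rho a (+) odd (count_mem a (word_of b))])), b)
  end.

Lemma qsym_uniq : uniq [:: Hole; EndM; Cell (tm_zero M); Cell (tm_one M)].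
Proof.
have := tm_sym_uniq M; rewrite /= !inE !andbT => /andP[_ zo] /=.
by apply: contraNN zo => /eqP[->].
Qed.

(* A control state of the queue automaton is paired with the parities of the
   window before its first symbol was deleted, so that comparing them with the
   current ones reveals that symbol. *)
Definition parity_of_tm : parity_hist :=
  @ParityHist qsym Hole EndM (Cell (tm_zero M)) (Cell (tm_one M)) qsym_uniq
    pstate None (Some None) pdelta.

(** The parity-HIST machine loses a symbol one step before the queue automaton reads it: hence the
    shift to [n.+1], and a window [w] from which [a] is already gone. *)
Lemma parity_run x n : exists c a w,
  iter n qstep (qstart x) = (c, a :: w) /\
  ph_run parity_of_tm x n.+1 = (Some (Some (c, hist_mod2 (a :: w))), w).
Proof.
have inE' : ph_input parity_of_tm x = map Cell (tm_input M x).
  by rewrite /ph_input /tm_input -map_comp; apply: eq_map => -[].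
have behE (w : seq qsym) b : exists a w', w ++ word_of b = a :: w' /\
    behead (w ++ word_of b) = w'.
  by case: w b => [|a w] [a'|[a' b']] /=; do 2!eexists; split; reflexivity.
elim: n => [|n [c [a [w [qE pE]]]]].
  have [a [w [wE wE']]] := behE (map Cell (tm_input M x)) (inl EndM).
  exists (tm_start M, MarkNext), a, w; split; first by rewrite /= /qstart wE.
  rewrite /ph_run /= /ph_step /= inE' wE'; congr (Some (Some (_, _)), _).
  apply/ffunP => d; rewrite !ffunE -wE count_cat oddD /= addn0 [EndM == d]eq_sym.
  by case: (d == EndM).
case dE: (qdelta c a) => [c' b].
have [a' [w' [wE wE']]] := behE w b.
exists c', a', w'; split; first by rewrite iterS qE /qstep /= dE wE.
rewrite /ph_run iterS -/(ph_run parity_of_tm x n.+1) pE /ph_step /=.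
have -> : odflt EndM [pick d | hist_mod2 (a :: w) d != hist_mod2 w d] = a.
  case: pickP => [d|/(_ a)] /=.
    rewrite !ffunE /= oddD; case: (eqVneq a d) => //= _; by rewrite eqxx.
  by rewrite !ffunE /= eqxx oddD; case: (odd (count_mem a w)).
rewrite dE /= wE'; congr (Some (Some (_, _)), _).
by apply/ffunP => d; rewrite !ffunE -wE count_cat oddD.
Qed.

Definition panswer (s : pstate) : option bool :=
  if s is Some (Some ((q, _), _)) then
    if q == tm_accept M then Some true
    else if q == tm_reject M then Some false else None
  else None.

Lemma parity_answer x b : tm_answer M x b <->
  exists s, panswer (ph_run parity_of_tm x s).1 = Some b.
Proof.
rewrite queue_answer; split=> [[n nE]|[[//|n]]].
  exists n.+1; have [c [a [w [qE ->]]]] := parity_run x n.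
  move: nE; rewrite qE /=; case: c {qE} => q m /= ->.
  case: b; first by rewrite eqxx.
  by rewrite eqxx eq_sym (negPf (tm_answers M)).
have [c [a [w [qE ->]]]] := parity_run x n; rewrite /panswer /=.
case: c qE => q m qE; case: eqP => [qa [<-]|_]; first by exists n; rewrite qE.
by case: eqP => // qr [<-]; exists n; rewrite qE.
Qed.

Lemma parity_not_halting x s : (ph_run parity_of_tm x s).1 != ph_halt parity_of_tm.
Proof.
by case: s => [//|s]; have [c [a [w [_ ->]]]] := parity_run x s.
Qed.

End Queue.

Theorem tm_computable_swt (R : realType) (f : problem) :
  tm_computable f -> swt_computable R f.
Proof.
move=> [M fE]; pose P := parity_of_tm M.
exists (sim_swt R P), (sim_prompter P),
  (fun t : token P => obind (@panswer M) (tok_st t)), (sim_bits P).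
split; first exact: parity_swt_finite.
move=> x b; rewrite sim_answer.
- by rewrite -parity_answer.
- exact: parity_not_halting.
- by [].
- move=> s s' b1 b2 h1 h2; apply: (@tm_answer_fun M x).
    by apply/parity_answer; exists s.
  by apply/parity_answer; exists s'.
Qed.

Theorem theorem2 (R : realType) :
  (forall M : parity_hist,
     exists T : swt R, finite_params T /\ simulates T M) /\
  turing_complete (swt_computable R).
Proof.
split=> [M|f].
  exists (sim_swt R M); split; [exact: parity_swt_finite|exact: sim_swt_simulates].
by split; [exact: swt_computable_tm|exact: tm_computable_swt].
Qed.
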